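(* Let $U,V,W\subset\mathbb{C}$ be nonempty compact sets and $p\in[1,\infty]$, with the bi-infinite and semi-infinite matrices below acting on $\ell^p(\mathbb{Z})$ and $\ell^p(\mathbb{N})$, respectively. Suppose that one (equivalently, each) of the following equivalent conditions holds: (a) the full finite section method (FSM) applies to one operator in $\Psi E(U,V,W)$; (b) the full FSM applies to one operator in $\Psi E_+(U,V,W)$; (c) all operators in $M_+(U,V,W)$ are invertible; (d) all operators in $M_+(U,V,W)$ are invertible, and the inverses are uniformly bounded; (e) one operator in $\Psi E_+(U,V,W)$ is invertible; (f) $0\notin\Sigma_+$; (g) one operator in $\Psi E_+(U,V,W)$ is Fredholm with index $0$; (h) all operators in $M_+(U,V,W)$ are Fredholm with index $0$; (i) $(U,V,W)$ is compatible and $\kappa(U,V,W)=0$; (j) the full FSM applies to all operators in $M(U,V,W)$; (k) the full FSM applies to all operators in $M_+(U,V,W)$. Then all finite Jacobi matrices over $U$, $V$ and $W$, that is, all $F\in M_{\rm fin}(U,V,W)$, are invertible.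
   Context: $\mathbb{N}=\{1,2,\dots\}$. $M(U,V,W)$ is the set of bi-infinite tridiagonal matrices $A=(a_{ij})_{i,j\in\mathbb{Z}}$ with $a_{i,i-1}\in U$, $a_{i,i}\in V$, $a_{i,i+1}\in W$ for all $i$, all other entries zero. $M_+(U,V,W)$ is the set of semi-infinite tridiagonal matrices $(a_{ij})_{i,j\in\mathbb{N}}$ with subdiagonal entries in $U$, diagonal entries in $V$, superdiagonal entries in $W$, all other entries zero. $M_n(U,V,W)$ is the set of $n\times n$ matrices of the same kind, and $M_{\rm fin}(U,V,W)=\bigcup_{n\in\mathbb{N}}M_n(U,V,W)$. Invertibility, spectra, Fredholmness and Fredholm index of the bi- and semi-infinite ones do not depend on $p$. The index of a Fredholm operator is the dimension of its null space minus the codimension of its image. $A\in M(U,V,W)$ is pseudoergodic, $A\in \Psi E(U,V,W)$, if for every $n\in\mathbb N$, every $B\in M_n(U,V,W)$ and every $\varepsilon>0$ there is a submatrix $C$ of $A$ composed of rows and columns $k+1,\dots,k+n$ of $A$, for some integer $k$, with $\|B-C\|<\varepsilon$; $\Psi E_+(U,V,W)\subset M_+(U,V,W)$ is defined in the same way. $(U,V,W)$ is compatible if all operators in $M(U,V,W)$ are invertible (known to be equivalent to: one operator in $\Psi E(U,V,W)$ is Fredholm; one operator in $\Psi E(U,V,W)$ is invertible; all operators in $M(U,V,W)$ are Fredholm; one operator in $\Psi E_+(U,V,W)$ is Fredholm; all operators in $M_+(U,V,W)$ are Fredholm). If $(U,V,W)$ is compatible, all $B_+\in M_+(U,V,W)$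 are Fredholm with one and the same index, denoted $\kappa(U,V,W)\in\{-1,0,1\}$. $\Sigma_+:=\bigcup_{C_+\in M_+(U,V,W)}\operatorname{spec}C_+$, which equals $\operatorname{spec}B_+$ for every $B_+\in\Psi E_+(U,V,W)$. FSM: for $A=(a_{ij})_{i,j\in\mathbb Z}$ and integer cut-off sequences $l_n\to-\infty$, $r_n\to+\infty$, the equation $Ax=b$ is replaced by $\sum_{l_n\le j\le r_n}a_{ij}x_n(j)=b(i)$, $l_n\le i\le r_n$. The FSM applies to $A$ if $A$ is invertible, the truncated systems are uniquely solvable for all sufficiently large $n$ and every $b$, and, for every $b$, the solutions $x_n$ (extended by zero) approximate the solution $x$ of $Ax=b$: $\|x_n-x\|\to0$ if $p<\infty$; $\|x_n\|=O(1)$ and $x_n(j)\to x(j)$ for every $j$ if $p=\infty$. For semi-infinite matrices the same definition is used with $l_n=1$. The full FSM is the choice $l_n=-n$, $r_n=n$ for bi-infinite matrices, and $l_n=1$, $r_n=n$ for semi-infinite matrices. *)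

(* Defs.v *)
From HB Require Import structures.
From mathcomp Require Import all_boot all_order all_algebra.
From mathcomp Require Import complex.
From mathcomp Require Import all_classical all_reals all_analysis.

Set Implicit Arguments.
Unset Strict Implicit.
Unset Printing Implicit Defensive.
Import Order.TTheory GRing.Theory Num.Theory.
Import numFieldNormedType.Exports.

Local Open Scope classical_set_scope.
Local Open Scope ring_scope.

(** The space l^p(I), for I = int (bi-infinite) or I = nat (semi-infinite).
    The positive integers are represented by [nat], the row or column number i
    of the mathematical text being the index i - 1 here. *)
Section Lp.
Context {R : realType} {I : choiceType}.
Implicit Types (p : \bar R) (x y : I -> R[i]).

(* Meant for 1 <= p <= +oo; the value at p = -oo is irrelevant. *)
Definition lpnorm p x : \bar R :=
  match p with
  | r%:E => ((\esum_(i in [set: I]) (Normc.normc (x i) `^ r)%:E)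
               `^ r^-1)%E
  | _ => ereal_sup (range (fun i => (Normc.normc (x i))%:E))
  end.

Definition lp p : set (I -> R[i]) := [set x | (lpnorm p x < +oo)%E].

Definition bounded_linear p (M : R) (T : (I -> R[i]) -> I -> R[i]) : Prop :=
  (forall (a : R[i]) x y, lp p x -> lp p y ->
     T (fun i => a * x i + y i) = (fun i => a * T x i + T y i)) /\
  (forall x, lp p x -> lp p (T x) /\ (lpnorm p (T x) <= M%:E * lpnorm p x)%E).

(* The sum is the finitely supported sum of fsbigop; it is the matrix product
   as soon as the rows of A have finite support, as for tridiagonal A. *)
Definition mxact (A : I -> I -> R[i]) x : I -> R[i] :=
  fun i => \sum_(j \in [set: I]) (A i j * x j).

Definition inverse_on p (A : I -> I -> R[i]) (B : (I -> R[i]) -> I -> R[i])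
    : Prop :=
  forall x, lp p x -> mxact A (B x) = x /\ B (mxact A x) = x.

Definition invertible_with_bound p (M : R) (A : I -> I -> R[i]) : Prop :=
  exists B, bounded_linear p M B /\ inverse_on p A B.

Definition invertible p (A : I -> I -> R[i]) : Prop :=
  exists M : R, invertible_with_bound p M A.

Definition spec p (A : I -> I -> R[i]) : set R[i] :=
  [set z | ~ invertible p (fun i j => A i j - (if i == j then z else 0))].

(* For linear subspaces Y of X: dim (X / Y) = d. *)
Definition quotient_dim (X Y : set (I -> R[i])) (d : nat) : Prop :=
  exists e : 'I_d -> I -> R[i], (forall k, X (e k)) /\
    forall x, X x ->
      exists! c : 'rV[R[i]]_d, Y (fun i => x i - \sum_(k < d) c 0 k * e k i).

Definition null_space p (A : I -> I -> R[i]) : set (I -> R[i]) :=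
  [set x | lp p x /\ mxact A x = (fun=> 0)].

Definition image_space p (A : I -> I -> R[i]) : set (I -> R[i]) :=
  [set mxact A x | x in lp p].

Definition fredholm_index p (A : I -> I -> R[i]) (k : int) : Prop :=
  exists n m : nat,
    [/\ quotient_dim (null_space p A) [set (fun=> 0)] n,
        quotient_dim (lp p) (image_space p A) m
      & k = n%:Z - m%:Z].

(* y solves the system truncated to the rows and columns in D, and is extended
   by zero outside of D. *)
Definition truncated_solution (D : set I) (A : I -> I -> R[i])
    (b y : I -> R[i]) : Prop :=
  (forall j, ~ D j -> y j = 0) /\
  (forall i, D i -> \sum_(j \in D) (A i j * y j) = b i).

Definition approximates p (y : nat -> I -> R[i]) (x : I -> R[i]) : Prop :=
  if p == +oo%E then
    (exists M : R, \forall n \near \oo, (lpnorm p (y n) <= M%:E)%E) /\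
    (forall j, (fun n => y n j : R[i]^o) @ \oo --> (x j : R[i]^o))
  else lpnorm p (fun j => y n j - x j) @[n --> \oo] --> (0 : \bar R)%E.

(* The finite section method for the windows D n of rows and columns. *)
Definition fsm_applies p (D : nat -> set I) (A : I -> I -> R[i]) : Prop :=
  invertible p A /\
  exists N : nat,
    (forall n, (N <= n)%N -> forall b, lp p b ->
       exists! y, truncated_solution (D n) A b y) /\
    (forall b x (y : nat -> I -> R[i]), lp p b -> lp p x -> mxact A x = b ->
       (forall n, (N <= n)%N -> truncated_solution (D n) A b (y n)) ->
       approximates p y x).

End Lp.

Definition full_fsm_bi {R : realType} (p : \bar R) (A : int -> int -> R[i]) :=
  fsm_applies p (fun n => [set j : int | - n%:Z <= j <= n%:Z]) A.

Definition full_fsm_semi {R : realType} (p : \bar R) (A : nat -> nat -> R[i]) :=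
  fsm_applies p (fun n => [set j : nat | (j < n)%N]) A.

Section Jacobi.
Context {R : realType}.
Implicit Types (U V W : set R[i]) (p : \bar R).

Definition jacobi_entry U V W (i j : int) : set R[i] :=
  if i == j + 1 then U else if i == j then V else if j == i + 1 then W
  else [set 0].

Definition M_bi U V W : set (int -> int -> R[i]) :=
  [set A | forall i j, jacobi_entry U V W i j (A i j)].

Definition M_semi U V W : set (nat -> nat -> R[i]) :=
  [set A | forall i j : nat, jacobi_entry U V W i%:Z j%:Z (A i j)].

Definition M_n U V W (n : nat) : set 'M[R[i]]_n :=
  [set A | forall i j : 'I_n,
     jacobi_entry U V W (nat_of_ord i)%:Z (nat_of_ord j)%:Z (A i j)].

(* The norm is the library's norm on matrices, the maximum of the moduli of the
   entries; any other norm on the n x n matrices gives the same notion. *)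
Definition PsiE_bi U V W : set (int -> int -> R[i]) :=
  [set A | M_bi U V W A /\
     forall n : nat, (0 < n)%N -> forall B : 'M[R[i]]_n, M_n U V W B ->
     forall eps : R, 0 < eps -> exists k : int,
       `| B - \matrix_(i < n, j < n) A (k + i.+1%:Z) (k + j.+1%:Z) |
         < (eps%:C)%C].

Definition PsiE_semi U V W : set (nat -> nat -> R[i]) :=
  [set A | M_semi U V W A /\
     forall n : nat, (0 < n)%N -> forall B : 'M[R[i]]_n, M_n U V W B ->
     forall eps : R, 0 < eps -> exists k : nat,
       `| B - \matrix_(i < n, j < n) A (k + i)%N (k + j)%N | < (eps%:C)%C].

Definition compatible p U V W : Prop :=
  forall A, M_bi U V W A -> invertible p A.

(* kappa(U,V,W) = k, where kappa is the common index of the operators in M_+. *)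
Definition kappa_is p U V W (k : int) : Prop :=
  forall A, M_semi U V W A -> fredholm_index p A k.

Definition Sigma_plus p U V W : set R[i] :=
  \bigcup_(A in M_semi U V W) spec p A.

End Jacobi.

(* Main.v *)
(** A singular finite Jacobi matrix [F] with [F x = 0] produces, by repeating [F]
    along the diagonal with single entries in between, a half-infinite Jacobi matrix
    with a bounded null vector [x, 0, a x, 0, a^2 x, ...], |a| <= 1; if |a| > 1 one
    reverses the order of the indices, which exchanges [U] and [W].

    On the other hand each condition gives a uniform lower bound for all bi-infinite
    Jacobi matrices: otherwise a pseudoergodic operator contains infinitely many
    well-separated approximate left null vectors, and a gliding hump shows that its
    range has infinite codimension.  Under the lower bound half-line null vectors
    decay exponentially; a half-infinite matrix over [U, V, W] and one over
    [W, V, U] cannot both have one (Coburn's lemma, by gluing them to a bi-infinite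
    null vector); and if one half-infinite matrix over [U, V, W] has one, then all
    have, since a finite square matrix with an approximate left null vector also has
    an approximate right null vector.  So either all semi-infinite operators have
    index 1, or all have index -1, and the truncations of a bi-infinite operator
    have exponentially growing inverses: this contradicts all the conditions. *)

Require Import Defs.
From HB Require Import structures.
From mathcomp Require Import all_boot all_order all_algebra.
From mathcomp Require Import complex.
From mathcomp Require Import all_classical all_reals all_analysis.
From mathcomp Require Import ring lra zify.
Set Implicit Arguments.
Unset Strict Implicit.
Unset Printing Implicit Defensive.
Import Order.TTheory GRing.Theory Num.Theory.
Import numFieldNormedType.Exports.
Local Open Scope classical_set_scope.
Local Open Scope ring_scope.

(** Whatever [p] is, null vectors are studied in the supremum norm, and ellipticity is the single
    constant [K] of [lower_bound]. It is extracted from the codimension of the image, because a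
    cokernel is detected by finitely supported functionals, which behave alike for all [p], infinity
    included.

    Transposition and reflection both exchange [U] and [W]. Reflection shows that the same [K]
    serves (U,V,W) and (W,V,U), so the bound governs left null vectors as well as right ones.

    Half-line and finite objects are extended by zero to the integers, where [lower_bound] applies.
    Extension by zero creates a residual only in the row just outside a boundary, namely one
    off-diagonal coefficient times the boundary entry. This one row is behind the decay relative to
    [z 0], the lower bound on off-diagonal entries, and the alternative between left and right end
    in a finite section. *)

Local Notation nc := Normc.normc.

(** * The modulus on R[i] and tridiagonal operators *)

Lemma normc_normr (R : realType) (x : R[i]) : (nc x)%:C%C = `|x|.
Proof. by []. Qed.

Lemma normc_ge0 (R : realType) (x : R[i]) : 0 <= nc x.
Proof. by rewrite -ler0c normc_normr. Qed.

Lemma normcD (R : realType) (x y : R[i]) : nc (x + y) <= nc x + nc y.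
Proof. by rewrite -lecR rmorphD /= !normc_normr ler_normD. Qed.

Lemma normcN (R : realType) (x : R[i]) : nc (- x) = nc x.
Proof. by apply: complexI; rewrite !normc_normr normrN. Qed.

Lemma normcB (R : realType) (x y : R[i]) : nc (x - y) <= nc x + nc y.
Proof. by rewrite -(normcN y) normcD. Qed.

Lemma normc_eq0 (R : realType) (x : R[i]) : (nc x == 0) = (x == 0).
Proof.
apply/eqP/eqP; first exact: Normc.eq0_normc.
by move=> ->; rewrite Normc.normc0.
Qed.

Lemma normc_gt0 (R : realType) (x : R[i]) : (0 < nc x) = (x != 0).
Proof. by rewrite lt0r normc_ge0 andbT normc_eq0. Qed.

Lemma normcR (R : realType) (a : R) : nc (a%:C%C) = `|a|.
Proof. by rewrite /= expr0n addr0 sqrtr_sqr. Qed.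

Lemma normc_sum (R : realType) (I : Type) (s : seq I) (P : pred I) (F : I -> R[i]) :
  nc (\sum_(i <- s | P i) F i) <= \sum_(i <- s | P i) nc (F i).
Proof.
elim/big_rec2: _ => [|i x y _ h]; first by rewrite Normc.normc0.
by rewrite (le_trans (normcD _ _)) ?lerD2l.
Qed.

Lemma normc_lin3 (R : realType) (a b c x y z : R[i]) (B : R) :
  nc a <= B -> nc b <= B -> nc c <= B ->
  nc (a * x + b * y + c * z) <= B * (nc x + nc y + nc z).
Proof.
move=> ha hb hc; rewrite (le_trans (normcD _ _))// !mulrDr lerD//; last first.
  by rewrite Normc.normcM ler_wpM2r ?normc_ge0.
by rewrite (le_trans (normcD _ _))// !Normc.normcM lerD// ler_wpM2r ?normc_ge0.
Qed.

Record jacobi (R : realType) :=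
  Jacobi { lo : int -> R[i]; di : int -> R[i]; up : int -> R[i] }.

Definition jacobi_in (R : realType) (U V W : set R[i]) (c : jacobi R) :=
  forall i, [/\ U (lo c i), V (di c i) & W (up c i)].

Definition jact (R : realType) (c : jacobi R) (z : int -> R[i]) (i : int) :=
  lo c i * z (i - 1) + di c i * z i + up c i * z (i + 1).

Definition reflect_jac (R : realType) (c : jacobi R) :=
  Jacobi (fun i => up c (- i)) (fun i => di c (- i)) (fun i => lo c (- i)).

(** [lo c i] and [up c i] stand in row [i]; column [i] therefore contains [up c (i - 1)] above the
    diagonal and [lo c (i + 1)] below it. *)
Definition transpose_jac (R : realType) (c : jacobi R) :=
  Jacobi (fun i => up c (i - 1)) (di c) (fun i => lo c (i + 1)).

Definition shift_jac (R : realType) (k : int) (c : jacobi R) :=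
  Jacobi (fun i => lo c (k + i)) (fun i => di c (k + i)) (fun i => up c (k + i)).

Lemma jacobi_in_reflect (R : realType) (U V W : set R[i]) c :
  jacobi_in U V W c -> jacobi_in W V U (reflect_jac c).
Proof. by move=> h i; have [] := h (- i). Qed.

Lemma jacobi_in_transpose (R : realType) (U V W : set R[i]) c :
  jacobi_in U V W c -> jacobi_in W V U (transpose_jac c).
Proof.
by move=> h i; have [? ? ?] := h i; have [] := h (i - 1); have [] := h (i + 1).
Qed.

Lemma jacobi_in_shift (R : realType) (U V W : set R[i]) k c :
  jacobi_in U V W c -> jacobi_in U V W (shift_jac k c).
Proof. by move=> h i; have [] := h (k + i). Qed.

Lemma jact_reflect (R : realType) (c : jacobi R) z i :
  jact (reflect_jac c) (fun j => z (- j)) i = jact c z (- i).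
Proof.
rewrite /jact /= opprB opprD (_ : 1 - i = - i + 1); last by rewrite addrC.
by ring.
Qed.

Lemma jact_shift (R : realType) (c : jacobi R) z k i :
  jact (shift_jac k c) (fun j => z (k + j)) i = jact c z (k + i).
Proof. by rewrite /jact /= !addrA. Qed.

(** * Uniform lower bounds, decay of half-line null vectors, Coburn's lemma *)

(** [B] is absent from the conclusion: it confines the estimate to bounded vectors, since a Jacobi
    operator bounded below in this sense may have unbounded null vectors. *)
Definition lower_bound (R : realType) (U V W : set R[i]) (K : R) :=
  forall c, jacobi_in U V W c -> forall z B m,
  (forall i, nc (z i) <= B) -> (forall i, nc (jact c z i) <= m) ->
  forall i, nc (z i) <= K * m.

Lemma lower_bound_reflect (R : realType) (U V W : set R[i]) K :
  lower_bound U V W K -> lower_bound W V U K.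
Proof.
move=> h c hc z B m zB zm i.
rewrite -(opprK i); apply: (h _ (jacobi_in_reflect hc) (fun j => z (- j)) B) => // j.
by rewrite jact_reflect.
Qed.

Definition uniformly_elliptic (R : realType) (U V W : set R[i]) (b K : R) :=
  [/\ 0 < b, 0 < K, forall x, U x \/ V x \/ W x -> nc x <= b & lower_bound U V W K].

Lemma uniformly_elliptic_reflect (R : realType) (U V W : set R[i]) b K :
  uniformly_elliptic U V W b K -> uniformly_elliptic W V U b K.
Proof.
move=> [b0 K0 hb /lower_bound_reflect h]; split=> // x hx; apply: hb; tauto.
Qed.

(** Absorption: for S the supremum of [f], finite thanks to [B], the second hypothesis gives S <= S
    / 2 + a. *)
Lemma half_bound (R : realType) (T : Type) (f : T -> R) (B a : R) :
  (forall i, f i <= B) ->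
  (forall S, (forall i, f i <= S) -> forall i, f i <= S / 2 + a) ->
  forall i, f i <= 2 * a.
Proof.
move=> fB h i.
have hs : has_sup (range f).
  by split; [exists (f i), i|exists B => _ [j _ <-]].
have fs j : f j <= sup (range f) by apply: sup_upper_bound => //; exists j.
have : sup (range f) <= sup (range f) / 2 + a.
  by apply: ge_sup; [exists (f i), i|move=> _ [j _ <-]; apply: h].
by have := fs i; lra.
Qed.

Lemma pow_step (R : realType) (s : R) (m n : nat) : 1 <= s ->
  (m <= n.+1)%N -> (n <= m.+1)%N -> `|s ^+ m - s ^+ n| <= (s - 1) * s ^+ m.
Proof.
move=> s1 mn nm.
have hp k : 0 <= s ^+ k by rewrite exprn_ge0//; lra.
have [->|[->|->]] : m = n \/ m = n.+1 \/ n = m.+1 by lia.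
- by rewrite subrr normr0 mulr_ge0//; lra.
- have h0 : 0 <= (s - 1) * s ^+ n by rewrite mulr_ge0 ?hp//; lra.
  have h1 : 0 <= (s - 1) * ((s - 1) * s ^+ n) by rewrite mulr_ge0//; lra.
  rewrite exprS ger0_norm; lra.
- have h0 : 0 <= (s - 1) * s ^+ m by rewrite mulr_ge0 ?hp//; lra.
  rewrite exprS ler0_norm; lra.
Qed.

(** The rate s solves 2 K b (s - 1) = 1/2: a weight that changes by a factor s per step then
    perturbs the equation by an amount that [half_bound] absorbs. *)
Definition decay_rate (R : realType) (b K : R) := 1 + (4 * K * b)^-1.

(** Bi-infinite coefficients encode a half-line operator: those in negative rows are fillers, and
    [lo c 0] meets only the entry [z (-1) = 0]. Row -1 is left free. *)
Definition half_kernel (R : realType) (c : jacobi R) (z : int -> R[i]) :=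
  (forall i, i < 0 -> z i = 0) /\ (forall i, 0 <= i -> jact c z i = 0).

(** The lower bound is applied to [z] times the weight [phi]. In rows j >= 0 only the commutator
    with the weight survives, of size 2 b (s - 1) S if S bounds the weighted vector; row -1
    contributes at most b |z 0|. After multiplication by [K] the first term is S / 2 and is
    absorbed. *)
Lemma half_kernel_decay (R : realType) (U V W : set R[i]) b K c z B :
  uniformly_elliptic U V W b K -> jacobi_in U V W c -> half_kernel c z ->
  (forall i, nc (z i) <= B) ->
  forall n : nat, nc (z n%:Z) * decay_rate b K ^+ n <= 2 * (K * b) * nc (z 0).
Proof.
move=> [b0 K0 hb lb] hc [z0 zk] zB n.
set s := decay_rate b K.
have Kb : 0 < K * b by rewrite mulr_gt0.
have s1 : 1 < s by rewrite /s /decay_rate ltrDl invr_gt0 -mulrA mulr_gt0.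
have sE : K * b * (s - 1) = 1 / 4.
  by rewrite /s /decay_rate; field; rewrite !gt_eqF.
(* The exponent is capped at [n] to keep the weighted vector bounded; the estimate is read off at
   index [n]. *)
pose phi (i : int) : R := s ^+ (minn `|i|%N n).
have phi0 i : 0 <= phi i by rewrite exprn_ge0//; lra.
pose z' i := (phi i)%:C%C * z i.
have nz' i : nc (z' i) = phi i * nc (z i).
  by rewrite Normc.normcM normcR ger0_norm.
have key : forall i, nc (z' i) <= 2 * (K * b * nc (z 0)).
  apply: (@half_bound _ _ (fun i => nc (z' i)) (s ^+ n * B)) => [i|S hS i].
    rewrite nz' ler_pM ?normc_ge0// /phi ler_eXn2l ?geq_minr//.
  have S0 : 0 <= S := le_trans (normc_ge0 _) (hS 0).
  have -> : S / 2 + K * b * nc (z 0) = K * (2 * (b * (s - 1)) * S + b * nc (z 0)).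
    have e : K * (b * (s - 1)) = 1 / 4 by rewrite mulrA.
    rewrite mulrDr (_ : K * (2 * _ * S) = (K * (b * (s - 1))) * (2 * S)); last by ring.
    by rewrite e; field.
  apply: (lb c hc z' S) => // j.
  have P0 := normc_ge0 (z 0).
  have bs : 0 <= b * (s - 1) by apply: mulr_ge0; lra.
  have bS : 0 <= 2 * (b * (s - 1)) * S by rewrite mulr_ge0// mulr_ge0.
  have bz : 0 <= b * nc (z 0) by rewrite mulr_ge0// ltW.
  have [j0|[jm|j0]] : 0 <= j \/ j = -1 \/ j < -1 by clear; lia.
  - have -> : jact c z' j = lo c j * ((phi (j - 1) - phi j)%:C%C * z (j - 1)) + di c j * 0
                 + up c j * ((phi (j + 1) - phi j)%:C%C * z (j + 1)).
      transitivity (jact c z' j - (phi j)%:C%C * jact c z j).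
        by rewrite (zk j j0) mulr0 subr0.
      by rewrite /jact /z' !rmorphB /=; ring.
    have [hlo hdi hup] := hc j.
    apply: (le_trans (@normc_lin3 _ _ _ _ _ _ _ b _ _ _)); try by apply: hb; tauto.
    rewrite Normc.normc0 addr0 !Normc.normcM !normcR.
    have st k : (`|k|.-1 <= `|j| <= `|k|.+1)%N -> `|phi k - phi j| * nc (z k) <= (s - 1) * S.
      move=> hk; apply: (@le_trans _ _ (((s - 1) * phi k) * nc (z k))).
        by rewrite ler_wpM2r ?normc_ge0// pow_step//; [lra| |]; clear -hk; lia.
      by rewrite -mulrA -nz' ler_wpM2l//; lra.
    have h1 : `|phi (j - 1) - phi j| * nc (z (j - 1)) <= (s - 1) * S.
      by apply: st; clear; lia.
    have h2 : `|phi (j + 1) - phi j| * nc (z (j + 1)) <= (s - 1) * S.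
      by apply: st; clear; lia.
    apply: (@le_trans _ _ (b * (2 * ((s - 1) * S)))).
      by rewrite ler_wpM2l ?(ltW b0)//; lra.
    by rewrite -[leLHS]addr0 lerD//; lra.
  - rewrite jm /jact /z' (z0 (-1 - 1))// (z0 (-1))// !mulr0 !add0r.
    rewrite (_ : (-1 + 1 : int) = 0)// /phi absz0 min0n expr0 mul1r Normc.normcM.
    rewrite -[leLHS]add0r lerD// ler_wpM2r ?normc_ge0//; apply: hb.
    by have [] := hc (-1); tauto.
  - rewrite /jact /z' (z0 (j - 1)) ?(z0 j) ?(z0 (j + 1)); try by clear -j0; lia.
    by rewrite !mulr0 !addr0 Normc.normc0 addr_ge0.
have := key n%:Z; rewrite nz' /phi absz_nat minnn; lra.
Qed.

Definition has_half_kernel (R : realType) (U V W : set R[i]) :=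
  exists c z B, [/\ jacobi_in U V W c, half_kernel c z,
    forall i, nc (z i) <= B & exists i, z i != 0].

(** The decay estimate is relative to |z 0|, so [z 0 = 0] would annihilate every entry. *)
Lemma half_kernel_neq0 (R : realType) (U V W : set R[i]) b K c z B :
  uniformly_elliptic U V W b K -> jacobi_in U V W c -> half_kernel c z ->
  (forall i, nc (z i) <= B) -> (exists i, z i != 0) -> z 0 != 0.
Proof.
move=> ell hc hz zB [i zi]; apply/eqP => z0.
have [i0|i0] := ltP i 0; first by rewrite hz.1 ?eqxx in zi.
have := half_kernel_decay ell hc hz zB `|i|%N.
rewrite z0 Normc.normc0 mulr0 gez0_abs// pmulr_lle0; last first.
  case: ell => b0 K0 _ _; rewrite exprn_gt0// /decay_rate addr_gt0// invr_gt0.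
  by rewrite -mulrA mulr_gt0// mulr_gt0.
by rewrite leNgt normc_gt0 zi.
Qed.

(** One vector is placed on the positive side, the other one reflected on the negative side, with a
    single zero entry at 0 between them. Only row 0 couples the halves, and the lower bound with
    residual 0 kills the resulting null vector. *)
Lemma coburn (R : realType) (U V W : set R[i]) b K :
  uniformly_elliptic U V W b K ->
  has_half_kernel U V W -> has_half_kernel W V U -> False.
Proof.
move=> ell [c [z [B [hc hz zB nz]]]] [c' [z' [B' [hc' hz' zB' nz']]]].
have z0 := half_kernel_neq0 ell hc hz zB nz.
have z'0 := half_kernel_neq0 (uniformly_elliptic_reflect ell) hc' hz' zB' nz'.
pose u0 := lo c 0; pose w0 := up c 0.
(* Row 0 is one homogeneous linear equation in the two scaling factors, so it has a nontrivial
   solution. *)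
have [g [d [gd e]]] : exists g d : R[i], ((g != 0) || (d != 0)) /\
    u0 * (g * z' 0) + w0 * (d * z 0) = 0.
  have [u00|u00] := eqVneq u0 0; last first.
    exists (- (w0 * z 0)), (u0 * z' 0); rewrite !mulf_neq0// orbT; split=> //; ring.
  have [w00|w00] := eqVneq w0 0; last first.
    exists (- (w0 * z 0)), (u0 * z' 0); rewrite oppr_eq0 mulf_neq0//; split=> //; ring.
  by exists 1, 1; rewrite oner_eq0 u00 w00 !mul0r addr0.
pose Z (i : int) := if 0 < i then d * z (i - 1) else if i < 0 then g * z' (-1 - i) else 0.
pose C := Jacobi
  (fun i : int => if 0 < i then lo c (i - 1) else if i < 0 then up c' (-1 - i) else lo c 0)
  (fun i : int => if 0 < i then di c (i - 1) else if i < 0 then di c' (-1 - i) else di c 0)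
  (fun i : int => if 0 < i then up c (i - 1) else if i < 0 then lo c' (-1 - i) else up c 0).
have hC : jacobi_in U V W C.
  move=> i; rewrite /C /=; have [] := hc (i - 1); have [] := hc' (-1 - i); have [] := hc 0.
  by case: (0 < i); case: (i < 0).
have ZE i : 0 <= i -> Z (i + 1) = d * z i.
  by move=> i0; rewrite /Z (_ : 0 < i + 1 = true) ?addrK//; clear -i0; lia.
have Z0 : Z 0 = 0 by [].
have ZE' i : 0 <= i -> Z (- (i + 1)) = g * z' i.
  move=> i0; rewrite /Z (_ : 0 < - (i + 1) = false); last by clear -i0; lia.
  rewrite (_ : - (i + 1) < 0 = true); last by clear -i0; lia.
  by congr (_ * z' _); clear; lia.
have ZC i : jact C Z i = 0.
  have [i0|[->|i0]] : 0 < i \/ i = 0 \/ i < 0 by clear; lia.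
  - have E : jact C Z i = d * jact c z (i - 1).
      rewrite /jact /C /= i0 /Z i0 (_ : 0 < i + 1 = true); last by clear -i0; lia.
      rewrite (_ : i - 1 + 1 = i + 1 - 1); last by clear -i0; lia.
      case: ifP => h; first by ring.
      rewrite (_ : i - 1 < 0 = false); last by clear -i0; lia.
      rewrite (hz.1 (i - 1 - 1)); last by clear -i0 h; lia.
      by ring.
    by rewrite E hz.2 ?mulr0//; clear -i0; lia.
  - rewrite /jact (_ : 0 - 1 = - (0 + 1) :> int)// ZE'// ZE// Z0 mulr0 addr0 /C /=.
    exact: e.
  - have E : jact C Z i = g * jact c' z' (-1 - i).
      rewrite /jact /C /= i0 /Z i0 (_ : 0 < i = false); last by clear -i0; lia.
      rewrite (_ : 0 < i - 1 = false); last by clear -i0; lia.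
      rewrite (_ : i - 1 < 0 = true); last by clear -i0; lia.
      rewrite (_ : 0 < i + 1 = false); last by clear -i0; lia.
      rewrite (_ : -1 - i + 1 = -1 - (i - 1)); last by clear -i0; lia.
      rewrite (_ : -1 - i - 1 = -1 - (i + 1)); last by clear -i0; lia.
      case: ifP => h; first by ring.
      rewrite (hz'.1 (-1 - (i + 1))); last by clear -i0 h; lia.
      by ring.
    by rewrite E hz'.2 ?mulr0//; clear -i0; lia.
have B0 : 0 <= B := le_trans (normc_ge0 _) (zB 0).
have B'0 : 0 <= B' := le_trans (normc_ge0 _) (zB' 0).
have h1 : forall i, nc (Z i) <= nc d * B + nc g * B'.
  have p1 := mulr_ge0 (normc_ge0 d) B0; have p2 := mulr_ge0 (normc_ge0 g) B'0.
  move=> i; rewrite /Z; case: ifP => _.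
    by rewrite Normc.normcM -[leLHS]addr0 lerD// ler_wpM2l ?normc_ge0.
  case: ifP => _; last by rewrite Normc.normc0 addr_ge0.
  by rewrite Normc.normcM -[leLHS]add0r lerD// ler_wpM2l ?normc_ge0.
case: ell => _ _ _ /(_ C hC Z _ 0 h1).
have h2 i : nc (jact C Z i) <= 0 by rewrite ZC Normc.normc0.
move=> /(_ h2); rewrite mulr0 => hZ.
have Zn i : Z i = 0 by apply/eqP; rewrite -normc_eq0 eq_le hZ normc_ge0.
move: gd; have := ZE 0 isT; have := ZE' 0 isT; rewrite !Zn.
by move=> /esym/eqP; rewrite mulf_eq0 (negbTE z'0) orbF => -> /esym/eqP;
  rewrite mulf_eq0 (negbTE z0) orbF => ->.
Qed.

(** * Null vectors as limits of approximate null vectors *)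

Lemma bernoulli_exp (R : realType) (s : R) (n : nat) : 1 <= s ->
  n%:R * (s - 1) <= s ^+ n.
Proof.
move=> s1; suff : 1 + n%:R * (s - 1) <= s ^+ n by lra.
elim: n => [|n ih]; first by rewrite mul0r addr0 expr0.
rewrite exprS; have := ler_wpM2l (ltW (lt_le_trans ltr01 s1)) ih.
have : 0 <= n%:R * (s - 1) * (s - 1) by rewrite !mulr_ge0//; lra.
rewrite -natr1; lra.
Qed.

Lemma exp_unbounded (R : realType) (s C e : R) : 1 < s -> 0 < e ->
  exists n : nat, C <= e * s ^+ n.
Proof.
move=> s1 e0; have he : 0 < e * (s - 1) by rewrite mulr_gt0//; lra.
have [n hn] : exists n : nat, `|C / (e * (s - 1))| < n%:R.
  by exists (Num.bound `|C / (e * (s - 1))|); rewrite archi_boundP.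
exists n; apply: (@le_trans _ _ (e * (n%:R * (s - 1)))); last first.
  by rewrite ler_wpM2l ?bernoulli_exp// ltW.
rewrite mulrCA -ler_pdivrMr//; exact: le_trans (ler_norm _) (ltW hn).
Qed.

Lemma normc_le_ReIm (R : realType) (x : R[i]) : nc x <= `|complex.Re x| + `|complex.Im x|.
Proof.
case: x => a b /=; rewrite -[leRHS]ger0_norm ?addr_ge0// -sqrtr_sqr ler_wsqrtr//.
rewrite sqrrD !real_normK ?num_real// addrAC lerDl.
by rewrite mulrn_wge0// mulr_ge0.
Qed.

Lemma normc_ge_ReIm (R : realType) (x : R[i]) :
  `|complex.Re x| <= nc x /\ `|complex.Im x| <= nc x.
Proof.
case: x => a b /=; split; rewrite -sqrtr_sqr ler_wsqrtr//.
  by rewrite lerDl sqr_ge0.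
by rewrite lerDr sqr_ge0.
Qed.

(** A cluster point in the product topology exists by Tychonoff, real and imaginary parts being
    separate coordinates in [-1, 1]. Closeness at three neighbouring indices for one and the same
    [h] is what a tridiagonal row needs. *)
Lemma pointwise_cluster (R : realType) (y : nat -> int -> R[i]) :
  (forall h i, nc (y h i) <= 1) ->
  exists x : int -> R[i], forall (i : int) (e : R) (N : nat), 0 < e ->
    exists2 h, (N <= h)%N & [/\ nc (y h (i - 1) - x (i - 1)) <= e,
      nc (y h i - x i) <= e & nc (y h (i + 1) - x (i + 1)) <= e].
Proof.
move=> y1.
pose T := prod_topology (fun _ : int * bool => R^o).
pose g (h : nat) : T :=
  fun k => if k.2 then complex.Re (y h k.1) else complex.Im (y h k.1).
pose X : set T := [set f | forall k, `[-1, 1]%classic (f k)].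
have cX : compact X.
  by apply: (@tychonoff (int * bool)%type (fun=> R^o) (fun=> `[-1, 1]%classic)) => k;
    exact: segment_compact.
have gX : (g @ \oo) X.
  exists 0%N => // h _ k /=; rewrite in_itv /= -ler_norml /g.
  have [h1 h2] := normc_ge_ReIm (y h k.1).
  by case: k.2; [apply: le_trans h1 _|apply: le_trans h2 _].
have [f [_ fcl]] := cX _ _ gX.
exists (fun i => (f (i, true) +i* f (i, false))%C) => i e N e0.
have e2 : 0 < e / 2 by rewrite divr_gt0.
have nb k : nbhs f [set f' : T | `|f k - f' k| < e / 2].
  have := @proj_continuous (int * bool)%type (fun=> R^o) k f.
  move=> /(_ (ball (f k) (e / 2))); apply; exact: nbhsx_ballx.
have nb2 j : nbhs f [set f' : T | `|f (j, true) - f' (j, true)| < e / 2 /\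
    `|f (j, false) - f' (j, false)| < e / 2].
  by apply: filterI; apply: nb.
have nbN : (g @ \oo) [set f' | exists2 h, (N <= h)%N & f' = g h].
  by exists N => // h hN; exists h.
have := fcl _ _ nbN (filterI (nb2 (i - 1)) (filterI (nb2 i) (nb2 (i + 1)))).
have key h j : `|f (j, true) - g h (j, true)| < e / 2 /\
    `|f (j, false) - g h (j, false)| < e / 2 ->
    nc (y h j - (f (j, true) +i* f (j, false))%C) <= e.
  rewrite /g; case: (y h j) => a b [h1 h2].
  apply: le_trans (normc_le_ReIm _) _ => /=; move: h1 h2 => /=.
  by rewrite !(distrC (f _)); lra.
by move=> [_ [[h hN ->] [h1 [h2 h3]]]]; exists h => //; split; apply: key.
Qed.

(** Compactness turns approximate null vectors on longer and longer windows into an exact one; the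
    bound [d] at index 0 prevents the limit from vanishing. *)
Lemma half_kernel_limit (R : realType) (c : jacobi R) (d : R) : 0 < d ->
  (forall (h : nat) (e : R), 0 < e -> exists y, [/\ forall i, i < 0 -> y i = 0,
     forall i, nc (y i) <= 1, d <= nc (y 0) &
     forall i : nat, (i <= h)%N -> nc (jact c y i%:Z) <= e]) ->
  exists y, [/\ half_kernel c y, forall i, nc (y i) <= 1 & y 0 != 0].
Proof.
move=> d0 H.
have /choice[Y hY] : forall h : nat, exists y : int -> R[i],
    [/\ forall i, i < 0 -> y i = 0,
     forall i, nc (y i) <= 1, d <= nc (y 0) &
     forall i : nat, (i <= h)%N -> nc (jact c y i%:Z) <= h.+1%:R^-1].
  by move=> h; apply: H; rewrite invr_gt0.
have [x hx] := @pointwise_cluster _ Y (fun h => let: And4 _ h2 _ _ := hY h in h2).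
exists x; split.
- split=> [i i0|i i0].
    apply/eqP; rewrite -normc_eq0 eq_le normc_ge0 andbT; apply/ler_addgt0Pl => e e0.
    have [h _ [_ + _]] := hx i e 0%N e0; have [h1 _ _ _] := hY h.
    by rewrite h1// sub0r normcN addr0.
  apply/eqP; rewrite -normc_eq0 eq_le normc_ge0 andbT.
  set B := nc (lo c i) + nc (di c i) + nc (up c i).
  have B0 : 0 <= B by rewrite !addr_ge0 ?normc_ge0.
  apply/ler_addgt0Pl => e e0; rewrite addr0.
  (* Three entries, each off by at most e', change the row by at most 3 B e' <= e / 2; the other
     half of [e] is the residual of [Y h]. *)
  set e' := e / (2 * (B * 3 + 1)).
  have e'0 : 0 < e' by rewrite divr_gt0// mulr_gt0//; lra.
  have [N hN] : exists N : nat, 2 / e < N%:R.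
    by exists (Num.bound (2 / e)); rewrite archi_boundP// divr_ge0// ltW.
  have [h hN' [h1 h2 h3]] := hx i e' (maxn N `|i|%N) e'0.
  have [_ _ _ /(_ `|i|%N)] := hY h.
  rewrite gez0_abs// => /(_ (leq_trans (leq_maxr _ _) hN')) hr.
  have -> : jact c x i = jact c (Y h) i - (lo c i * (Y h (i - 1) - x (i - 1))
     + di c i * (Y h i - x i) + up c i * (Y h (i + 1) - x (i + 1))).
    by rewrite /jact; ring.
  apply: le_trans (normcB _ _) _.
  have -> : e = e / 2 + e / 2 by field.
  apply: lerD.
    apply: le_trans hr _; rewrite -[leRHS]invrK lef_pV2 ?posrE ?invr_gt0 ?divr_gt0//.
    rewrite invf_div; apply: le_trans (ltW hN) _; rewrite ler_nat.
    by rewrite (leq_trans (leq_maxl _ _) (leq_trans hN' _)).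
  apply: (@le_trans _ _ (B * (e' + e' + e'))).
    apply: le_trans (normc_lin3 _ _ _ (_ : _ <= B) (_ : _ <= B) (_ : _ <= B)) _.
    - by rewrite /B -addrA lerDl addr_ge0 ?normc_ge0.
    - by rewrite /B addrAC lerDr addr_ge0 ?normc_ge0.
    - by rewrite /B lerDr addr_ge0 ?normc_ge0.
    by rewrite ler_wpM2l// !lerD.
  have : e = e' * (2 * (B * 3 + 1)) by rewrite /e' divfK// gt_eqF// mulr_gt0//; lra.
  by nra.
- move=> i; apply/ler_addgt0Pl => e e0.
  have [h _ [_ h2 _]] := hx i e 0%N e0; have [_ h1 _ _] := hY h.
  rewrite (_ : x i = Y h i - (Y h i - x i)); last by ring.
  by apply: le_trans (normcB _ _) _; have := h1 i; lra.
- rewrite -normc_gt0; have d2 : 0 < d / 2 by rewrite divr_gt0.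
  have [h _ [_ h2 _]] := hx 0 (d / 2) 0%N d2; have [_ _ h1 _] := hY h.
  have : nc (Y h 0) <= nc (x 0) + nc (Y h 0 - x 0).
    by rewrite [in leLHS](_ : Y h 0 = x 0 + (Y h 0 - x 0)) ?normcD//; ring.
  lra.
Qed.

(** A singular square [T] has a null vector. Otherwise y = T^-1 e_k satisfies X_k = (X T) y, whence
    |X_k| <= e |X_k| max |y|: the solution is large while T y = e_k has norm 1, and it remains to
    normalise [y]. The l^1 norm on the left is dual to the maximum norm on the right. *)
Lemma approx_kernel_dual (R : realType) (n : nat) (T : 'M[R[i]]_n) (X : 'rV[R[i]]_n)
    (k : 'I_n) (e : R) : X 0 k != 0 -> 0 <= e ->
  \sum_j nc ((X *m T) 0 j) <= e * nc (X 0 k) ->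
  exists y : 'cV[R[i]]_n, [/\ forall i, nc (y i 0) <= 1,
    exists i, nc (y i 0) = 1 & forall i, nc ((T *m y) i 0) <= e].
Proof.
move=> Xk e0 hX.
suff [y [l yl hy]] : exists (y : 'cV[R[i]]_n), exists2 l, y l 0 != 0 &
    forall i0, (forall i, nc (y i 0) <= nc (y i0 0)) ->
      forall i, nc ((T *m y) i 0) <= e * nc (y i0 0).
  pose i0 := [arg max_(i > l) (nc (y i 0) : R)]%O.
  have hi0 i : nc (y i 0) <= nc (y i0 0).
    by rewrite /i0; case: arg_maxP => // j _; apply.
  have y0 : y i0 0 != 0 by rewrite -normc_gt0 (lt_le_trans _ (hi0 l))// normc_gt0.
  have ny0 : 0 < nc (y i0 0) by rewrite normc_gt0.
  exists ((y i0 0)^-1 *: y); split=> [i||i].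
  - by rewrite mxE Normc.normcM Normc.normcV mulrC ler_pdivrMr ?mul1r.
  - by exists i0; rewrite mxE mulVf// Normc.normc1.
  - by rewrite -scalemxAr mxE Normc.normcM Normc.normcV mulrC ler_pdivrMr// hy.
have [uT|nuT] := boolP (T \in unitmx); last first.
  move: nuT; rewrite -unitmx_tr unitmxE unitfE negbK => /det0P[v v0 vT].
  have [l vl] : exists l, v 0 l != 0.
    by apply/existsP; rewrite -negb_forall; apply: contra v0 => /forallP h;
      apply/eqP/rowP => j; rewrite mxE; apply/eqP.
  exists v^T; exists l; rewrite ?mxE// => i0 _ i.
  have -> : T *m v^T = 0 by rewrite -(trmxK T) -trmx_mul vT trmx0.
  by rewrite mxE Normc.normc0 mulr_ge0 ?normc_ge0.
(* This is the solution of T y = e_k. *)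
pose y := col k (invmx T).
have Ty : T *m y = delta_mx k 0.
  apply/matrixP => i j; rewrite (ord1 j) /y.
  have := congr1 (fun A : 'M[R[i]]_n => A i k) (mulmxV uT).
  by rewrite !mxE eqxx andbT => <-; apply: eq_bigr => l _; rewrite !mxE.
have Xy : X 0 k = \sum_j (X *m T) 0 j * y j 0.
  have : (X *m T *m y) 0 0 = X 0 k by rewrite -mulmxA Ty -colE mxE.
  by rewrite mxE => <-.
have [l yl] : exists l, y l 0 != 0.
  apply/existsP; rewrite -negb_forall; apply: contra Xk => /forallP h.
  by rewrite Xy big1// => j _; rewrite (eqP (h j)) mulr0.
exists y, l => // i0 hi0 i.
have h1 : 1 <= e * nc (y i0 0).
  have Xk0 : 0 < nc (X 0 k) by rewrite normc_gt0.
  rewrite -(ler_pM2l Xk0) mulr1 mulrA (mulrC _ e).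
  apply: le_trans (ler_wpM2r (normc_ge0 _) hX).
  rewrite {1}Xy (le_trans (normc_sum _ _ _))// mulr_suml ler_sum// => j _.
  by rewrite Normc.normcM ler_wpM2l ?normc_ge0.
apply: le_trans h1; rewrite Ty mxE; case: (_ && _).
  by rewrite Normc.normc1.
by rewrite Normc.normc0.
Qed.

(** * Existence of null vectors does not depend on the half-infinite matrix *)

Definition jacobi_mx (R : realType) (c : jacobi R) (i j : int) : R[i] :=
  if i == j + 1 then lo c i else if i == j then di c i
  else if j == i + 1 then up c i else 0.

Lemma jacobi_mx_split (R : realType) (c : jacobi R) (z : int -> R[i]) (i j : int) :
  jacobi_mx c i j * z j = (if j == i - 1 then lo c i * z (i - 1) else 0)
     + (if j == i then di c i * z i else 0)
     + (if j == i + 1 then up c i * z (i + 1) else 0).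
Proof.
rewrite /jacobi_mx.
have [e1|e1] := eqVneq j (i - 1).
  rewrite ifT; last by rewrite e1; clear; lia.
  rewrite ifF; last by rewrite e1; clear; lia.
  rewrite ifF; last by rewrite e1; clear; lia.
  by rewrite e1 !addr0.
rewrite ifF; last by clear -e1; lia.
have [e2|e2] := eqVneq j i.
  rewrite e2 /= ifF; last by clear; lia.
  by rewrite addr0 add0r.
rewrite /=.
by case: eqP => [->|_]; rewrite ?mul0r !add0r ?addr0.
Qed.

Lemma sum_ord_delta (T : nmodType) (n : nat) (k : int) (g : T) :
  (~~ (0 <= k < n%:Z) -> g = 0) ->
  \sum_(j < n) (if j%:Z == k then g else 0) = g.
Proof.
move=> h; have [/andP[k0 kn]|/h ->] := boolP (0 <= k < n%:Z); last first.
  by rewrite big1// => j _; case: ifP.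
have kn' : (`|k| < n)%N by clear -k0 kn; lia.
rewrite (bigD1 (Ordinal kn')) //= gez0_abs// eqxx big1 ?addr0// => j jk.
rewrite ifF//; apply: contraNF jk => /eqP e; apply/eqP/val_inj => /=.
by rewrite -e absz_nat.
Qed.

Lemma sum_jacobi_mx (R : realType) (c : jacobi R) (z : int -> R[i]) (n : nat) (i : int) :
  (forall j, ~~ (0 <= j < n%:Z) -> z j = 0) ->
  \sum_(j < n) jacobi_mx c i j%:Z * z j%:Z = jact c z i.
Proof.
move=> hz; under eq_bigr do rewrite jacobi_mx_split.
rewrite !big_split /= !sum_ord_delta// => [/hz ->|/hz ->|/hz ->]; exact: mulr0.
Qed.

Lemma jacobi_mx_transpose (R : realType) (c : jacobi R) (i j : int) :
  jacobi_mx (transpose_jac c) i j = jacobi_mx c j i.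
Proof.
rewrite /jacobi_mx /=.
have [e1|e1] := eqVneq i (j + 1).
  rewrite ifF; last by rewrite e1; clear; lia.
  rewrite ifF; last by rewrite e1; clear; lia.
  by rewrite e1 addrK.
have [e2|e2] := eqVneq i j; first by rewrite e2 /= ifF//; clear; lia.
by case: eqP => [->|].
Qed.

(* Glue a half-infinite Jacobi matrix [c'] with a kernel-bearing [c], transposed and
   reflected so that its kernel vector becomes an approximate left null vector of
   the finite section at its right end. A square matrix has then also an
   approximate right null vector. If the latter lives at the right end, the
   transpose of [c] has a kernel, contradicting [coburn]; so it lives at the left
   end, and [c'] has a kernel. *)
Lemma has_half_kernel_spread (R : realType) (U V W : set R[i]) b K :
  uniformly_elliptic U V W b K -> has_half_kernel U V W ->
  forall c', jacobi_in U V W c' ->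
  exists y, [/\ half_kernel c' y, forall i, nc (y i) <= 1 & y 0 != 0].
Proof.
move=> ell hk c' hc'.
have [c [x [B [hc hx xB nzx]]]] := hk.
have x0 := half_kernel_neq0 ell hc hx xB nzx.
have nx0 : 0 < nc (x 0) by rewrite normc_gt0.
have dec := half_kernel_decay ell hc hx xB.
have [b0 K0 hb lb] := ell.
set s := decay_rate b K in dec.
have Kb : 0 < K * b by rewrite mulr_gt0.
have s1 : 1 < s by rewrite /s /decay_rate ltrDl invr_gt0 -mulrA mulr_gt0.
(* The modulus that the lower bound forces on one of the two boundary entries of a unit approximate
   null vector of a finite section. *)
set d := (K * b)^-1.
have d0 : 0 < d by rewrite invr_gt0.
pose P (c : jacobi R) (h : nat) (e : R) := exists y, [/\ forall i, i < 0 -> y i = 0,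
     forall i, nc (y i) <= 1, d <= nc (y 0) &
     forall i : nat, (i <= h)%N -> nc (jact c y i%:Z) <= e].
have [H|] := pselect (forall h e, 0 < e -> P c' h e); first exact: half_kernel_limit d0 H.
move=> /existsNP[h1 /existsNP[e1 /not_implyP[e10 n1]]].
have [H|] := pselect (forall h e, 0 < e -> P (transpose_jac c) h e).
  have [y [hy y1 y0]] := half_kernel_limit d0 H.
  exfalso; apply: (coburn ell hk); exists (transpose_jac c), y, 1; split=> //.
    exact: jacobi_in_transpose.
  by exists 0.
move=> /existsNP[h2 /existsNP[e2 /not_implyP[e20 n2]]]; exfalso.
(* Small enough to contradict both failures [n1] and [n2], and with K e <= 1/2 so that interior
   residuals cannot account for an entry of modulus 1. *)
pose e := Num.min (Num.min e1 e2) (2 * K)^-1.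
have e0 : 0 < e by rewrite !lt_min e10 e20 invr_gt0 mulr_gt0.
have ee1 : e <= e1 by rewrite !ge_min lexx.
have ee2 : e <= e2 by rewrite !ge_min lexx orbT.
have eK : K * e <= 1 / 2.
  have : e <= (2 * K)^-1 by rewrite !ge_min lexx orbT.
  move=> /(ler_wpM2l (ltW K0)); rewrite invfM mulrCA mulfV ?gt_eqF// => /le_trans; apply.
  by lra.
(* The left residual is at most 6 b r, and the decay of [x] gives r s^(L-1) <= 4 K b |x 0|; hence
   the constant 24. *)
have [L0 hL0] := @exp_unbounded R s (24 * (K * b) * b) e s1 e0.
pose L := (maxn L0 h2).+1.
(* Rows up to [h1] then involve [c'] only, and L > h2 leaves the last h2 + 1 rows to the other
   matrix. *)
pose mid := h1.+2.
pose N := (mid + L)%N.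
(* Index [N] of [t'] corresponds to index 0 of [c]. Transposition and reflection each exchange [U]
   and [W], so [t'] is again over (U,V,W). *)
pose t' := shift_jac (- N%:Z) (reflect_jac (transpose_jac c)).
have ht' : jacobi_in U V W t'.
  exact/jacobi_in_shift/jacobi_in_reflect/jacobi_in_transpose.
pose t := Jacobi (fun i => if i < mid%:Z then lo c' i else lo t' i)
  (fun i => if i < mid%:Z then di c' i else di t' i)
  (fun i => if i < mid%:Z then up c' i else up t' i).
have ht : jacobi_in U V W t.
  move=> i; rewrite /t /=; have [] := hc' i; have [] := ht' i.
  by case: (i < mid%:Z).
have htb i : [/\ nc (lo t i) <= b, nc (di t i) <= b & nc (up t i) <= b].
  by have [? ? ?] := ht i; split; apply: hb; tauto.
(* The null vector [x] read backwards from the right end and cut at [mid]. Columns beyond [mid]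
   vanish by the null equation and columns before [mid - 1] meet only zeros; the cut leaves the
   columns [mid - 1] and [mid], where [x] has already decayed. *)
pose X (i : int) := if mid%:Z <= i then x (N%:Z - i) else 0.
have X0 i : ~~ (0 <= i < N.+1%:Z) -> X i = 0.
  rewrite /X; case: ifP => // h h'; apply: hx.1; clear -h h'; rewrite /mid in h; lia.
have colE j : mid%:Z < j -> j <= N%:Z -> jact (transpose_jac t) X j = 0.
  move=> hj1 hj2.
  have -> : jact (transpose_jac t) X j = jact c x (N%:Z - j).
    rewrite /jact /transpose_jac /t /= /X.
    rewrite ifF; last by clear -hj1; lia.
    rewrite ifT; last by clear -hj1; lia.
    rewrite ifF; last by clear -hj1; lia.
    rewrite ifT; last by clear -hj1; lia.
    rewrite ifF; last by clear -hj1; lia.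
    rewrite ifT; last by clear -hj1; lia.
    rewrite (_ : - (- N%:Z + (j - 1)) - 1 = N%:Z - j); last by ring.
    rewrite (_ : N%:Z - (j - 1) = N%:Z - j + 1); last by ring.
    rewrite (_ : - (- N%:Z + j) = N%:Z - j); last by ring.
    rewrite (_ : - (- N%:Z + (j + 1)) + 1 = N%:Z - j); last by ring.
    rewrite (_ : N%:Z - (j + 1) = N%:Z - j - 1); last by ring.
    by ring.
  by apply: hx.2; clear -hj2; lia.
set r := nc (x L%:Z) + nc (x L.-1%:Z).
have nX i : i <= mid%:Z + 1 -> nc (X i) <= r.
  move=> hi; rewrite /X; case: ifP => [h|_]; last first.
    by rewrite Normc.normc0 addr_ge0 ?normc_ge0.
  have [->|->] : i = mid%:Z \/ i = mid%:Z + 1 by clear -h hi; lia.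
    by rewrite (_ : N%:Z - mid%:Z = L%:Z) ?lerDl ?normc_ge0// /N; clear; lia.
  rewrite (_ : N%:Z - (mid%:Z + 1) = L.-1%:Z) ?lerDr ?normc_ge0//.
  by rewrite /N /L; clear; lia.
have col0 j : j < mid%:Z - 1 -> jact (transpose_jac t) X j = 0.
  move=> hj; rewrite /jact /X !ifF ?mulr0 ?addr0//; clear -hj; lia.
have htT i : [/\ nc (lo (transpose_jac t) i) <= b,
    nc (di (transpose_jac t) i) <= b & nc (up (transpose_jac t) i) <= b].
  by have [? ? ?] := jacobi_in_transpose ht i; split; apply: hb; tauto.
have colb j : j <= mid%:Z -> nc (jact (transpose_jac t) X j) <= 3 * b * r.
  move=> hj; have [h1' h2' h3'] := htT j.
  apply: le_trans (normc_lin3 _ _ _ h1' h2' h3') _.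
  rewrite -mulrA mulrCA ler_wpM2l ?(ltW b0)//.
  have a1 : nc (X (j - 1)) <= r by apply: nX; clear -hj; lia.
  have a2 : nc (X j) <= r by apply: nX; clear -hj; lia.
  have a3 : nc (X (j + 1)) <= r by apply: nX; clear -hj; lia.
  lra.
pose Tm : 'M[R[i]]_N.+1 := \matrix_(i, j) jacobi_mx t i%:Z j%:Z.
pose Xv : 'rV[R[i]]_N.+1 := \row_i X i%:Z.
have XT j : (Xv *m Tm) 0 j = jact (transpose_jac t) X j%:Z.
  rewrite mxE -(@sum_jacobi_mx _ _ X N.+1)//; apply: eq_bigr => i _.
  by rewrite !mxE jacobi_mx_transpose mulrC.
have XN : X N%:Z = x 0 by rewrite /X subrr ifT// /N; clear; lia.
have r0 : 0 <= 3 * b * r by rewrite mulr_ge0 ?addr_ge0 ?normc_ge0// mulr_ge0// ltW.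
have sumX : \sum_j nc ((Xv *m Tm) 0 j) <= 3 * b * r + 3 * b * r.
  rewrite -{1}(@sum_ord_delta _ N.+1 (mid%:Z - 1) (3 * b * r)); last first.
    by move=> h; exfalso; move: h; rewrite /N /mid; clear; lia.
  rewrite -{2}(@sum_ord_delta _ N.+1 mid%:Z (3 * b * r)); last first.
    by move=> h; exfalso; move: h; rewrite /N /mid; clear; lia.
  rewrite -big_split /= ler_sum// => j _; rewrite XT.
  have [j1|[j1|[j1|j1]]] : j%:Z < mid%:Z - 1 \/ j%:Z = mid%:Z - 1 \/ j%:Z = mid%:Z \/
      mid%:Z < j%:Z by clear; lia.
  - by rewrite col0// Normc.normc0 addr_ge0//; case: ifP.
  - rewrite [in leRHS]j1 eqxx; apply: (@le_trans _ _ (3 * b * r)).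
      by apply: colb; rewrite j1; clear; lia.
    by rewrite lerDl; case: ifP.
  - rewrite [in leRHS]j1 eqxx; apply: (@le_trans _ _ (3 * b * r)).
      by apply: colb; rewrite j1.
    by rewrite lerDr; case: ifP.
  - rewrite colE// ?Normc.normc0 ?addr_ge0//; try by case: ifP.
    by have := ltn_ord j; clear; lia.
have rsmall : 3 * b * r + 3 * b * r <= e * nc (x 0).
  have sL : 0 < s ^+ L.-1 by rewrite exprn_gt0//; lra.
  rewrite -(ler_pM2r sL).
  have hL : 24 * (K * b) * b <= e * s ^+ L.-1.
    by apply: le_trans hL0 _; rewrite ler_wpM2l ?(ltW e0)// ler_weXn2l ?(ltW s1)// leq_maxl.
  have d1 := dec L.-1.
  have d2 : nc (x L%:Z) * s ^+ L.-1 <= 2 * (K * b) * nc (x 0).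
    apply: le_trans (dec L); rewrite ler_wpM2l ?normc_ge0//.
    by rewrite ler_weXn2l ?(ltW s1)// /L.
  have d3 : r * s ^+ L.-1 <= 4 * (K * b) * nc (x 0) by rewrite /r; lra.
  have := ler_wpM2l (ltW b0) d3; have := ler_wpM2r (ltW nx0) hL; lra.
have Xv0 : Xv 0 ord_max != 0 by rewrite mxE XN.
have XvT : \sum_j nc ((Xv *m Tm) 0 j) <= e * nc (Xv 0 ord_max).
  by rewrite mxE XN; apply: le_trans sumX rsmall.
have [y [y1 [k yk] hy]] := approx_kernel_dual Xv0 (ltW e0) XvT.
pose Y (i : int) := if i < 0 then 0 else
  if insub `|i|%N is Some k then y k 0 else 0 : R[i].
have YE (i : 'I_N.+1) : Y i%:Z = y i 0.
  by rewrite /Y /= valK.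
have Y0 i : ~~ (0 <= i < N.+1%:Z) -> Y i = 0.
  rewrite /Y => h; case: ifP => // h'; rewrite insubF//.
  by clear -h h'; lia.
have Y1 i : nc (Y i) <= 1.
  rewrite /Y; case: ifP => _; first by rewrite Normc.normc0.
  by case: insub => [?|]; rewrite ?y1// Normc.normc0.
have rowE i : 0 <= i <= N%:Z -> nc (jact t Y i) <= e.
  move=> hi; have hi' : (`|i| < N.+1)%N by clear -hi; lia.
  have := hy (Ordinal hi'); rewrite mxE.
  under eq_bigr do rewrite mxE -YE.
  by rewrite (sum_jacobi_mx _ _ Y0) /= gez0_abs//; clear -hi; lia.
(* Extended by zero, [Y] has residual at most b |Y 0| in row -1, at most b |Y N| in row N + 1, and
   at most [e] in between. As K e <= 1/2 and some entry has modulus 1, one of the boundary entries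
   must reach 1 / (K b). *)
have [hy0|hyN] : d <= nc (Y 0) \/ d <= nc (Y N%:Z).
  apply: contrapT => /not_orP[/negP h1' /negP h2'].
  rewrite -!ltNge in h1' h2'.
  pose m := Num.max e (b * Num.max (nc (Y 0)) (nc (Y N%:Z))).
  have : nc (Y k%:Z) <= K * m.
    apply: (lb t ht Y 1) => // i.
    have [hi|[hi|[hi|hi]]] : (0 <= i <= N%:Z) \/ i = -1 \/ i = N%:Z + 1 \/
        (i < -1 \/ N%:Z + 1 < i) by clear; lia.
    - by rewrite le_max rowE.
    - rewrite /jact (Y0 (i - 1)) ?(Y0 i) ?hi// !mulr0 !add0r Normc.normcM le_max.
      have [_ _ h3'] := htb (-1).
      by rewrite ler_pM ?normc_ge0 ?orbT// le_max lexx.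
    - rewrite /jact (Y0 (i + 1)) ?(Y0 i); try by rewrite hi; clear; lia.
      rewrite !mulr0 !addr0 Normc.normcM le_max hi addrK.
      have [h3' _ _] := htb (N%:Z + 1).
      by rewrite (ler_pM _ _ h3') ?normc_ge0 ?orbT// le_max lexx orbT.
    - rewrite /jact !Y0 ?mulr0 ?addr0 ?Normc.normc0 ?le_max ?(ltW e0)//; clear -hi; lia.
  rewrite YE yk; apply/negP; rewrite -ltNge /m maxr_pMr ?(ltW K0)// gt_max.
  apply/andP; split; first by apply: le_lt_trans eK _; lra.
  by rewrite mulrA -ltr_pdivlMl// mulr1 gt_max h1' h2'.
- apply: n1; exists Y; split=> //.
    by move=> i i0; apply: Y0; clear -i0; lia.
  move=> i ih.
  have -> : jact c' Y i%:Z = jact t Y i%:Z.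
    by rewrite /jact /t /= !ifT//; rewrite /mid; clear -ih; lia.
  by apply: le_trans ee1; apply: rowE; rewrite /N /mid; clear -ih; lia.
- apply: n2; exists (fun i => Y (N%:Z - i)); split=> //.
  + by move=> i i0; apply: Y0; clear -i0; lia.
  + by rewrite subr0.
  move=> i ih.
  have hLh : (h2 < L)%N by rewrite /L ltnS leq_maxr.
  have -> : jact (transpose_jac c) (fun i => Y (N%:Z - i)) i%:Z = jact t Y (N%:Z - i%:Z).
    rewrite /jact /t /= !ifF; try by rewrite /N; clear -ih hLh; lia.
    rewrite (_ : - (- N%:Z + (N%:Z - i%:Z)) = i%:Z); last by ring.
    rewrite (_ : N%:Z - (i%:Z - 1) = N%:Z - i%:Z + 1); last by ring.
    rewrite (_ : N%:Z - (i%:Z + 1) = N%:Z - i%:Z - 1); last by ring.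
    by ring.
  by apply: le_trans ee2; apply: rowE; rewrite /N; clear -ih hLh; lia.
Qed.

(** * Null vectors from singular finite matrices *)

(** The shifts of [c] are over the same sets, so null vectors start at every [k]. Extended by zero,
    the one starting at [k] has its whole residual in row k - 1, where it equals [up c (k - 1)]; the
    lower bound thus keeps this coefficient away from 0. *)
Lemma half_kernels_everywhere (R : realType) (U V W : set R[i]) b K :
  uniformly_elliptic U V W b K -> has_half_kernel U V W ->
  forall c, jacobi_in U V W c -> forall k : int, exists z,
  [/\ z k = 1, forall i, i < k -> z i = 0, forall i, k <= i -> jact c z i = 0,
   forall n : nat, nc (z (k + n%:Z)) * decay_rate b K ^+ n <= 2 * (K * b)
   & 1 <= K * nc (up c (k - 1))].
Proof.
move=> ell hk c hc k; have hck := jacobi_in_shift k hc.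
have [y [hy y1 y0]] := has_half_kernel_spread ell hk hck.
have dec := half_kernel_decay ell hck hy y1.
have ny0 : 0 < nc (y 0) by rewrite normc_gt0.
pose z i := (y 0)^-1 * y (i - k).
have zk : z k = 1 by rewrite /z subrr mulVf.
have zlt i : i < k -> z i = 0.
  by move=> ik; rewrite /z (hy.1 (i - k)) ?mulr0//; clear -ik; lia.
have zE i : jact c z i = (y 0)^-1 * jact (shift_jac k c) y (i - k).
  rewrite /jact /z /= addrCA subrr addr0.
  rewrite (_ : i - 1 - k = i - k - 1); last by ring.
  by rewrite (_ : i + 1 - k = i - k + 1); [ring|ring].
have zge i : k <= i -> jact c z i = 0.
  by move=> ik; rewrite zE hy.2 ?mulr0//; clear -ik; lia.
exists z; split=> //.
  move=> n; rewrite /z addrAC subrr add0r Normc.normcM Normc.normcV -mulrA.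
  by rewrite ler_pdivrMl// (mulrC (nc (y 0))) dec.
have [b0 K0 hb lb] := ell.
have zb i : nc (z i) <= nc (y 0)^-1.
  by rewrite /z Normc.normcM ler_piMr ?normc_ge0.
have := lb c hc z _ (nc (up c (k - 1))) zb _ k; rewrite zk Normc.normc1; apply=> i.
have [ik|[ik|ik]] : k <= i \/ i = k - 1 \/ i < k - 1 by clear; lia.
- by rewrite zge// Normc.normc0 normc_ge0.
- rewrite /jact ik subrK zk !zlt ?mulr0 ?add0r ?mulr1//; clear; lia.
- by rewrite /jact !zlt ?mulr0 ?addr0 ?Normc.normc0 ?normc_ge0//; clear -ik; lia.
Qed.

(* The blocks [x, 0, a x, 0, a^2 x, ...] form a kernel vector of the periodic
   Jacobi matrix with diagonal blocks [F, v, F, v, ...], where [F x = 0]. *)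
Lemma has_half_kernel_blocks (R : realType) (U V W : set R[i]) c (x : int -> R[i])
    (n : nat) (u w : R[i]) :
  jacobi_in U V W c -> U u -> W w ->
  (forall i, ~~ (0 <= i < n%:Z) -> x i = 0) -> (exists i, x i != 0) ->
  (forall i, 0 <= i < n%:Z -> jact c x i = 0) ->
  nc (u * x (n%:Z - 1)) <= nc (w * x 0) -> has_half_kernel U V W.
Proof.
move=> hc Uu Ww x0 [j xj] hx hle.
(* The separating row reads u x(n-1) + w a x(0) = 0. If w x(0) = 0, the inequality [hle] makes the
   other term vanish as well. *)
pose a := - (u * x (n%:Z - 1)) / (w * x 0).
have aE : u * x (n%:Z - 1) + w * (a * x 0) = 0.
  have [e|e] := eqVneq (w * x 0) 0; last first.
    by rewrite mulrCA /a divfK// addrN.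
  move: hle; rewrite e Normc.normc0 -(Normc.normc0 R).
  have := normc_ge0 (u * x (n%:Z - 1)) => h1 h2.
  have /eqP : nc (u * x (n%:Z - 1)) = 0.
    by apply/eqP; rewrite eq_le h1 andbT -(Normc.normc0 R).
  by rewrite normc_eq0 mulrCA e mulr0 addr0 => /eqP.
have a1 : nc a <= 1.
  rewrite /a Normc.normcM normcN Normc.normcV.
  have [e|e] := eqVneq (w * x 0) 0; first by rewrite e Normc.normc0 invr0 mulr0.
  by rewrite ler_pdivrMr ?normc_gt0// mul1r.
(* A period consists of a block of length [n] and one separating zero entry. *)
pose p := n.+1.
pose z (i : int) := if 0 <= i then a ^+ (`|i| %/ p) * x (`|i| %% p)%:Z else 0.
have zE q r : (r < p)%N -> z (q * p + r)%:Z = a ^+ q * x r%:Z.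
  by move=> rp; rewrite /z /= divnMDl// divn_small// addn0 modnMDl modn_small.
pose m (i : int) := (`|i| %% p)%N.
pose C := Jacobi (fun i => if m i == n then u else lo c (m i)%:Z)
  (fun i => di c (m i)%:Z) (fun i => if m i == n then w else up c (m i)%:Z).
have hC : jacobi_in U V W C.
  by move=> i; rewrite /C /=; have [] := hc (m i)%:Z; case: ifP.
have [Bx hBx] : exists B, forall i, nc (x i) <= B.
  exists (\sum_(k < n) nc (x k%:Z)) => i.
  have [h|/x0 ->] := boolP (0 <= i < n%:Z); last first.
    by rewrite Normc.normc0 sumr_ge0// => k _; exact: normc_ge0.
  have hi : (`|i| < n)%N by clear -h; lia.
  rewrite (bigD1 (Ordinal hi)) //= gez0_abs; last by clear -h; lia.
  by rewrite lerDl sumr_ge0// => k _; exact: normc_ge0.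
exists C, z, Bx; split=> //.
- split=> [i i0|i i0]; first by rewrite /z ifF//; clear -i0; lia.
  have -> : i = (`|i| %/ p * p + `|i| %% p)%N%:Z by rewrite -divn_eq gez0_abs.
  set q := (`|i| %/ p)%N; set r := (`|i| %% p)%N.
  have rp : (r < p)%N by rewrite ltn_mod.
  have mE : m (q * p + r)%N%:Z = r by rewrite /m /= modnMDl modn_small.
  have [rn|rn] := eqVneq r n.
    rewrite /jact /C /= mE rn eqxx.
    have n0 : (0 < n)%N.
      case: (posnP n) => // n0; move: xj; rewrite x0 ?eqxx// n0; clear; lia.
    rewrite (_ : (q * p + n)%N%:Z - 1 = (q * p + n.-1)%N%:Z); last by clear -n0; lia.
    rewrite (_ : (q * p + n)%N%:Z + 1 = (q.+1 * p + 0)%N%:Z); last first.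
      by rewrite mulSn /p; clear; lia.
    rewrite !zE//; last by rewrite /p; clear; lia.
    rewrite (x0 n%:Z) ?mulr0 ?addr0; last by clear; lia.
    rewrite (_ : n.-1%:Z = n%:Z - 1); last by clear -n0; lia.
    by rewrite exprS -[RHS](mulr0 (a ^+ q)) -aE; ring.
  have rn' : (r < n)%N by rewrite ltn_neqAle rn -ltnS.
  have -> : jact C z (q * p + r)%N%:Z = a ^+ q * jact c x r%:Z.
    rewrite /jact /C /= mE (negbTE rn).
    have -> : z ((q * p + r)%N%:Z + 1) = a ^+ q * x (r%:Z + 1).
      rewrite (_ : (q * p + r)%N%:Z + 1 = (q * p + r.+1)%N%:Z); last by clear; lia.
      by rewrite zE ?ltnS// (_ : r%:Z + 1 = r.+1%:Z)//; clear; lia.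
    have -> : z ((q * p + r)%N%:Z - 1) = a ^+ q * x (r%:Z - 1).
      have [r0|r0] := posnP r; last first.
        rewrite (_ : (q * p + r)%N%:Z - 1 = (q * p + r.-1)%N%:Z); last by clear -r0; lia.
        rewrite zE; last by apply: leq_ltn_trans rp; exact: leq_pred.
        by rewrite (_ : r%:Z - 1 = r.-1%:Z)//; clear -r0; lia.
      rewrite r0 (x0 (0%:Z - 1))// mulr0.
      have [q0|q0] := posnP q; first by rewrite q0 mul0n.
      rewrite (_ : (q * p + 0)%N%:Z - 1 = (q.-1 * p + n)%N%:Z); last first.
        by rewrite -{1}(prednK q0) mulSn /p; clear; lia.
      by rewrite zE// x0 ?mulr0//; clear; lia.
    by rewrite zE//; ring.
  by rewrite hx ?mulr0//; clear -rn'; lia.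
- move=> i; rewrite /z; case: ifP => _; last first.
    by rewrite Normc.normc0 (le_trans (normc_ge0 (x 0))).
  rewrite Normc.normcM -[leRHS]mul1r ler_pM ?normc_ge0//.
  elim: (_ %/ _)%N => [|q ih]; first by rewrite expr0 Normc.normc1.
  by rewrite exprS Normc.normcM mulr_ile1 ?normc_ge0.
- exists j.
  have hj : 0 <= j < n%:Z by apply: contraT => /x0 e; rewrite e eqxx in xj.
  have -> : j = (0 * p + `|j|)%N%:Z by clear -hj; lia.
  rewrite zE; last by rewrite /p; clear -hj; lia.
  by rewrite expr0 mul1r gez0_abs//; clear -hj; lia.
Qed.

(** Reversing the order of the indices exchanges the two ends of [x] as well as [U] and [W], so the
    inequality required by [has_half_kernel_blocks] holds in one of the two orders. *)
Lemma has_half_kernel_finite (R : realType) (U V W : set R[i]) c (x : int -> R[i])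
    (n : nat) :
  jacobi_in U V W c ->
  (forall i, ~~ (0 <= i < n%:Z) -> x i = 0) -> (exists i, x i != 0) ->
  (forall i, 0 <= i < n%:Z -> jact c x i = 0) ->
  has_half_kernel U V W \/ has_half_kernel W V U.
Proof.
move=> hc x0 xj hx; have [Uu _ Ww] := hc 0.
have [hle|hlt] := leP (nc (lo c 0 * x (n%:Z - 1))) (nc (up c 0 * x 0)).
  by left; exact: (has_half_kernel_blocks hc Uu Ww x0 xj hx hle).
right.
pose c' := reflect_jac (shift_jac (n%:Z - 1) c).
pose x' i := x (n%:Z - 1 + - i).
have hc' : jacobi_in W V U c' by exact/jacobi_in_reflect/jacobi_in_shift.
apply: (has_half_kernel_blocks (x := x') (n := n) hc' Ww Uu).
- by move=> i hi; apply: x0; clear -hi; lia.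
- case: xj => j xj; exists (n%:Z - 1 - j); rewrite /x'.
  by rewrite (_ : n%:Z - 1 - (n%:Z - 1 - j) = j)//; ring.
- move=> i hi; rewrite /x' /c'.
  rewrite (jact_reflect (shift_jac (n%:Z - 1) c) (fun j => x (n%:Z - 1 + j))) jact_shift.
  by apply: hx; clear -hi; lia.
- by rewrite /x' subrr subr0 ltW.
Qed.

Lemma jacobi_in_entry (R : realType) (U V W : set R[i]) c (i j : int) :
  jacobi_in U V W c -> jacobi_entry U V W i j (jacobi_mx c i j).
Proof.
move=> hc; have [h1 h2 h3] := hc i; rewrite /jacobi_entry /jacobi_mx.
by case: ifP => //; case: ifP => //; case: ifP.
Qed.

(** Outside the matrix the coefficients are filled with arbitrary elements of the three nonempty
    sets. *)
Lemma M_n_jacobi (R : realType) (U V W : set R[i]) (n : nat) (F : 'M[R[i]]_n) :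
  U !=set0 -> V !=set0 -> W !=set0 -> M_n U V W F ->
  exists2 c, jacobi_in U V W c & forall i j : 'I_n, jacobi_mx c i%:Z j%:Z = F i j.
Proof.
move=> [u Uu] [v Vv] [w Ww]; case: n F => [|n] F hF.
  by exists (Jacobi (fun=> u) (fun=> v) (fun=> w)) => [i|[]].
pose f (i j : int) := F (inord `|i|) (inord `|j|).
pose c := Jacobi (fun i => if 1 <= i <= n%:Z then f i (i - 1) else u)
  (fun i => if 0 <= i <= n%:Z then f i i else v)
  (fun i => if 0 <= i < n%:Z then f i (i + 1) else w).
have fE i j : 0 <= i <= n%:Z -> 0 <= j <= n%:Z -> jacobi_entry U V W i j (f i j).
  move=> hi hj; have := hF (inord `|i|) (inord `|j|).
  by rewrite !inordK ?gez0_abs//; clear -hi hj; lia.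
exists c => [i|i j].
  rewrite /c /=; split; case: ifP => // hi.
  - have := fE i (i - 1) ltac:(clear -hi; lia) ltac:(clear -hi; lia).
    by rewrite /jacobi_entry subrK eqxx.
  - have := fE i i ltac:(clear -hi; lia) ltac:(clear -hi; lia).
    by rewrite /jacobi_entry eqxx ifF//; clear; lia.
  - have := fE i (i + 1) ltac:(clear -hi; lia) ltac:(clear -hi; lia).
    by rewrite /jacobi_entry eqxx ifF ?ifF//; clear; lia.
have := hF i j; have [li lj] := (ltn_ord i, ltn_ord j).
have fij : f i%:Z j%:Z = F i j by rewrite /f !absz_nat !inord_val.
rewrite /jacobi_entry /jacobi_mx /c /=.
case: eqP => [e|_].
  by rewrite ifT -?fij ?e ?addrK//; clear -li e; lia.
case: eqP => [e|_].
  by rewrite ifT -?fij ?e//; clear -lj; lia.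
case: eqP => [e|_]; last by move=> ->.
by rewrite ifT -?fij ?e//; clear -lj e; lia.
Qed.

Lemma has_half_kernel_singular (R : realType) (U V W : set R[i]) (n : nat)
    (F : 'M[R[i]]_n) :
  U !=set0 -> V !=set0 -> W !=set0 -> M_n U V W F -> F \notin unitmx ->
  has_half_kernel U V W \/ has_half_kernel W V U.
Proof.
move=> U0 V0 W0 hF; have [c hc cF] := M_n_jacobi U0 V0 W0 hF.
rewrite -unitmx_tr unitmxE unitfE negbK => /det0P[y y0 yF].
pose x (i : int) : R[i] :=
  if i < 0 then 0 else if insub `|i|%N is Some k then y 0 k else 0.
have xE (i : 'I_n) : x i%:Z = y 0 i by rewrite /x /= valK.
have x0 i : ~~ (0 <= i < n%:Z) -> x i = 0.
  rewrite /x => h; case: ifP => // h'; rewrite insubF//.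
  by clear -h h'; lia.
apply: (has_half_kernel_finite hc x0).
  have [k yk] : exists k, y 0 k != 0.
    by apply/existsP; rewrite -negb_forall; apply: contra y0 => /forallP h;
      apply/eqP/rowP => j; rewrite mxE; apply/eqP.
  by exists k%:Z; rewrite xE.
move=> i hi; have hi' : (`|i| < n)%N by clear -hi; lia.
rewrite -(sum_jacobi_mx c i x0).
have := congr1 (fun A : 'rV[R[i]]_n => A 0 (Ordinal hi')) yF.
rewrite !mxE => /(etrans _); apply; apply: eq_bigr => j _.
by rewrite mxE -cF xE mulrC /= gez0_abs//; clear -hi; lia.
Qed.

(** * The norm of l^p *)

Lemma powR_convex2 (R : realType) (r t a b : R) : 1 <= r -> 0 <= t <= 1 ->
  0 <= a -> 0 <= b ->
  (t * a + (1 - t) * b) `^ r <= t * a `^ r + (1 - t) * b `^ r.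
Proof.
move=> r1 /andP[t0 t1] a0 b0.
have ha : a \in (`[0, +oo[%classic : set R) by rewrite inE /= in_itv /= a0.
have hb : b \in (`[0, +oo[%classic : set R) by rewrite inE /= in_itv /= b0.
exact: (convex_powR r1 (Itv01 t0 t1) ha hb).
Qed.

(** For [0 <= M] and [1 <= p] this says that the l^p norm is at most [M], by real-valued finite sums
    instead of extended reals and a supremum. *)
Definition lp_bounded (R : realType) (I : choiceType) (p : \bar R) (M : R)
    (x : I -> R[i]) : Prop :=
  match p with
  | r%:E => forall s : seq I, uniq s -> \sum_(i <- s) nc (x i) `^ r <= M `^ r
  | _ => forall i, nc (x i) <= M
  end.

Section LpBounded.
Context {R : realType} {p : \bar R} (p1 : (1 <= p)%E).
Implicit Types I J : choiceType.

Lemma lpnorm_leP I (M : R) (x : I -> R[i]) : 0 <= M ->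
  (lpnorm p x <= M%:E)%E <-> lp_bounded p M x.
Proof.
move=> M0; case: p p1 => [r|_|]; last by rewrite leeNy_eq.
- rewrite lee_fin => r1 /=; have r0 : 0 < r by apply: lt_le_trans r1.
  have -> : ((\esum_(i in [set: I]) (nc (x i) `^ r)%:E) `^ r^-1 <= M%:E)%E =
      (\esum_(i in [set: I]) (nc (x i) `^ r)%:E <= (M `^ r)%:E)%E.
    have : (0 <= \esum_(i in [set: I]) (nc (x i) `^ r)%:E)%E.
      by apply: esum_ge0 => i _; rewrite lee_fin powR_ge0.
    case: (\esum_(i in [set: I]) _)%E => [a|_|//]; last first.
      by rewrite poweRyr ?gt_eqF ?invr_gt0// !leye_eq.
    rewrite lee_fin poweR_EFin !lee_fin => a0; apply/idP/idP => h.
      have := ge0_ler_powR (ltW r0) (powR_ge0 a r^-1) M0 h.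
      by rewrite -powRrM mulVf ?gt_eqF// powRr1.
    have r0' : 0 <= r^-1 by rewrite invr_ge0 ltW.
    have := ge0_ler_powR r0' a0 (powR_ge0 M r) h.
    by rewrite -powRrM mulfV ?gt_eqF// powRr1.
  split=> [h s us|h].
    rewrite -lee_fin -sumEFin; apply: le_trans h; apply: esum_ge.
    exists [set` s]; last by rewrite -fsbig_seq.
    by split=> //; exact: finite_seq.
  apply: ge_ereal_sup => _ [X [finX _] <-].
  by rewrite fsbig_finite// sumEFin lee_fin h// fset_uniq.
- rewrite /=; split=> [h i|h].
    by rewrite -lee_fin; apply: le_trans h; apply: ereal_sup_ubound; exists i.
  by apply: ge_ereal_sup => _ [i _ <-]; rewrite lee_fin.
Qed.

Lemma lpP I (x : I -> R[i]) : lp p x <-> exists2 M, 0 <= M & lp_bounded p M x.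
Proof.
split=> [h|[M M0 /(lpnorm_leP _ M0) h]]; last by apply: le_lt_trans h (ltry _).
have h' : (lpnorm p x < +oo)%E by exact: h.
exists (Num.max 0 (fine (lpnorm p x))); first by rewrite le_max lexx.
apply/lpnorm_leP; first by rewrite le_max lexx.
case: (lpnorm p x) h' => [a|//|] _; last by rewrite leNye.
by rewrite lee_fin le_max lexx orbT.
Qed.

Lemma lp_bounded_le I (M N : R) (x : I -> R[i]) : 0 <= M -> M <= N ->
  lp_bounded p M x -> lp_bounded p N x.
Proof.
move=> M0 MN; rewrite /lp_bounded; case: p p1 => [r|_|_].
- rewrite lee_fin => r1 h s us; apply: le_trans (h s us) _.
  by apply: ge0_ler_powR; rewrite ?nnegrE//; [apply: le_trans r1|apply: le_trans MN].
- by move=> h i; apply: le_trans MN.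
- by move=> h i; apply: le_trans MN.
Qed.

(** The norm is tested on finite sets, and the dominating vector may depend on the set; infinite
    series are thus handled by finite partial sums. *)
Lemma lp_bounded_fatou I (M : R) (x : I -> R[i]) :
  (forall s : seq I, exists2 y, lp_bounded p M y &
    forall i, i \in s -> nc (x i) <= nc (y i)) -> lp_bounded p M x.
Proof.
rewrite /lp_bounded; case: p p1 => [r|_|_].
- rewrite lee_fin => r1 h s us; have [y hy xy] := h s.
  apply: le_trans (hy s us); rewrite !big_seq ler_sum// => i si.
  apply: ge0_ler_powR; rewrite ?nnegrE ?normc_ge0 ?xy//.
  by apply: le_trans r1.
- move=> h i; have [y hy xy] := h [:: i].
  by apply: le_trans (hy i); apply: xy; rewrite inE.
- move=> h i; have [y hy xy] := h [:: i].
  by apply: le_trans (hy i); apply: xy; rewrite inE.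
Qed.

Lemma lp_bounded_mono I (M : R) (x y : I -> R[i]) :
  (forall i, nc (x i) <= nc (y i)) -> lp_bounded p M y -> lp_bounded p M x.
Proof. by move=> xy hy; apply: lp_bounded_fatou => s; exists y. Qed.

Lemma lp_bounded_scale I (M : R) (a : R[i]) (x : I -> R[i]) : 0 <= M ->
  lp_bounded p M x -> lp_bounded p (nc a * M) (fun i => a * x i).
Proof.
move=> M0; rewrite /lp_bounded; case: p p1 => [r|_|_].
- move=> _ h s us.
  rewrite powRM ?normc_ge0//; apply: le_trans (ler_wpM2l (powR_ge0 _ _) (h s us)).
  rewrite mulr_sumr ler_sum// => i _.
  by rewrite Normc.normcM powRM ?normc_ge0.
- by move=> h i; rewrite Normc.normcM ler_wpM2l ?normc_ge0.
- by move=> h i; rewrite Normc.normcM ler_wpM2l ?normc_ge0.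
Qed.

Lemma lp_bounded_coord I (M : R) (x : I -> R[i]) (i : I) : 0 <= M ->
  lp_bounded p M x -> nc (x i) <= M.
Proof.
move=> M0; rewrite /lp_bounded; case: p p1 => [r|_|_].
- rewrite lee_fin => r1 /(_ [:: i] isT); rewrite big_seq1 => h.
  have r0 : 0 < r by apply: lt_le_trans r1.
  rewrite leNgt; apply/negP => h'.
  by have := gt0_ltr_powR r0 M0 (normc_ge0 (x i)) h'; rewrite ltNge h.
- by move=> ->.
- by move=> ->.
Qed.

(** Minkowski's inequality: (x + y) / (M + N) is the convex combination of x / M and y / N with
    weight t = M / (M + N), and r-th powers are convex. Zero bounds are treated apart because of the
    divisions. *)
Lemma lp_bounded_add I (M N : R) (x y : I -> R[i]) : 0 <= M -> 0 <= N ->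
  lp_bounded p M x -> lp_bounded p N y ->
  lp_bounded p (M + N) (fun i => x i + y i).
Proof.
move=> M0 N0 hx hy.
have [M00|Mn0] := eqVneq M 0.
  apply: (lp_bounded_mono (y := y)); last by rewrite M00 add0r.
  move=> i; have := lp_bounded_coord i M0 hx; rewrite M00 => xi.
  by apply: le_trans (normcD _ _) _; rewrite gerDr.
have [N00|Nn0] := eqVneq N 0.
  apply: (lp_bounded_mono (y := x)); last by rewrite N00 addr0.
  move=> i; have := lp_bounded_coord i N0 hy; rewrite N00 => yi.
  by apply: le_trans (normcD _ _) _; rewrite gerDl.
have Mp : 0 < M by rewrite lt0r Mn0.
have Np : 0 < N by rewrite lt0r Nn0.
have MN : 0 < M + N by rewrite addr_gt0.
move: hx hy; rewrite /lp_bounded; case: p p1 => [r|_|_].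
- rewrite lee_fin => r1 hx hy s us.
  have r0 : 0 <= r by apply: le_trans r1.
  pose t := M / (M + N).
  have t01 : 0 <= t <= 1.
    by rewrite /t divr_ge0 ?(ltW MN)//= ler_pdivrMr// mul1r lerDl.
  have tE : 1 - t = N / (M + N) by rewrite /t; field; rewrite gt_eqF.
  apply: (@le_trans _ _ (\sum_(i <- s) (M + N) `^ r *
     (t / M `^ r * nc (x i) `^ r + (1 - t) / N `^ r * nc (y i) `^ r))).
    apply: ler_sum => i _.
    have -> : t / M `^ r * nc (x i) `^ r + (1 - t) / N `^ r * nc (y i) `^ r =
       t * (nc (x i) / M) `^ r + (1 - t) * (nc (y i) / N) `^ r.
      have iM (m : R) : 0 <= m -> m^-1 `^ r = (m `^ r)^-1.
        by move=> m0; rewrite -powR_inv1// -powRrM mulN1r powRN.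
      by rewrite !powRM ?normc_ge0 ?invr_ge0// !iM//; ring.
    have := powR_convex2 r1 t01 (divr_ge0 (normc_ge0 (x i)) M0)
       (divr_ge0 (normc_ge0 (y i)) N0).
    move=> /(ler_wpM2l (powR_ge0 (M + N) r)); apply: le_trans.
    have [t0 t1] := andP t01.
    rewrite -powRM ?(ltW MN)//; last first.
      by rewrite addr_ge0// mulr_ge0 ?divr_ge0 ?normc_ge0//; lra.
    apply: ge0_ler_powR; rewrite ?nnegrE ?normc_ge0//.
      rewrite mulr_ge0 ?(ltW MN)// addr_ge0// mulr_ge0 ?divr_ge0 ?normc_ge0//; lra.
    rewrite tE /t; have -> : (M + N) * (M / (M + N) * (nc (x i) / M) +
       N / (M + N) * (nc (y i) / N)) = nc (x i) + nc (y i).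
      by field; rewrite Mn0 Nn0 gt_eqF.
    exact: normcD.
  rewrite -mulr_sumr -[leRHS]mulr1 ler_wpM2l ?powR_ge0// big_split /= -!mulr_sumr.
  have [t0 t1] := andP t01.
  have hM : 0 < M `^ r by rewrite powR_gt0.
  have hN : 0 < N `^ r by rewrite powR_gt0.
  have a1 : t / M `^ r * \sum_(i <- s) nc (x i) `^ r <= t.
    by rewrite mulrAC ler_pdivrMr// ler_wpM2l// hx.
  have a2 : (1 - t) / N `^ r * \sum_(i <- s) nc (y i) `^ r <= 1 - t.
    by rewrite mulrAC ler_pdivrMr// ler_wpM2l ?hy//; lra.
  lra.
- by move=> hx hy i; apply: le_trans (normcD _ _) _; rewrite lerD.
- by move=> hx hy i; apply: le_trans (normcD _ _) _; rewrite lerD.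
Qed.

Lemma lp_bounded0 I (M : R) : 0 <= M -> lp_bounded p M (fun _ : I => 0 : R[i]).
Proof.
move=> M0; rewrite /lp_bounded; case: p p1 => [r|_|_].
- rewrite lee_fin => r1 s _; rewrite big1 ?powR_ge0// => i _.
  by rewrite Normc.normc0 powR0// gt_eqF//; apply: lt_le_trans r1.
- by rewrite Normc.normc0.
- by rewrite Normc.normc0.
Qed.

Lemma lp_bounded_sum I (T : Type) (s : seq T) (M : T -> R) (x : T -> I -> R[i]) :
  (forall k, 0 <= M k) -> (forall k, lp_bounded p (M k) (x k)) ->
  lp_bounded p (\sum_(k <- s) M k) (fun i => \sum_(k <- s) x k i).
Proof.
move=> M0 hx; elim: s => [|k s ih].
  rewrite big_nil; apply: (lp_bounded_mono _ (lp_bounded0 _ _)) => // i.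
  by rewrite big_nil.
rewrite big_cons.
have h := lp_bounded_add (M0 k) (sumr_ge0 _ (fun j _ => M0 j)) (hx k) ih.
by apply: lp_bounded_mono h => i; rewrite big_cons.
Qed.

Lemma lp_bounded_delta I (j : I) :
  lp_bounded p 1 (fun i => if i == j then 1 else 0 : R[i]).
Proof.
rewrite /lp_bounded; case: p p1 => [r|_ i|_ i].
- rewrite lee_fin => r1 s us.
  have r0 : r != 0 by rewrite gt_eqF//; apply: lt_le_trans r1.
  have [js|js] := boolP (j \in s); last first.
    rewrite big_seq big1 ?powR_ge0// => i si.
    rewrite ifF ?Normc.normc0 ?powR0//; apply: contraNF js => /eqP <-.
    by [].
  rewrite (bigD1_seq j)//= eqxx Normc.normc1 big1 ?addr0// => i ij.
  by rewrite (negbTE ij) Normc.normc0 powR0.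
- by case: eqP => _; rewrite ?Normc.normc1 ?Normc.normc0.
- by case: eqP => _; rewrite ?Normc.normc1 ?Normc.normc0.
Qed.

(** [h] is a partial injection, which covers shifts, restrictions and extensions by zero at once. *)
Lemma lp_bounded_reindex I J (M : R) (x : I -> R[i]) (h : J -> option I) : 0 <= M ->
  (forall j j' i, h j = Some i -> h j' = Some i -> j = j') ->
  lp_bounded p M x -> lp_bounded p M (fun j => oapp x 0 (h j)).
Proof.
move=> M0 hinj; rewrite /lp_bounded; case: p p1 => [r|_|_].
- rewrite lee_fin => r1 hx s us.
  have r0 : r != 0 by rewrite gt_eqF//; apply: lt_le_trans r1.
  have -> : \sum_(j <- s) nc (oapp x 0 (h j)) `^ r =
      \sum_(i <- pmap h s) nc (x i) `^ r.
    elim: s {us} => [|j s ih]; rewrite ?big_nil// big_cons ih.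
    rewrite [pmap h (j :: s)]/=; case: (h j) => [i|]; rewrite [RHS]/=; first by rewrite big_cons.
    by rewrite [oapp x 0 None]/= Normc.normc0 powR0// add0r.
  apply: hx; elim: s us => //= j s ih /andP[js us].
  case e : (h j) => [i|] /=; last exact: ih.
  rewrite ih// andbT mem_pmap; apply: contra js => /mapP[j' sj' e'].
  by rewrite (hinj j j' i).
- by move=> hx j; case: (h j) => [i|]; rewrite [oapp _ _ _]/= ?hx// Normc.normc0.
- by move=> hx j; case: (h j) => [i|]; rewrite [oapp _ _ _]/= ?hx// Normc.normc0.
Qed.

End LpBounded.

(** * Gliding humps *)

Lemma fsbig_delta (T : nmodType) (I : choiceType) (e : I -> int) (D : set I)
    (k : int) (g : T) : injective e -> finite_set D ->
  (~ (exists2 j, D j & e j = k) -> g = 0) ->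
  \sum_(j \in D) (if e j == k then g else 0) = g.
Proof.
move=> einj finD h; have [[j Dj ej]|/h ->] := pselect (exists2 j, D j & e j = k).
  rewrite (fsbigD1 j)//= ej eqxx fsbig1 ?addr0// => i [_ ij].
  by case: eqP => // eik; exfalso; apply: ij; apply: einj; rewrite ej.
by rewrite fsbig1// => j _; case: ifP.
Qed.

Lemma fsbig_jacobi_mx (R : realType) (I : choiceType) (e : I -> int) (D : set I)
    (c : jacobi R) (z : int -> R[i]) (i : int) : injective e ->
  (forall k, ~ (exists2 j, D j & e j = k) -> z k = 0) ->
  \sum_(j \in D) jacobi_mx c i (e j) * z (e j) = jact c z i.
Proof.
move=> einj h.
pose D' := D `&` e @^-1` [set` [:: i - 1; i; i + 1]].
have finD' : finite_set D'.
  apply: finite_setIr; apply: finite_preimage => [x y _ _|]; first exact: einj.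
  exact: finite_seq.
have -> : \sum_(j \in D) jacobi_mx c i (e j) * z (e j) =
    \sum_(j \in D') jacobi_mx c i (e j) * z (e j).
  apply/esym/fsbig_widen; first by move=> j [].
  move=> j [Dj nD'] /=; rewrite jacobi_mx_split.
  have : ~ e j \in [:: i - 1; i; i + 1] by move=> hj; apply: nD'; split.
  by rewrite !inE => /negP /norP[/negbTE -> /norP[/negbTE -> /negbTE ->]]; rewrite !addr0.
under eq_fsbigr do rewrite jacobi_mx_split.
have hD k : k \in [:: i - 1; i; i + 1] -> ~ (exists2 j, D' j & e j = k) -> z k = 0.
  move=> hk hn; apply: h => -[j Dj ej]; apply: hn; exists j => //; split=> //=.
  by rewrite ej.
rewrite !fsbig_split//= !fsbig_delta//.
- by move=> /hD ->; rewrite ?mulr0// !inE eqxx ?orbT.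
- by move=> /hD ->; rewrite ?mulr0// !inE eqxx ?orbT.
- by move=> /hD ->; rewrite ?mulr0// !inE eqxx ?orbT.
Qed.

(** [zeta] is an approximate left null vector: as a functional supported on [t], away from [s], it
    has norm at most [e] on the image of the unit ball, although it takes the value 1 at the unit
    vector [b]. *)
Definition hump (R : realType) (I : choiceType) (p : \bar R) (A : I -> I -> R[i])
    (e : R) (s t : seq I) (zeta b : I -> R[i]) :=
  [/\ uniq t /\ (forall i, i \in t -> i \notin s), forall i, i \notin t -> b i = 0,
    lp_bounded p 1 b, \sum_(i <- t) zeta i * b i = 1 &
    forall x M, 0 <= M -> lp_bounded p M x ->
      nc (\sum_(i <- t) zeta i * mxact A x i) <= e * M].

(** Humps with disjoint supports and e = 4^-j are distributed over d + 1 residue classes, each class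
    giving one vector, the sum of its 2^-j b_j. In codimension [d] some nontrivial combination of
    these d + 1 vectors lies in the image; paired with zeta_j it gives 2^-j times a fixed nonzero
    coefficient, for infinitely many [j], against a bound of order 4^-j. *)
Lemma humps_infinite_codim (R : realType) (I : choiceType) (p : \bar R)
    (A : I -> I -> R[i]) (d : nat) :
  (1 <= p)%E ->
  (forall a x y, mxact A (fun i => a * x i + y i) =
     (fun i => a * mxact A x i + mxact A y i)) ->
  (forall e s, 0 < e -> exists t zeta b, hump p A e s t zeta b) ->
  ~ quotient_dim (lp p) (image_space p A) d.
Proof.
move=> p1 lin H [f [_ fq]].
have /choice[Hf HfP] : forall es : nat * seq I, exists tzb : seq I * (I -> R[i]) * (I -> R[i]),
    hump p A (4^-1 ^+ es.1) es.2 tzb.1.1 tzb.1.2 tzb.2.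
  move=> [j s]; have [|t [zeta [b h]]] := H (4^-1 ^+ j) s.
    by rewrite exprn_gt0// invr_gt0.
  by exists (t, zeta, b).
pose S := fix S (j : nat) : seq I := if j is k.+1 then S k ++ (Hf (k, S k)).1.1 else [::].
pose t j := (Hf (j, S j)).1.1.
pose zeta j := (Hf (j, S j)).1.2.
pose b j := (Hf (j, S j)).2.
have hP j : hump p A (4^-1 ^+ j) (S j) (t j) (zeta j) (b j) by exact: HfP (j, S j).
have tS j k i : (j < k)%N -> i \in t j -> i \in S k.
  elim: k => // k ih; rewrite ltnS leq_eqVlt => /orP[/eqP <-|jk] it.
    by rewrite /= mem_cat -/(t j) it orbT.
  by rewrite /= mem_cat ih.
have tdisj j k i : i \in t j -> i \in t k -> j = k.
  move=> ij ik; have [jk|kj|//] := ltngtP j k.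
    by have [[_ /(_ i ik)]] := hP k; rewrite (tS j k i jk ij).
  by have [[_ /(_ i ij)]] := hP j; rewrite (tS k j i kj ik).
have b0 j i : i \notin t j -> b j i = 0 by have [_ + _ _ _] := hP j; apply.
(* As the supports are disjoint, at most one term of the series is nonzero at [i], and [xchoose]
   selects its index. *)
pose B (l : 'I_d.+1) (i : I) : R[i] :=
  if pselect (exists j, i \in t j) is left h then
    (if (xchoose h %% d.+1)%N == l then (2^-1)%:C%C ^+ xchoose h * b (xchoose h) i else 0)
  else 0.
have BE l j i : i \in t j ->
    B l i = if (j %% d.+1)%N == l then (2^-1)%:C%C ^+ j * b j i else 0.
  move=> ij; rewrite /B; case: pselect => [h|[]]; last by exists j.
  by rewrite (tdisj _ _ _ (xchooseP h) ij).
have normhalf j : nc ((2^-1 : R)%:C%C ^+ j) = 2^-1 ^+ j.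
  by rewrite -rmorphXn normcR ger0_norm// exprn_ge0.
have lpB l : lp p (B l).
  apply/(lpP p1); exists 2 => //; apply: (lp_bounded_fatou p1) => s.
  have [J hJ] : exists J, forall i j, i \in s -> i \in t j -> (j < J)%N.
    elim: s => [|i s [J hJ]]; first by exists 0%N.
    have [[j ij]|h] := pselect (exists j, i \in t j); last first.
      exists J => k j; rewrite inE => /orP[/eqP -> kj|]; last exact: hJ.
      by exfalso; apply: h; exists j.
    exists (maxn J j.+1) => k j'; rewrite inE => /orP[/eqP -> kj|ks kj].
      by rewrite (tdisj _ _ _ ij kj) leq_max leqnn orbT.
    by rewrite leq_max (hJ k j').
  exists (fun i => \sum_(j < J) (2^-1 : R)%:C%C ^+ j * b j i).
    have hsum : \sum_(j < J) 2^-1 ^+ j * 1 <= 2 :> R.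
      have -> : \sum_(j < J) 2^-1 ^+ j * 1 = 2 - 2 * 2^-1 ^+ J :> R.
        elim: (J) => [|k ih]; first by rewrite big_ord0 expr0 mulr1 subrr.
        by rewrite big_ord_recr /= ih exprS; field.
      by rewrite gerBl mulr_ge0// exprn_ge0.
    apply: (lp_bounded_le p1 _ hsum).
      by apply: sumr_ge0 => j _; rewrite mulr1 exprn_ge0.
    apply: (lp_bounded_sum p1) => k; first by rewrite mulr1 exprn_ge0.
    rewrite -normhalf; apply: (lp_bounded_scale p1) => //.
    by have [_ _ + _ _] := hP k.
  move=> i is_; rewrite {1}/B; case: pselect => [h|_]; last first.
    by rewrite Normc.normc0 normc_ge0.
  have ij := xchooseP h; set j := xchoose h in ij *.
  have jJ := hJ i j is_ ij.
  rewrite (bigD1 (Ordinal jJ)) //= big1 ?addr0; last first.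
    move=> k kj; rewrite b0 ?mulr0//; apply: contra kj => ik.
    by apply/eqP/val_inj; apply: tdisj ik ij.
  by case: ifP => // _; rewrite Normc.normc0 normc_ge0.
have /choice[cof cofP] : forall l : 'I_d.+1, exists c : 'rV[R[i]]_d,
    image_space p A (fun i => B l i - \sum_(k < d) c 0 k * f k i).
  by move=> l; have [c [hc _]] := fq _ (lpB l); exists c.
have /choice[x xP] : forall l : 'I_d.+1, exists x, lp p x /\
    mxact A x = (fun i => B l i - \sum_(k < d) cof l 0 k * f k i).
  by move=> l; have [x ? ?] := cofP l; exists x.
pose M : 'M[R[i]]_(d.+1, d) := \matrix_(l, k) cof l 0 k.
(* d + 1 rows in dimension [d] are linearly dependent. *)
have [v v0 vM] : exists2 v : 'rV[R[i]]_d.+1, v != 0 & v *m M = 0.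
  have : kermx M != 0.
    by rewrite -mxrank_eq0 mxrank_ker subn_eq0 -ltnNge ltnS rank_leq_col.
  move=> /rowV0Pn[v vk v0]; exists v => //.
  by apply/eqP; rewrite -sub_kermx.
have mx0 : mxact A (fun _ => 0) = (fun _ => 0).
  have := lin 1 (fun _ => 0) (fun _ => 0).
  rewrite (_ : (fun i => 1 * 0 + 0) = (fun _ : I => 0 : R[i])); last first.
    by apply/funext => i; rewrite mulr0 addr0.
  move=> e; apply/funext => i; have := congr1 (fun g => g i) e.
  by rewrite mul1r => /eqP; rewrite -subr_eq0 opprD addNKr oppr_eq0 => /eqP.
have mxsum (s : seq 'I_d.+1) : mxact A (fun i => \sum_(l <- s) v 0 l * x l i) =
    (fun i => \sum_(l <- s) v 0 l * mxact A (x l) i).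
  elim: s => [|l s ih].
    have -> : (fun i => \sum_(l <- [::]) v 0 l * x l i) = (fun _ => 0).
      by apply/funext => i; rewrite big_nil.
    by rewrite mx0; apply/funext => i; rewrite big_nil.
  have -> : (fun i => \sum_(l <- l :: s) v 0 l * x l i) =
      (fun i => v 0 l * x l i + \sum_(l <- s) v 0 l * x l i).
    by apply/funext => i; rewrite big_cons.
  by rewrite lin ih; apply/funext => i; rewrite big_cons.
pose X i := \sum_(l < d.+1) v 0 l * x l i.
have XE i : mxact A X i = \sum_(l < d.+1) v 0 l * B l i.
  rewrite /X mxsum; transitivity (\sum_(l < d.+1) (v 0 l * B l i -
      \sum_(k < d) v 0 l * cof l 0 k * f k i)).
    apply: eq_bigr => l _; rewrite (xP l).2 mulrBr mulr_sumr; congr (_ - _).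
    by apply: eq_bigr => k _; rewrite mulrA.
  rewrite sumrB exchange_big /= [X in _ - X]big1 ?subr0// => k _.
  rewrite -mulr_suml; have := congr1 (fun N : 'rV[R[i]]_d => N 0 k) vM.
  rewrite !mxE => e; rewrite (_ : \sum_(l < _) _ = 0) ?mul0r//.
  by rewrite -[RHS]e; apply: eq_bigr => l _; rewrite mxE.
have [N N0 hX] : exists2 N, 0 <= N & lp_bounded p N X.
  have /choice[m mP] : forall l, exists m, 0 <= m /\ lp_bounded p m (x l).
    by move=> l; have [m ? ?] := (lpP p1 _).1 (xP l).1; exists m.
  exists (\sum_(l < d.+1) nc (v 0 l) * m l).
    by apply: sumr_ge0 => l _; rewrite mulr_ge0 ?normc_ge0//; have [] := mP l.
  apply: (lp_bounded_sum p1) => l; have [m0 hm] := mP l.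
    by rewrite mulr_ge0 ?normc_ge0.
  exact: lp_bounded_scale.
have [l vl] : exists l, v 0 l != 0.
  by apply/existsP; rewrite -negb_forall; apply: contra v0 => /forallP h;
    apply/eqP/rowP => j; rewrite mxE; apply/eqP.
have nvl : 0 < nc (v 0 l) by rewrite normc_gt0.
(* [j] is taken in the class of [l] and so large that |v_l| 2^j exceeds the bound [N] of the
   preimage. *)
have [n hn] := @exp_unbounded R 2 (N + 1) _ ltac:(lra) nvl.
pose j := (n * d.+1 + l)%N.
have jl : (j %% d.+1)%N = l by rewrite /j modnMDl modn_small.
have nj : (n <= j)%N by rewrite /j mulnS -addnA leq_addr.
have [_ _ _ zb hz] := hP j.
have := hz X N N0 hX.
have -> : \sum_(i <- t j) zeta j i * mxact A X i = v 0 l * (2^-1 : R)%:C%C ^+ j.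
  rewrite -[RHS]mulr1 -zb mulr_sumr big_seq [RHS]big_seq; apply: eq_bigr => i it.
  rewrite XE (bigD1 l) //= big1 ?addr0 ?(BE _ _ _ it) ?jl ?eqxx; first by ring.
  move=> k kl; rewrite (BE _ _ _ it) jl ifF ?mulr0//; apply: contraNF kl => /eqP e.
  by apply/eqP/val_inj.
rewrite Normc.normcM normhalf => h.
have : (N + 1) * 2^-1 ^+ j <= 4^-1 ^+ j * (2 ^+ j * N).
  have e2 : 4^-1 ^+ j * 2 ^+ j = 2^-1 ^+ j :> R.
    by rewrite -exprMn; congr (_ ^+ _); field.
  have h1 : N + 1 <= nc (v 0 l) * 2 ^+ j.
    by apply: le_trans hn _; rewrite ler_wpM2l ?(ltW nvl)// ler_weXn2l// ler1n.
  have e3 : 2^-1 ^+ j * 2 ^+ j = 1 :> R by rewrite -exprMn mulVf// expr1n.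
  apply: (@le_trans _ _ (nc (v 0 l) * 2 ^+ j * 2^-1 ^+ j)).
    by rewrite ler_wpM2r// exprn_ge0.
  have := ler_wpM2r (exprn_ge0 j (ler0n R 2)) h.
  rewrite mulrAC -mulrA; lra.
rewrite mulrA -exprMn (_ : 4^-1 * 2 = 2^-1 :> R); last by field.
rewrite mulrC ler_pM2l ?exprn_gt0//; lra.
Qed.

(** * Approximate null vectors of pseudoergodic operators *)

(* If there is no uniform lower bound, exponentially decaying windows of bounded
   approximate null vectors give finitely supported ones whose residual is small
   relative to the vector itself, up to a summable error: hence in every l^q at once. *)
Lemma approx_null_window (R : realType) (U V W : set R[i]) (b : R) : 0 < b ->
  (forall x, U x \/ V x \/ W x -> nc x <= b) ->
  ~ (exists2 K, 0 < K & lower_bound U V W K) ->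
  forall d, 0 < d -> exists (n : nat) (err : R) c z, [/\ jacobi_in U V W c,
    forall i, ~~ (0 < i < n%:Z - 1) -> z i = 0,
    (forall i, nc (z i) <= 2) /\ (exists i, 1 <= nc (z i)),
    0 <= err /\ n%:R * err <= d &
    forall i, nc (jact c z i) <= d * (nc (z (i - 1)) + nc (z (i + 1))) + err].
Proof.
move=> b0 hb nLB d d0.
pose eps := Num.min 1 (d / (3 * b)).
have eps0 : 0 < eps by rewrite lt_min ltr01 divr_gt0// mulr_gt0.
have eps1 : eps <= 1 by rewrite ge_min lexx.
have epsd : 3 * eps * b <= d.
  have : eps <= d / (3 * b) by rewrite ge_min lexx orbT.
  by rewrite ler_pdivlMr ?mulr_gt0// => h; lra.
(* The weight decays at the rate s = tau^2, while the length n is at most a constant times tau^N by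
   Bernoulli's inequality; so n s^-N is still of order tau^-N. *)
pose tau := 1 + eps; pose s := tau ^+ 2.
have tau1 : 1 < tau by rewrite /tau; lra.
have s1 : 1 < s by rewrite /s exprn_egt1.
have s0 : 0 < s := lt_trans ltr01 s1.
have sb : b * (s - 1) <= d.
  have : eps * eps <= eps by rewrite ler_piMl// ltW.
  move=> /(ler_wpM2l (ltW b0)); rewrite /s /tau; lra.
have [N hN] := @exp_unbounded R tau (8 * b * (2 / eps + 5)) d tau1 d0.
pose n := (2 * N + 5)%N.
have nt : n%:R * (4 * b * (s ^+ N)^-1) <= d / 2.
  have tN : 1 <= tau ^+ N by rewrite exprn_ege1// ltW.
  have hn : n%:R <= (2 / eps + 5) * tau ^+ N.
    have := @bernoulli_exp R tau N (ltW tau1).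
    rewrite {1}/tau addrAC subrr add0r -ler_pdivlMr// => h.
    have -> : n%:R = 2 * N%:R + 5 :> R by rewrite /n natrD natrM.
    have -> : (2 / eps + 5) * tau ^+ N = 2 * (tau ^+ N / eps) + 5 * tau ^+ N by ring.
    lra.
  rewrite mulrA ler_pdivrMr ?(exprn_gt0 _ s0)//.
  have bp : 0 <= 4 * b by rewrite mulr_ge0// ltW.
  apply: le_trans (ler_wpM2r bp hn) _.
  have t0 : 0 <= tau ^+ N by rewrite exprn_ge0// ltW// (lt_trans _ tau1).
  have sN : s ^+ N = tau ^+ N * tau ^+ N by rewrite /s -exprM mulnC exprM expr2.
  have := ler_wpM2r t0 hN; rewrite sN; lra.
(* Failure of the lower bound with this constant gives a residual of at most d / (2 n) relative to
   the peak, which is half of the total error allowed over [n] rows. *)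
pose K := 2 * n%:R / d.
have K0 : 0 < K by rewrite divr_gt0// mulr_gt0// ltr0n /n addnS.
have : ~ lower_bound U V W K by move=> h; apply: nLB; exists K.
move=> /existsNP[c /not_implyP[hc /existsNP[z /existsNP[B /existsNP[m
  /not_implyP[zB /not_implyP[zm /existsNP[i1 /negP]]]]]]]].
rewrite -ltNge => hi1.
have m0 : 0 <= m := le_trans (normc_ge0 _) (zm 0).
(* The supremum need not be attained, so the peak is an index where half of it is reached; hence the
   factor 2. *)
have [i0 [hi0 z2]] : exists i0, K * m < nc (z i0) /\ forall i, nc (z i) <= 2 * nc (z i0).
  have hs : has_sup (range (fun i => nc (z i))).
    by split; [exists (nc (z 0)), 0|exists B => _ [j _ <-]].
  have ub i : nc (z i) <= sup (range (fun i => nc (z i))).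
    by apply: sup_upper_bound => //; exists i.
  set S := sup _ in ub.
  have S0 : 0 < S.
    by apply: lt_le_trans (ub i1); apply: le_lt_trans hi1; rewrite mulr_ge0// ltW.
  have [h|h] := leP (S / 2) (nc (z i1)).
    by exists i1; split=> // i; have := ub i; lra.
  have S20 : 0 < S / 2 by rewrite divr_gt0.
  have [_ [i2 _ <-] h2] := sup_adherent S20 hs.
  by exists i2; split=> [|i]; [|have := ub i]; rewrite -/S in h2; lra.
have zi0 : 0 < nc (z i0) by apply: le_lt_trans hi0; rewrite mulr_ge0// ltW.
have zi0' : z i0 != 0 by rewrite -normc_gt0.
(* The support |j - C| <= N is the range from 2 to 2 N + 2, strictly inside 0 < j < n - 1 = 2 N +
   4. *)
pose C := N.+2%:Z.
pose c' := shift_jac (i0 - C) c.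
pose y j := (z i0)^-1 * z (i0 - C + j).
have y2 j : nc (y j) <= 2.
  by rewrite /y Normc.normcM Normc.normcV mulrC ler_pdivrMr.
have yK j : nc (jact c' y j) <= K^-1.
  have -> : jact c' y j = (z i0)^-1 * jact c z (i0 - C + j).
    by rewrite -jact_shift /jact /y; ring.
  rewrite Normc.normcM Normc.normcV mulrC ler_pdivrMr// (le_trans (zm _))//.
  by rewrite -ler_pdivrMl ?invr_gt0// invrK ltW.
have hpow k : 0 < s ^+ k by rewrite exprn_gt0.
pose phi (j : int) : R := if (`|j - C| <= N)%N then (s ^+ `|j - C|)^-1 else 0.
have phi0 j : 0 <= phi j by rewrite /phi; case: ifP => // _; rewrite invr_ge0 ltW.
have phi1 j : phi j <= 1.
  rewrite /phi; case: ifP => // _; by rewrite invf_le1 ?hpow// exprn_ege1// ltW.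
(* The first term is the relative change of a geometric weight, the second one the jump where the
   weight is cut off. *)
have phistep j k : (`|j - C| <= `|k - C|.+1)%N -> (`|k - C| <= `|j - C|.+1)%N ->
    `|phi k - phi j| <= (s - 1) * phi k + (s ^+ N)^-1.
  have sN0 : 0 <= (s ^+ N)^-1 by rewrite invr_ge0 ltW.
  move=> h1 h2; rewrite /phi; case: ifP => hk; case: ifP => hj.
  - apply: (@le_trans _ _ ((s - 1) * (s ^+ `|k - C|)^-1)); last by rewrite lerDl.
    have [e|[e|e]] : (`|k - C| = `|j - C|)%N \/ (`|k - C| = `|j - C|.+1)%N \/
       (`|j - C| = `|k - C|.+1)%N by clear -h1 h2; lia.
    + by rewrite e subrr normr0 mulr_ge0 ?invr_ge0 ?ltW// subr_gt0.
    + rewrite e distrC exprS invfM.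
      set q := (s ^+ _)^-1; have q0 : 0 < q by rewrite invr_gt0.
      have -> : q - s^-1 * q = (s - 1) * (s^-1 * q).
        by field; rewrite gt_eqF.
      rewrite ger0_norm// mulr_ge0//; first by lra.
      by rewrite mulr_ge0 ?invr_ge0// ltW.
    + rewrite e exprS invfM.
      set q := (s ^+ _)^-1; have q0 : 0 < q by rewrite invr_gt0.
      have si : s^-1 * q <= q by rewrite ler_piMl ?(ltW q0)// invf_le1 ?(ltW s1).
      rewrite ger0_norm ?subr_ge0//.
      have -> : q - s^-1 * q = (s - 1) * (s^-1 * q).
        by field; rewrite gt_eqF.
      by rewrite ler_wpM2l//; lra.
  - have e : (`|k - C| = N)%N by clear -h1 h2 hj hk; lia.
    rewrite e subr0 ger0_norm// lerDr mulr_ge0//; lra.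
  - have e : (`|j - C| = N)%N by clear -h1 h2 hj hk; lia.
    by rewrite e sub0r normrN ger0_norm// mulr0 add0r.
  - by rewrite subrr normr0 mulr0 add0r.
pose x j := (phi j)%:C%C * y j.
have nx j : nc (x j) = phi j * nc (y j) by rewrite Normc.normcM normcR ger0_norm.
pose err := K^-1 + 4 * b * (s ^+ N)^-1.
exists n. exists err. exists c'. exists x. split.
- exact: jacobi_in_shift.
- move=> j hj; rewrite /x /phi ifF ?mul0r//; apply: contraNF hj.
  by rewrite /C /n; clear; lia.
- split=> [j|]; first by rewrite nx -[leRHS]mul1r ler_pM ?normc_ge0.
  exists C; rewrite nx /phi subrr absz0 leq0n expr0 invr1 mul1r /y subrK.
  by rewrite Normc.normcM Normc.normcV mulVf ?gt_eqF.
- split; first by rewrite addr_ge0 ?invr_ge0 ?mulr_ge0 ?(ltW b0) ?(ltW K0)// invr_ge0 ltW.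
  have nK : n%:R * K^-1 = d / 2.
    have n0 : n%:R != 0 :> R by rewrite pnatr_eq0 /n addnS.
    by rewrite /K; field; rewrite n0 gt_eqF.
  by rewrite mulrDr nK; lra.
move=> j.
have -> : jact c' x j = (phi j)%:C%C * jact c' y j +
   (lo c' j * ((phi (j - 1) - phi j)%:C%C * y (j - 1)) + di c' j * 0
     + up c' j * ((phi (j + 1) - phi j)%:C%C * y (j + 1))).
  by rewrite /jact /x !rmorphB /=; ring.
have hc' : jacobi_in U V W c' by exact: jacobi_in_shift.
have [hlo hdi hup] := hc' j.
have hlo' : nc (lo c' j) <= b by apply: hb; tauto.
have hdi' : nc (di c' j) <= b by apply: hb; tauto.
have hup' : nc (up c' j) <= b by apply: hb; tauto.
apply: le_trans (normcD _ _) _; rewrite /err [leRHS]addrC -[leRHS]addrA; apply: lerD.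
  by rewrite Normc.normcM normcR ger0_norm// -[leRHS]mul1r ler_pM ?normc_ge0//.
apply: le_trans (normc_lin3 _ _ _ hlo' hdi' hup') _.
have nm k : nc ((phi k - phi j)%:C%C * y k) = `|phi k - phi j| * nc (y k).
  by rewrite Normc.normcM normcR.
rewrite Normc.normc0 addr0 !nm.
have st k : (`|j - C| <= `|k - C|.+1)%N -> (`|k - C| <= `|j - C|.+1)%N ->
    b * (`|phi k - phi j| * nc (y k)) <= d * nc (x k) + 2 * b * (s ^+ N)^-1.
  move=> h1 h2; have h3 := ler_wpM2r (normc_ge0 (y k)) (phistep _ _ h1 h2).
  have h4 := ler_wpM2l (ltW b0) h3.
  have h5 := ler_wpM2r (normc_ge0 (x k)) sb; rewrite nx in h5 *.
  have sN0 : 0 <= b * (s ^+ N)^-1 by rewrite mulr_ge0 ?invr_ge0 ?ltW.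
  have h6 := ler_wpM2l sN0 (y2 k); lra.
have := st (j - 1) ltac:(clear; lia) ltac:(clear; lia).
have := st (j + 1) ltac:(clear; lia) ltac:(clear; lia).
lra.
Qed.

(** * Operators on both index sets as Jacobi operators along an embedding into the integers *)

Definition preim (I : choiceType) (e : I -> int) (k : int) : option I :=
  if pselect (exists i, e i == k) is left h then Some (xchoose h) else None.

Lemma preim_Some (I : choiceType) (e : I -> int) k i : preim e k = Some i -> e i = k.
Proof. by rewrite /preim; case: pselect => // h [<-]; apply/eqP; exact: (xchooseP h). Qed.

Lemma preimK (I : choiceType) (e : I -> int) i : injective e -> preim e (e i) = Some i.
Proof.
move=> einj; rewrite /preim; case: pselect => [h|[]]; last by exists i.
by congr Some; apply/einj/eqP; exact: (xchooseP h).
Qed.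

Definition extend0 (R : realType) (I : choiceType) (e : I -> int) (x : I -> R[i])
  (k : int) : R[i] := oapp x 0 (preim e k).

Definition jacobi_op (R : realType) (I : choiceType) (e : I -> int) (c : jacobi R)
  (i j : I) : R[i] := jacobi_mx c (e i) (e j).

Lemma mxact_jacobi (R : realType) (I : choiceType) (e : I -> int) (c : jacobi R)
    (x : I -> R[i]) i : injective e ->
  mxact (jacobi_op e c) x i = jact c (extend0 e x) (e i).
Proof.
move=> einj; rewrite -(@fsbig_jacobi_mx _ I e setT c (extend0 e x))//.
  by apply: eq_fsbigr => j _; rewrite /extend0 preimK.
move=> k hk; rewrite /extend0; case h : (preim e k) => [i'|//].
by exfalso; apply: hk; exists i' => //; apply: preim_Some.
Qed.

Lemma mxact_jacobi_linear (R : realType) (I : choiceType) (e : I -> int) (c : jacobi R)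
    (a : R[i]) x y : injective e ->
  mxact (jacobi_op e c) (fun i => a * x i + y i) =
  (fun i => a * mxact (jacobi_op e c) x i + mxact (jacobi_op e c) y i).
Proof.
move=> einj; apply/funext => i; rewrite !mxact_jacobi// /jact.
have E k : extend0 e (fun i => a * x i + y i) k = a * extend0 e x k + extend0 e y k.
  by rewrite /extend0; case: preim => //=; rewrite mulr0 addr0.
by rewrite !E; ring.
Qed.

(** [e] treats both index sets at once. Windows can be demanded at any distance [k0] from the
    origin, which makes the humps disjoint. *)
Definition pseudoergodic (R : realType) (I : choiceType) (e : I -> int)
    (U V W : set R[i]) (c : jacobi R) :=
  jacobi_in U V W c /\ forall (n k0 : nat) t (eta : R), jacobi_in U V W t -> 0 < eta ->
  exists k : int, [/\ forall j : nat, (j < n)%N -> exists i, e i = k + j%:Z,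
    k0%:Z < k \/ k + n%:Z < - k0%:Z &
    forall j : nat, (j < n)%N -> [/\ nc (lo c (k + j%:Z) - lo t j%:Z) <= eta,
      nc (di c (k + j%:Z) - di t j%:Z) <= eta &
      nc (up c (k + j%:Z) - up t j%:Z) <= eta]].

(** Summation by parts; no boundary terms occur since [z] vanishes at both ends of the window. *)
Lemma sum_jact_transpose (R : realType) (c : jacobi R) (z X : int -> R[i]) (n : nat) :
  (forall i, ~~ (0 < i < n%:Z - 1) -> z i = 0) ->
  \sum_(j < n) z j%:Z * jact c X j%:Z =
  \sum_(l < n) jact (transpose_jac c) z l%:Z * X l%:Z.
Proof.
move=> z0; pose Y i := if 0 <= i < n%:Z then X i else 0.
have Y0 i : ~~ (0 <= i < n%:Z) -> Y i = 0 by move=> /negbTE h; rewrite /Y h.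
have z0' i : ~~ (0 <= i < n%:Z) -> z i = 0.
  by move=> h; apply: z0; apply: contra h; clear; lia.
transitivity (\sum_(j < n) \sum_(l < n) z j%:Z * jacobi_mx c j%:Z l%:Z * X l%:Z).
  apply: eq_bigr => j _; have [h|h] := boolP (0 < j%:Z < n%:Z - 1); last first.
    by rewrite z0// mul0r big1// => l _; rewrite !mul0r.
  have -> : jact c X j%:Z = jact c Y j%:Z.
    by rewrite /jact /Y !ifT//; clear -h; lia.
  rewrite -(sum_jacobi_mx c j%:Z Y0) mulr_sumr; apply: eq_bigr => l _.
  by rewrite -mulrA /Y ifT//; have := ltn_ord l; clear; lia.
rewrite exchange_big; apply: eq_bigr => l _ /=.
rewrite -(sum_jacobi_mx _ _ z0') mulr_suml; apply: eq_bigr => j _.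
by rewrite jacobi_mx_transpose; ring.
Qed.

Lemma jact_perturb (R : realType) (c t : jacobi R) (z : int -> R[i]) i (eta B : R) :
  0 <= eta -> (forall j, nc (z j) <= B) ->
  (z (i - 1) != 0 -> nc (lo c i - lo t i) <= eta) ->
  (z i != 0 -> nc (di c i - di t i) <= eta) ->
  (z (i + 1) != 0 -> nc (up c i - up t i) <= eta) ->
  nc (jact c z i) <= nc (jact t z i) + 3 * eta * B.
Proof.
move=> eta0 zB h1 h2 h3.
have key a j : (z j != 0 -> nc a <= eta) -> nc (a * z j) <= eta * B.
  move=> h; have B0 : 0 <= B := le_trans (normc_ge0 _) (zB j).
  have [->|zj] := eqVneq (z j) 0; first by rewrite mulr0 Normc.normc0 mulr_ge0.
  by rewrite Normc.normcM ler_pM ?normc_ge0 ?h.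
have -> : jact c z i = jact t z i + ((lo c i - lo t i) * z (i - 1)
   + (di c i - di t i) * z i + (up c i - up t i) * z (i + 1)).
  by rewrite /jact; ring.
apply: le_trans (normcD _ _) _; rewrite lerD2l.
have := key _ _ h1; have := key _ _ h2; have := key _ _ h3.
set p := _ * z (i - 1); set q := _ * z i; set r := _ * z (i + 1).
have := normcD (p + q) r; have := normcD p q; lra.
Qed.

(** The size of the window vector [z] is measured by [Z], its norm as a functional on l^p. The
    residual is small relative to shifts of |z|, whose pairings are again controlled by [Z], plus an
    error that is summable over the window; so no dual exponent appears. *)
Lemma pseudoergodic_hump (R : realType) (I : choiceType) (e : I -> int)
    (U V W : set R[i]) (c : jacobi R) (b : R) (p : \bar R) : (1 <= p)%E ->
  injective e -> pseudoergodic e U V W c -> 0 < b ->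
  (forall x, U x \/ V x \/ W x -> nc x <= b) ->
  ~ (exists2 K, 0 < K & lower_bound U V W K) ->
  forall eps s, 0 < eps ->
  exists t zeta b, hump p (jacobi_op e c) eps s t zeta b.
Proof.
move=> p1 einj [hc erg] b0 hb nLB eps s eps0.
have nLB' : ~ (exists2 K, 0 < K & lower_bound W V U K).
  by move=> [K K0 h]; apply: nLB; exists K => //; exact: lower_bound_reflect.
have hb' x : W x \/ V x \/ U x -> nc x <= b by move=> h; apply: hb; tauto.
(* With d = eps / 8 the two shifted sums cost 2 d Z M, the errors [err] and [eta] cost 2 d M <= 2 d
   Z M, and division by |w| >= Z / 2 yields 8 d M. *)
have d0 : 0 < eps / 8 by rewrite divr_gt0.
have [n [err [t [z [ht z0 [z2 [i0 zi0]] [err0 nerr] hz]]]]] :=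
  approx_null_window b0 hb' nLB' d0.
set d := eps / 8 in d0 nerr hz.
pose eta := d / (6 * n.+1%:R).
have eta0 : 0 < eta by rewrite divr_gt0// mulr_gt0.
have neta : n%:R * (3 * eta * 2) <= d.
  have -> : d = eta * (6 * n.+1%:R) by rewrite /eta divfK// gt_eqF// mulr_gt0.
  have : n%:R * eta <= n.+1%:R * eta by rewrite ler_wpM2r ?(ltW eta0)// ler_nat.
  lra.
have [k0 hk0] : exists k0 : nat, forall i, i \in s -> (`|e i| < k0)%N.
  elim: s => [|i s [k hk]]; first by exists 0%N.
  exists (maxn k `|e i|.+1) => j; rewrite inE => /orP[/eqP ->|/hk h].
    by rewrite leq_max leqnn orbT.
  by rewrite leq_max h.
have [k [kdom kfar kapp]] := erg n k0 _ _ (jacobi_in_transpose ht) eta0.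
have /choice[g gE] : forall j : 'I_n, exists i, e i = k + j%:Z by move=> j; exact: kdom.
have ginj : injective g by move=> j j' /(congr1 e); rewrite !gE => /addrI [] /val_inj.
pose T := [seq g j | j <- enum 'I_n].
have sumT (F : I -> R[i]) : \sum_(i <- T) F i = \sum_(j < n) F (g j).
  by rewrite big_map big_enum.
pose zeta0 i := z (e i - k).
have zetag j : zeta0 (g j) = z j%:Z by rewrite /zeta0 gE addrAC subrr add0r.
pose pair (y : I -> R[i]) := \sum_(i <- T) zeta0 i * y i.
have pairB y : lp_bounded p 1 y -> nc (pair y) <= n%:R * 2.
  move=> hy; rewrite /pair sumT; apply: le_trans (normc_sum _ _ _) _.
  rewrite (_ : n%:R * 2 = \sum_(j < n) 2); last by rewrite sumr_const card_ord mulr_natl.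
  apply: ler_sum => j _; rewrite Normc.normcM zetag -[leRHS]mulr1 ler_pM ?normc_ge0//.
  exact: (lp_bounded_coord p1 _ ler01 hy).
pose E := [set nc (pair y) | y in [set y | lp_bounded p 1 y]].
have ub y : lp_bounded p 1 y -> nc (pair y) <= sup E.
  move=> hy; apply: sup_upper_bound; last by exists y.
  split; first by exists (nc (pair y)), y.
  by exists (n%:R * 2) => _ [y' hy' <-]; exact: pairB.
set Z := sup E in ub.
have hi0 : 0 < i0 < n%:Z - 1.
  by apply: contraT => /z0 h; move: zi0; rewrite h Normc.normc0 ler10.
have hi0' : (`|i0| < n)%N by clear -hi0; lia.
have Z1 : 1 <= Z.
  apply: le_trans (ub _ (lp_bounded_delta p1 (g (Ordinal hi0')))).
  rewrite /pair sumT (bigD1 (Ordinal hi0'))//= big1 ?addr0.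
    by rewrite eqxx mulr1 zetag /= gez0_abs//; clear -hi0; lia.
  by move=> j hj; rewrite ifF ?mulr0//; apply: contraNF hj => /eqP /ginj ->.
(* A vector of the unit ball that norms the functional up to a factor 2. *)
have [b1 [hb1 hb1Z]] : exists b1, lp_bounded p 1 b1 /\ Z / 2 <= nc (pair b1).
  have hs : has_sup E.
    split; first by exists (nc (pair (fun=> 0))), (fun=> 0) => //; exact: lp_bounded0.
    by exists (n%:R * 2) => _ [y' hy' <-]; exact: pairB.
  have [|_ [b1 hb1 <-] h] := @sup_adherent _ E (Z / 2) _ hs; first by rewrite divr_gt0//; lra.
  by exists b1; split=> //; rewrite -/Z in h; lra.
set w := pair b1 in hb1Z.
have w0 : 0 < nc w by apply: lt_le_trans hb1Z; rewrite divr_gt0//; lra.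
have w0' : w != 0 by rewrite -normc_gt0.
exists T, (fun i => w^-1 * zeta0 i), (fun i => if i \in T then b1 i else 0); split.
- split; first by rewrite map_inj_uniq ?enum_uniq.
  move=> i /mapP[j _ ->]; apply/negP => /hk0; rewrite gE.
  by have := ltn_ord j; clear -kfar; lia.
- by move=> i /negbTE ->.
- apply: (lp_bounded_mono p1 _ hb1) => i; case: ifP => // _.
  by rewrite Normc.normc0 normc_ge0.
- transitivity (w^-1 * pair b1); last by rewrite mulVf.
  rewrite /pair mulr_sumr big_seq [RHS]big_seq; apply: eq_bigr => i ->.
  by rewrite mulrA.
move=> x M M0 hx.
pose X i := extend0 e x (k + i).
have XM i : nc (X i) <= M.
  rewrite /X /extend0; case: preim => [j|]; first exact: (lp_bounded_coord p1 _ M0 hx).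
  by rewrite [oapp _ _ _]/= Normc.normc0.
pose c' := shift_jac k c.
have -> : \sum_(i <- T) w^-1 * zeta0 i * mxact (jacobi_op e c) x i =
    w^-1 * \sum_(l < n) jact (transpose_jac c') z l%:Z * X l%:Z.
  rewrite -sum_jact_transpose// sumT mulr_sumr; apply: eq_bigr => j _.
  by rewrite mxact_jacobi// gE zetag -mulrA -jact_shift.
have small l : (l < n)%N -> nc (jact (transpose_jac c') z l%:Z) <=
    d * (nc (z (l%:Z - 1)) + nc (z (l%:Z + 1))) + (err + 3 * eta * 2).
  move=> ln; rewrite addrA; apply: le_trans (lerD (hz l%:Z) (lexx _)).
  apply: jact_perturb => //; first exact: ltW.
  - have [l0|l0] := posnP l; first by rewrite l0 z0 ?eqxx.
    move=> _; have [_ _] := kapp l.-1 (leq_ltn_trans (leq_pred _) ln).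
    rewrite /= (_ : l.-1%:Z = l%:Z - 1); last by clear -l0; lia.
    by rewrite subrK.
  - by move=> _; have [] := kapp l ln.
  - have [ln1|ln1] := ltnP l.+1 n; last first.
      by rewrite z0 ?eqxx//; clear -ln1; lia.
    move=> _; have [+ _ _] := kapp l.+1 ln1.
    rewrite /= (_ : l.+1%:Z = l%:Z + 1); last by clear; lia.
    by rewrite addrK.
(* The sum of moduli equals the pairing of [z] with a vector of norm at most [M]: the shifted moduli
   of [x] times unimodular factors that cancel the phases of [z]. *)
have shiftsum (r : int) : \sum_(j < n) nc (z j%:Z) * nc (X (j%:Z + r)) <= Z * M.
  pose ph (u : R[i]) := u^-1 * (nc u)%:C%C.
  have phE u : u * ph u = (nc u)%:C%C.
    have [->|u0] := eqVneq u 0; first by rewrite mul0r Normc.normc0.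
    by rewrite /ph mulrA mulfV// mul1r.
  have ph1 u : nc (ph u) <= 1.
    rewrite /ph Normc.normcM Normc.normcV normcR ger0_norm ?normc_ge0//.
    have [->|u0] := eqVneq u 0; first by rewrite Normc.normc0 mulr0.
    by rewrite mulVf// normc_eq0.
  pose y i := ph (zeta0 i) * (nc (extend0 e x (e i + r)))%:C%C.
  have hy : lp_bounded p M y.
    apply: (@lp_bounded_mono _ _ p1 _ _ _ (fun i => oapp x 0 (preim e (e i + r)))).
      move=> i; rewrite /y Normc.normcM normcR ger0_norm ?normc_ge0// -[leRHS]mul1r.
      by rewrite ler_pM ?normc_ge0.
    apply: (lp_bounded_reindex p1) => // j j' i /preim_Some h1 /preim_Some h2.
    by apply: einj; apply: (addIr r); rewrite -h1 -h2.
  have -> : \sum_(j < n) nc (z j%:Z) * nc (X (j%:Z + r)) = nc (pair y).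
    rewrite /pair sumT.
    have -> : \sum_(j < n) zeta0 (g j) * y (g j) =
        (\sum_(j < n) nc (z j%:Z) * nc (X (j%:Z + r)))%:C%C.
      rewrite rmorph_sum; apply: eq_bigr => j _.
      by rewrite /y mulrA phE zetag gE /X addrA rmorphM.
    by rewrite normcR ger0_norm// sumr_ge0// => j _; rewrite mulr_ge0 ?normc_ge0.
  have [M00|Mn0] := eqVneq M 0.
    rewrite /pair big1 ?Normc.normc0 ?M00 ?mulr0// => i _.
    have := lp_bounded_coord p1 i M0 hy; rewrite M00 => h.
    by have /eqP : nc (y i) = 0; [apply/eqP; rewrite eq_le h normc_ge0|
      rewrite normc_eq0 => /eqP ->; rewrite mulr0].
  have Mp : 0 < M by rewrite lt0r Mn0.
  have hyM : lp_bounded p 1 (fun i => (M^-1)%:C%C * y i).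
    have := lp_bounded_scale p1 (M^-1)%:C%C M0 hy.
    by rewrite normcR ger0_norm ?invr_ge0// mulVf.
  have := ub _ hyM.
  have -> : pair (fun i => (M^-1)%:C%C * y i) = (M^-1)%:C%C * pair y.
    by rewrite /pair mulr_sumr; apply: eq_bigr => i _; ring.
  by rewrite Normc.normcM normcR ger0_norm ?invr_ge0// mulrC ler_pdivrMr.
have z0' i : ~~ (0 <= i < n%:Z) -> z i = 0.
  by move=> h; apply: z0; apply: contra h; clear; lia.
have s1 : \sum_(l < n) nc (z (l%:Z - 1)) * nc (X l%:Z) <= Z * M.
  apply: le_trans (shiftsum 1).
  case: (n) z0 => [|m] z00; first by rewrite !big_ord0.
  rewrite big_ord_recl [leRHS]big_ord_recr /= z00// Normc.normc0 mul0r add0r.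
  apply: (@le_trans _ _ (\sum_(l < m) nc (z l%:Z) * nc (X (l%:Z + 1)))); last first.
    by rewrite lerDl mulr_ge0 ?normc_ge0.
  apply: ler_sum => j _; rewrite /bump /= add1n.
  rewrite (_ : j.+1%:Z - 1 = j%:Z); last by clear; lia.
  by rewrite (_ : j.+1%:Z = j%:Z + 1)//; clear; lia.
have s2 : \sum_(l < n) nc (z (l%:Z + 1)) * nc (X l%:Z) <= Z * M.
  apply: le_trans (shiftsum (-1)).
  case: (n) z0 => [|m] z00; first by rewrite !big_ord0.
  rewrite big_ord_recr [leRHS]big_ord_recl /= (z00 (m%:Z + 1)); last by clear; lia.
  rewrite Normc.normc0 mul0r addr0.
  apply: (@le_trans _ _ (\sum_(l < m) nc (z l.+1%:Z) * nc (X (l.+1%:Z - 1)))); last first.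
    by rewrite lerDr mulr_ge0 ?normc_ge0.
  apply: ler_sum => j _.
  rewrite (_ : j.+1%:Z - 1 = j%:Z); last by clear; lia.
  by rewrite (_ : j.+1%:Z = j%:Z + 1)//; clear; lia.
rewrite Normc.normcM Normc.normcV ler_pdivrMl//.
apply: le_trans (normc_sum _ _ _) _.
apply: (@le_trans _ _ (\sum_(l < n) (d * (nc (z (l%:Z - 1)) * nc (X l%:Z)) +
    d * (nc (z (l%:Z + 1)) * nc (X l%:Z)) + (err + 3 * eta * 2) * M))).
  apply: ler_sum => l _; rewrite Normc.normcM.
  have h1 := ler_wpM2r (normc_ge0 (X l%:Z)) (small l (ltn_ord l)).
  apply: le_trans h1 _.
  have h2 : (err + 3 * eta * 2) * nc (X l%:Z) <= (err + 3 * eta * 2) * M.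
    by rewrite ler_wpM2l// addr_ge0// !mulr_ge0// ltW.
  lra.
rewrite !big_split /= -!mulr_sumr sumr_const card_ord -[_ *+ n]mulr_natl.
have h1 := ler_wpM2l (ltW d0) s1; have h2 := ler_wpM2l (ltW d0) s2.
have h3 : n%:R * ((err + 3 * eta * 2) * M) <= 2 * d * M.
  by rewrite mulrA ler_wpM2r// mulrDr; lra.
have h4 : d * M <= d * (Z * M).
  by rewrite ler_wpM2l ?(ltW d0)// ler_peMl.
have h5 : (Z / 2) * (eps * M) <= nc w * (eps * M).
  by rewrite ler_wpM2r// mulr_ge0// ltW.
have -> : eps = 8 * d by rewrite /d; field.
have h6 : eps = 8 * d by rewrite /d; field.
rewrite h6 in h5; lra.
Qed.

(** * Pseudoergodic operators *)

Lemma mx_norm_ltP (R : realType) (n : nat) (A B : 'M[R[i]]_n) (e : R) : 0 < e ->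
  `|A - B| < e%:C%C <-> forall i j, nc (A i j - B i j) < e.
Proof.
move=> e0; have eC : 0 < e%:C%C by rewrite ltcR.
have E : ball_ (fun M : 'M[R[i]]_n => `|M|) A e%:C%C B <->
    forall i j, ball_ (fun x : R[i] => `|x|) (A i j) e%:C%C (B i j).
  rewrite -(@mx_norm_ball R[i] n n); split=> [[_ h] i j|h].
    by have := h i j; rewrite -ball_normE.
  by split=> // i j; have := h i j; rewrite -ball_normE.
split=> [/E h i j|h]; first by have := h i j; rewrite /ball_ /= -normc_normr ltcR.
by apply/E => i j; rewrite /ball_ /= -normc_normr ltcR.
Qed.

Lemma jacobi_mx_shift (R : realType) (c : jacobi R) (k i j : int) :
  jacobi_mx c (k + i) (k + j) = jacobi_mx (shift_jac k c) i j.
Proof. by rewrite /jacobi_mx /= -!addrA !(inj_eq (addrI k)). Qed.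

Definition jacobi_close (R : realType) (c t : jacobi R) (i : int) (e : R) :=
  [/\ nc (lo c i - lo t i) <= e, nc (di c i - di t i) <= e & nc (up c i - up t i) <= e].

Lemma jacobi_mx_close (R : realType) (c t : jacobi R) (i j : int) (e : R) : 0 <= e ->
  jacobi_close c t i e -> nc (jacobi_mx c i j - jacobi_mx t i j) <= e.
Proof.
move=> e0 [h1 h2 h3]; rewrite /jacobi_mx; case: ifP => // _; case: ifP => // _.
by case: ifP => // _; rewrite subrr Normc.normc0.
Qed.

Lemma jacobi_close_mx (R : realType) (c t : jacobi R) (i : int) (e : R) :
  nc (jacobi_mx c i (i - 1) - jacobi_mx t i (i - 1)) <= e ->
  nc (jacobi_mx c i i - jacobi_mx t i i) <= e ->
  nc (jacobi_mx c i (i + 1) - jacobi_mx t i (i + 1)) <= e -> jacobi_close c t i e.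
Proof.
rewrite /jacobi_mx subrK !eqxx.
rewrite (_ : (i == i + 1) = false); last by clear; lia.
rewrite (_ : (i == i + 1 + 1) = false); last by clear; lia.
by split.
Qed.

(* Windows at a prescribed distance from the origin are found by looking for many
   copies of the pattern in a row: the first or the last of them is far away. *)
Lemma pseudoergodic_of_sections (R : realType) (I : choiceType) (e : I -> int)
    (U V W : set R[i]) (c : jacobi R) : jacobi_in U V W c ->
  (forall n : nat, (0 < n)%N -> forall B : 'M[R[i]]_n, M_n U V W B -> forall eta, 0 < eta ->
    exists k : int, (forall j : nat, (j < n)%N -> exists i, e i = k + j%:Z) /\
      forall i j : 'I_n, nc (B i j - jacobi_mx c (k + i%:Z) (k + j%:Z)) < eta) ->
  pseudoergodic e U V W c.
Proof.
move=> hc H; split=> // n k0 t eta ht eta0.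
(* The first and last rows of a section lack one coefficient, so each copy of the pattern is padded
   by one row on either side. *)
pose L := n.+2; pose q := (2 * k0 + n + 2)%N.
have L0 : (0 < L)%N by [].
pose t' := Jacobi (fun i => lo t ((`|i| %% L)%N%:Z - 1)) (fun i => di t ((`|i| %% L)%N%:Z - 1))
   (fun i => up t ((`|i| %% L)%N%:Z - 1)).
have ht' : jacobi_in U V W t' by move=> i; have [] := ht ((`|i| %% L)%N%:Z - 1).
pose m := (q * L)%N.
have m0 : (0 < m)%N by rewrite muln_gt0 andbT /q addn2.
pose B : 'M[R[i]]_m := \matrix_(i, j) jacobi_mx t' i%:Z j%:Z.
have hB : M_n U V W B by move=> i j; rewrite /B mxE; exact: jacobi_in_entry.
have [k [kdom kapp]] := H m m0 B hB eta eta0.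
have copy s : (s < q)%N -> forall j : nat, (j < n)%N ->
    (forall i, k + (s * L).+1%:Z + j%:Z = i ->
      [/\ nc (lo c i - lo t j%:Z) <= eta, nc (di c i - di t j%:Z) <= eta &
        nc (up c i - up t j%:Z) <= eta]) /\ ((s * L).+1 + j < m)%N.
  move=> sq j jn; set r := ((s * L).+1 + j)%N.
  have rL : (r.+1 < m)%N.
    have : (s.+1 * L <= q * L)%N by rewrite leq_mul2r sq orbT.
    by rewrite mulSn -/m /r /L; clear -jn; lia.
  have rE : (r %% L)%N = j.+1.
    by rewrite /r addSn -addnS modnMDl modn_small// /L; clear -jn; lia.
  have r1m : (r.-1 < m)%N by apply: leq_ltn_trans (leq_pred _) (ltnW rL).
  split; last exact: ltnW.
  move=> _ <-; rewrite (_ : k + (s * L).+1%:Z + j%:Z = k + r%:Z); last first.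
    by rewrite /r; clear; lia.
  have jE : (r %% L)%N%:Z - 1 = j%:Z by rewrite rE; clear; lia.
  pose ro := Ordinal (ltnW rL).
  have g : jacobi_close t' (shift_jac k c) r%:Z eta.
    apply: jacobi_close_mx.
    - have := kapp ro (Ordinal r1m); rewrite mxE jacobi_mx_shift => h.
      by rewrite (_ : r%:Z - 1 = r.-1%:Z); [exact: ltW h|clear; lia].
    - by have := kapp ro ro; rewrite mxE jacobi_mx_shift => h; exact: ltW h.
    - have := kapp ro (Ordinal rL); rewrite mxE jacobi_mx_shift => h.
      by rewrite (_ : r%:Z + 1 = r.+1%:Z); [exact: ltW h|clear; lia].
  move: g; rewrite /jacobi_close -jE => -[g1 g2 g3].
  by split; rewrite -normcN opprB.
have [far|near] := pselect (k0%:Z < k + 1 \/ k + 1 + n%:Z < - k0%:Z).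
  exists (k + 1); split=> // j jn.
    have [_ jm] := copy 0%N ltac:(by rewrite /q addn2) j jn.
    by have [i iE] := kdom _ jm; exists i; rewrite iE; clear; lia.
  by have [+ _] := copy 0%N ltac:(by rewrite /q addn2) j jn; apply; clear; lia.
(* If the first copy is near, k + 1 >= - k0 - n; the last one starts at least q - 1 = 2 k0 + n + 1
   further, hence beyond [k0]. *)
have qq : (q.-1 < q)%N by rewrite /q addn2.
exists (k + (q.-1 * L).+1%:Z); split=> [j jn||j jn].
- have [_ jm] := copy _ qq j jn.
  by have [i iE] := kdom _ jm; exists i; rewrite iE; clear; lia.
- left; have : (q.-1 * 1 <= q.-1 * L)%N by rewrite leq_mul2l orbT.
  by rewrite /q addn2 /=; clear -near; lia.
- by have [+ _] := copy _ qq j jn; apply.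
Qed.

Lemma PsiE_bi_pseudoergodic (R : realType) (U V W : set R[i]) A : PsiE_bi U V W A ->
  exists2 c, A = jacobi_op id c & pseudoergodic id U V W c.
Proof.
move=> [hA erg].
pose c := Jacobi (fun i => A i (i - 1)) (fun i => A i i) (fun i => A i (i + 1)).
have AE i j : A i j = jacobi_mx c i j.
  have := hA i j; rewrite /jacobi_entry /jacobi_mx /=.
  case: eqP => [->|_ /=]; first by rewrite addrK.
  case: eqP => [->//|_ /=]; case: eqP => [->//|_ ->//].
have hc : jacobi_in U V W c.
  move=> i; split.
  - by have := hA i (i - 1); rewrite /jacobi_entry subrK eqxx.
  - by have := hA i i; rewrite /jacobi_entry eqxx ifF//; clear; lia.
  - by have := hA i (i + 1); rewrite /jacobi_entry eqxx ifF ?ifF//; clear; lia.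
exists c; first by apply/funext => i; apply/funext => j.
apply: pseudoergodic_of_sections => // n n0 B hB eta eta0.
have [k] := erg n n0 B hB eta eta0; rewrite mx_norm_ltP// => hk.
exists (k + 1); split=> [j _|i j]; first by exists (k + 1 + j%:Z).
have := hk i j; rewrite mxE AE.
have kS (l : nat) : k + l.+1%:Z = k + 1 + l%:Z by clear; lia.
by rewrite (kS i) (kS j).
Qed.

Lemma PsiE_semi_pseudoergodic (R : realType) (U V W : set R[i]) A :
  U !=set0 -> V !=set0 -> W !=set0 -> PsiE_semi U V W A ->
  exists2 c, A = jacobi_op Posz c & pseudoergodic Posz U V W c.
Proof.
move=> [u Uu] [v Vv] [w Ww] [hA erg].
pose c := Jacobi (fun i => if 1 <= i then A `|i|%N `|i|.-1%N else u)
  (fun i => if 0 <= i then A `|i|%N `|i|%N else v)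
  (fun i => if 0 <= i then A `|i|%N `|i|.+1%N else w).
have AE (i j : nat) : A i j = jacobi_mx c i%:Z j%:Z.
  have := hA i j; rewrite /jacobi_entry /jacobi_mx /=.
  case: eqP => [e|_].
    by have -> : i = j.+1 by clear -e; lia.
  case: eqP => [[->]//|_]; case: eqP => [e|_ ->//].
  by have -> : j = i.+1 by clear -e; lia.
have hc : jacobi_in U V W c.
  move=> i; rewrite /c /=; split; case: ifP => // hi.
  - have := hA `|i|%N `|i|.-1%N; rewrite /jacobi_entry ifT//; clear -hi; lia.
  - by have := hA `|i|%N `|i|%N; rewrite /jacobi_entry eqxx ifF//; clear -hi; lia.
  - have := hA `|i|%N `|i|.+1%N; rewrite /jacobi_entry ifF; last by clear; lia.
    rewrite ifF; last by clear; lia.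
    by rewrite ifT//; clear; lia.
exists c; first by apply/funext => i; apply/funext => j.
apply: pseudoergodic_of_sections => // n n0 B hB eta eta0.
have [k] := erg n n0 B hB eta eta0; rewrite mx_norm_ltP// => hk.
exists k%:Z; split=> [j _|i j]; first by exists (k + j)%N.
by have := hk i j; rewrite mxE AE.
Qed.

(** * Existence of pseudoergodic operators *)

(** The sequence concatenates all finite words. The separator [x0] makes each prefix [P k] at least
    [k] long, even when words are empty, so that entry [i] can be read in [P i.+1]. *)
Lemma universal_sequence (T : countType) (x0 : T) : exists s : nat -> T,
  forall w : seq T, exists k : nat, forall i, (i < size w)%N -> s (k + i)%N = nth x0 w i.
Proof.
pose word k : seq T := odflt [::] (unpickle k).
pose P := fix P k := if k is k'.+1 then P k' ++ x0 :: word k' else [::].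
have sizeP k : (k <= size (P k))%N.
  by elim: k => // k ih; rewrite /= size_cat /=; lia.
have nthP k m i : (k <= m)%N -> (i < size (P k))%N -> nth x0 (P m) i = nth x0 (P k) i.
  move=> km ik; have [h1 h2] : (i < size (P m))%N /\ nth x0 (P m) i = nth x0 (P k) i.
    elim: m km => [|m ih]; first by rewrite leqn0 => /eqP <-.
    rewrite leq_eqVlt => /orP[/eqP <- //|]; rewrite ltnS => /ih[h1 h2].
    by rewrite /= size_cat nth_cat h1 ltn_addr.
  by [].
exists (fun i => nth x0 (P i.+1) i) => w.
exists (size (P (pickle w))).+1 => i iw.
have wE : P (pickle w).+1 = P (pickle w) ++ x0 :: w by rewrite /= /word pickleK.
rewrite (nthP (pickle w).+1); last 2 first.
- by rewrite ltnS (leq_trans (sizeP _))// addSn -addnS leq_addr.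
- by rewrite wE size_cat /= addSn -addnS ltn_add2l.
by rewrite wE nth_cat ifF ?addSn -?addnS ?addKn//; clear; lia.
Qed.

(** One point of [X] is chosen in every ball with rational centre and radius 1/(m+1) that meets
    [X]. *)
Lemma countable_dense_subset (R : realType) (X : set R[i]) : X !=set0 ->
  exists f : rat * rat * nat -> R[i], (forall q, X (f q)) /\
    forall x, X x -> forall e, 0 < e -> exists q, nc (f q - x) <= e.
Proof.
move=> [x0 Xx0].
pose near (q : rat * rat * nat) (y : R[i]) :=
  X y /\ nc (y - (ratr q.1.1 +i* ratr q.1.2)%C) <= q.2.+1%:R^-1.
have /choice[f fP] : forall q, exists y, X y /\ ((exists y', near q y') -> near q y).
  move=> q; have [[y hy]|h] := pselect (exists y, near q y).
    by exists y; split=> //; case: hy.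
  by exists x0; split.
exists f; split=> [q|x Xx e e0]; first by have [] := fP q.
have [m hm] : exists m : nat, 2 / e < m%:R.
  by exists (Num.bound (2 / e)); rewrite archi_boundP// divr_ge0// ltW.
have m0 : 0 < m.+1%:R :> R by [].
have hme : m.+1%:R^-1 <= e / 2.
  rewrite -[leRHS]invrK lef_pV2 ?posrE ?invr_gt0 ?divr_gt0// invf_div.
  by apply: le_trans (ltW hm) _; rewrite ler_nat.
have hd : 0 < (2 * m.+1%:R)^-1 :> R by rewrite invr_gt0 mulr_gt0.
have approx (y : R) : exists a : rat, `|y - ratr a| <= (2 * m.+1%:R)^-1.
  move: hd; set dl := (2 * m.+1%:R)^-1 => hd.
  have [|a] := @rat_in_itvoo R (y - dl) (y + dl); first by lra.
  rewrite in_itv /= => /andP[h1 h2]; exists a.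
  by rewrite ler_distlC (ltW h1) (ltW h2).
have [a ha] := approx (complex.Re x); have [b hb] := approx (complex.Im x).
have nx : nc (x - (ratr a +i* ratr b)%C) <= m.+1%:R^-1.
  apply: le_trans (normc_le_ReIm _) _.
  have -> : m.+1%:R^-1 = (2 * m.+1%:R)^-1 + (2 * m.+1%:R)^-1 :> R.
    by field; rewrite gt_eqF// addrC natr1.
  by move: ha hb; case: (x) => p q /= ha hb; apply: lerD.
exists (a, b, m); have [_ /(_ _)[|_ h]] := fP (a, b, m); first by exists x.
have {}h : nc (f (a, b, m) - (ratr a +i* ratr b)%C) <= m.+1%:R^-1 by exact: h.
rewrite (_ : f _ - x = (f (a, b, m) - (ratr a +i* ratr b)%C) - (x - (ratr a +i* ratr b)%C)).
  apply: le_trans (normcB _ _) _.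
  by rewrite (splitr e) lerD// ?(le_trans h)// (le_trans nx).
by ring.
Qed.

Lemma jacobi_approximating (R : realType) (U V W : set R[i]) :
  U !=set0 -> V !=set0 -> W !=set0 ->
  exists2 c, jacobi_in U V W c & forall (n : nat) t e, jacobi_in U V W t -> 0 < e ->
    exists k : nat, forall i : nat, (i < n)%N -> jacobi_close t (shift_jac k%:Z c) i%:Z e.
Proof.
move=> /countable_dense_subset[fU [hU dU]] /countable_dense_subset[fV [hV dV]]
  /countable_dense_subset[fW [hW dW]].
pose Q := (rat * rat * nat)%type; pose T : countType := (Q * Q * Q)%type.
pose q0 : Q := (0, 0, 0%N).
have [s hs] := universal_sequence ((q0, q0, q0) : T).
exists (Jacobi (fun i => fU (s `|i|%N).1.1) (fun i => fV (s `|i|%N).1.2)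
   (fun i => fW (s `|i|%N).2)) => [i|n t e ht e0]; first by split => /=.
have /choice[g gP] : forall i : nat, exists q : T, [/\ nc (fU q.1.1 - lo t i%:Z) <= e,
    nc (fV q.1.2 - di t i%:Z) <= e & nc (fW q.2 - up t i%:Z) <= e].
  move=> i; have [h1 h2 h3] := ht i%:Z.
  have [q1 ?] := dU _ h1 _ e0; have [q2 ?] := dV _ h2 _ e0; have [q3 ?] := dW _ h3 _ e0.
  by exists (q1, q2, q3).
have [k hk] := hs (mkseq g n); exists k => i iN.
have [h1 h2 h3] := gP i.
have e1 : s `|(k%:Z + i%:Z)%R|%N = g i.
  by rewrite -PoszD absz_nat hk ?size_mkseq// nth_mkseq.
by split; rewrite /= -normcN opprB e1.
Qed.

Lemma PsiE_section (R : realType) (U V W : set R[i]) c :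
  (forall (n : nat) t e, jacobi_in U V W t -> 0 < e ->
    exists k : nat, forall i : nat, (i < n)%N -> jacobi_close t (shift_jac k%:Z c) i%:Z e) ->
  U !=set0 -> V !=set0 -> W !=set0 ->
  forall n (B : 'M[R[i]]_n), M_n U V W B -> forall eps, 0 < eps -> exists k : nat,
    `|B - \matrix_(i < n, j < n) jacobi_mx c (k%:Z + i%:Z) (k%:Z + j%:Z)| < (eps%:C)%C.
Proof.
move=> happ U0 V0 W0 n B hB eps eps0; have [t ht tB] := M_n_jacobi U0 V0 W0 hB.
have e2 : 0 < eps / 2 by rewrite divr_gt0.
have [k hk] := happ n t _ ht e2; exists k; apply/(mx_norm_ltP _ _ eps0) => i j.
rewrite mxE jacobi_mx_shift -tB.
by apply: le_lt_trans (jacobi_mx_close _ (ltW e2) (hk i (ltn_ord i))) _; lra.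
Qed.

Lemma PsiE_semi_nonempty (R : realType) (U V W : set R[i]) :
  U !=set0 -> V !=set0 -> W !=set0 -> exists A, PsiE_semi U V W A.
Proof.
move=> U0 V0 W0; have [c hc happ] := jacobi_approximating U0 V0 W0.
exists (jacobi_op Posz c); split=> [i j|n n0 B hB eps eps0]; first exact: jacobi_in_entry.
by have [k hk] := PsiE_section happ U0 V0 W0 hB eps0; exists k.
Qed.

Lemma PsiE_bi_nonempty (R : realType) (U V W : set R[i]) :
  U !=set0 -> V !=set0 -> W !=set0 -> exists A, PsiE_bi U V W A.
Proof.
move=> U0 V0 W0; have [c hc happ] := jacobi_approximating U0 V0 W0.
exists (jacobi_op id c); split=> [i j|n n0 B hB eps eps0]; first exact: jacobi_in_entry.
have [k hk] := PsiE_section happ U0 V0 W0 hB eps0; exists (k%:Z - 1).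
rewrite (_ : \matrix_(i, j) _ = \matrix_(i < n, j < n) jacobi_mx c (k%:Z + i%:Z) (k%:Z + j%:Z))//.
apply/matrixP => i j; rewrite !mxE /jacobi_op.
by congr (jacobi_mx _ _ _); clear; lia.
Qed.

(** * Semi-infinite operators of index 0 *)

Lemma compact_normc_bounded (R : realType) (X : set R[i]) :
  compact (X : set R[i]^o) -> exists N : nat, forall x, X x -> nc x <= N%:R.
Proof.
move=> /compact_near_coveringP cX.
have [] := cX nat \oo (fun n x => nc x <= n%:R) _.
  move=> x Xx; pose N := Num.bound (nc x + 1).
  exists (ball (x : R[i]^o) 1, [set n | (N <= n)%N]) => /=.
    by split; [exact: nbhsx_ballx|exists N].
  move=> [y n] [/= xy Nn].
  have {}xy : nc (x - y) < 1.
    by move: xy; rewrite -ball_normE /= -normc_normr (ltcR _ 1).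
  have hN : nc x + 1 < N%:R.
    by apply: archi_boundP; rewrite addr_ge0 ?normc_ge0.
  have hn : N%:R <= n%:R :> R by rewrite ler_nat.
  have -> : y = x - (x - y) by ring.
  have := normcB x (x - y); lra.
by move=> N _ h; exists N => x Xx; exact: (h N (leqnn N)).
Qed.

Lemma jacobi_bound (R : realType) (U V W : set R[i]) :
  compact (U : set R[i]^o) -> compact (V : set R[i]^o) -> compact (W : set R[i]^o) ->
  exists2 b : R, 0 < b & forall x, U x \/ V x \/ W x -> nc x <= b.
Proof.
move=> /compact_normc_bounded[l hl] /compact_normc_bounded[m hm] /compact_normc_bounded[n hn].
have ge k : k%:R <= (l + m + n).+1%:R :> R -> forall x : R[i], nc x <= k%:R ->
    nc x <= (l + m + n).+1%:R by move=> h x hx; apply: le_trans h.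
exists (l + m + n).+1%:R => // x [/hl|[/hm|/hn]]; apply: ge; rewrite ler_nat; lia.
Qed.

Lemma uniformly_elliptic_of_codim (R : realType) (I : choiceType) (e : I -> int)
    (U V W : set R[i]) (c : jacobi R) (b : R) (p : \bar R) (d : nat) : (1 <= p)%E ->
  injective e -> pseudoergodic e U V W c -> 0 < b ->
  (forall x, U x \/ V x \/ W x -> nc x <= b) ->
  quotient_dim (lp p) (image_space p (jacobi_op e c)) d ->
  exists K, uniformly_elliptic U V W b K.
Proof.
move=> p1 einj erg b0 hb qd.
have [[K K0 h]|nLB] := pselect (exists2 K, 0 < K & lower_bound U V W K).
  by exists K; split.
exfalso; apply: humps_infinite_codim qd => //.
  by move=> a x y; exact: mxact_jacobi_linear.
by move=> eps s; exact: (pseudoergodic_hump p1 einj erg b0 hb nLB).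
Qed.

Lemma Posz_inj : injective Posz.
Proof. by move=> m n []. Qed.

Lemma extend0_Posz (R : realType) (x : nat -> R[i]) (n : nat) :
  extend0 Posz x n%:Z = x n.
Proof. by rewrite /extend0 preimK//; exact: Posz_inj. Qed.

Lemma extend0_neg (R : realType) (x : nat -> R[i]) (k : int) : k < 0 ->
  extend0 Posz x k = 0.
Proof.
move=> k0; rewrite /extend0; case h : (preim Posz k) => [n|//].
by move: k0; rewrite -(preim_Some h).
Qed.

Lemma lp_normc_le (R : realType) (p : \bar R) (I : choiceType) (x : I -> R[i]) :
  (1 <= p)%E -> lp p x -> exists2 M, 0 <= M & forall i, nc (x i) <= M.
Proof.
move=> p1 /(lpP p1)[M M0 h]; exists M => // i.
exact: (lp_bounded_coord p1 i M0 h).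
Qed.

Lemma lp_delta (R : realType) (p : \bar R) (I : choiceType) (i : I) : (1 <= p)%E ->
  lp p (fun j => if j == i then 1 else 0 : R[i]).
Proof. by move=> p1; apply/(lpP p1); exists 1 => //; exact: lp_bounded_delta. Qed.

Lemma lp_opp (R : realType) (p : \bar R) (I : choiceType) (x : I -> R[i]) : (1 <= p)%E ->
  lp p x -> lp p (fun i => - x i).
Proof.
move=> p1 /(lpP p1)[M M0 h]; apply/(lpP p1); exists M => //.
by apply: lp_bounded_mono h => // i; rewrite normcN.
Qed.

Lemma lp0 (R : realType) (p : \bar R) (I : choiceType) : (1 <= p)%E ->
  lp p (fun _ : I => 0 : R[i]).
Proof. by move=> p1; apply/(lpP p1); exists 0 => //; exact: lp_bounded0. Qed.

Lemma geometric_sum_le (R : realType) (q : R) (n : nat) : 0 <= q -> q < 1 ->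
  \sum_(m < n) q ^+ m <= (1 - q)^-1.
Proof.
move=> q0 q1; have h : 0 < 1 - q by rewrite subr_gt0.
rewrite -[leRHS]mul1r ler_pdivlMr// mulrC.
have -> : (1 - q) * \sum_(m < n) q ^+ m = 1 - q ^+ n.
  elim: n => [|n ih]; first by rewrite big_ord0 expr0 mulr0 subrr.
  by rewrite big_ord_recr /= mulrDr ih exprS; ring.
by rewrite gerBl exprn_ge0.
Qed.

(** Young's inequality for a geometric kernel: the right-hand side is a sum of shifts of |y|, none
    of which increases the norm, with summable coefficients. *)
Lemma lp_convolution (R : realType) (p : \bar R) (x y : nat -> R[i]) (C q : R) :
  (1 <= p)%E -> 0 <= C -> 0 <= q -> q < 1 -> lp p y ->
  (forall i, nc (x i) <= \sum_(m < i.+1) C * q ^+ m * nc (y (i - m)%N)) -> lp p x.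
Proof.
move=> p1 C0 q0 q1 /(lpP p1)[M M0 hy] hx.
have q10 : 0 <= (1 - q)^-1 by rewrite invr_ge0 subr_ge0 ltW.
apply/(lpP p1); exists (C * (1 - q)^-1 * M); first by rewrite !mulr_ge0.
apply: (lp_bounded_fatou p1) => s.
have [J hJ] : exists J, forall i, i \in s -> (i < J)%N.
  elim: s => [|i s [J hJ]]; first by exists 0%N.
  exists (maxn J i.+1) => j; rewrite inE => /orP[/eqP ->|/hJ h].
    by rewrite leq_max leqnn orbT.
  by rewrite leq_max h.
pose h (m i : nat) := if (m <= i)%N then Some (i - m)%N else None.
pose ny i := (nc (y i))%:C%C.
have hny : lp_bounded p M ny.
  by apply: lp_bounded_mono hy => // i; rewrite normcR ger0_norm ?normc_ge0.
exists (fun i => \sum_(m < J) (C * q ^+ m)%:C%C * oapp ny 0 (h m i)).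
  have : lp_bounded p (\sum_(m < J) nc ((C * q ^+ m)%:C%C : R[i]) * M)
      (fun i => \sum_(m < J) (C * q ^+ m)%:C%C * oapp ny 0 (h m i)).
    apply: (lp_bounded_sum p1) => m; first by rewrite mulr_ge0 ?normc_ge0.
    apply: (lp_bounded_scale p1) => //; apply: (lp_bounded_reindex p1) => // j j' i.
    rewrite /h; case: ifP => // h1 [<-]; case: ifP => // h2 [].
    by clear -h1 h2; lia.
  apply: (lp_bounded_le p1).
    by apply: sumr_ge0 => m _; rewrite mulr_ge0 ?normc_ge0.
  rewrite -mulr_suml ler_wpM2r//.
  rewrite (eq_bigr (fun m : 'I_J => C * q ^+ m)); last first.
    by move=> m _; rewrite normcR ger0_norm// mulr_ge0// exprn_ge0.
  by rewrite -mulr_sumr ler_wpM2l// geometric_sum_le.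
move=> i /hJ iJ; apply: le_trans (hx i) _.
have -> : \sum_(m < J) (C * q ^+ m)%:C%C * oapp ny 0 (h m i) =
    (\sum_(m < J) (C * q ^+ m * (if (m <= i)%N then nc (y (i - m)%N) else 0)))%:C%C.
  rewrite rmorph_sum; apply: eq_bigr => m _; rewrite [RHS]rmorphM; congr (_ * _).
  by rewrite /h; case: ifP.
have t0 (m : nat) : 0 <= C * q ^+ m * (if (m <= i)%N then nc (y (i - m)%N) else 0).
  by rewrite !mulr_ge0 ?exprn_ge0//; case: ifP => // _; exact: normc_ge0.
rewrite normcR ger0_norm; last by apply: sumr_ge0.
rewrite (big_ord_widen J (fun m => C * q ^+ m * nc (y (i - m)%N)) iJ) big_mkcond /=.
apply: ler_sum => m _; case: ifP => hm; last exact: t0.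
by rewrite -ltnS hm.
Qed.

Lemma lp_geometric (R : realType) (p : \bar R) (x : nat -> R[i]) (C s : R) :
  (1 <= p)%E -> 1 < s -> 0 <= C -> (forall n, nc (x n) * s ^+ n <= C) -> lp p x.
Proof.
move=> p1 s1 C0 hx; have s0 : 0 < s by apply: lt_trans s1.
apply: (@lp_convolution _ p x (fun j => if j == 0%N then 1 else 0) C s^-1 p1 C0).
- by rewrite invr_ge0 ltW.
- by rewrite invf_lt1.
- exact: lp_delta.
move=> i; rewrite big_ord_recr /= subnn eqxx Normc.normc1 mulr1 exprVn.
rewrite -[leLHS]add0r lerD//; last by rewrite ler_pdivlMr// exprn_gt0.
apply: sumr_ge0 => m _; rewrite !mulr_ge0 ?normc_ge0// exprn_ge0// invr_ge0 ltW//.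
Qed.

(** If [Y] contains [X], the coefficients 0 and a basis vector both represent 0, which uniqueness
    forbids for d > 0. *)
Lemma quotient_dim_eq0 (R : realType) (I : choiceType) (X Y : set (I -> R[i])) d :
  X (fun=> 0) -> (forall x, X x -> X (fun i => - x i)) -> X `<=` Y ->
  quotient_dim X Y d -> d = 0%N.
Proof.
move=> X0 XN XY [e [Xe hq]]; case: d e Xe hq => // d e Xe hq.
have [c [_ cu]] := hq _ X0.
have h0 : Y (fun i => 0 - \sum_(k < d.+1) (0 : 'rV[R[i]]_d.+1) 0 k * e k i).
  rewrite (_ : (fun i => _) = (fun=> 0)); first exact: XY.
  by apply/funext => i; rewrite big1 ?subr0// => k _; rewrite mxE mul0r.
have h1 : Y (fun i => 0 - \sum_(k < d.+1) (delta_mx 0 ord0 : 'rV[R[i]]_d.+1) 0 k * e k i).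
  rewrite (_ : (fun i => _) = (fun i => - e ord0 i)); first exact/XY/XN.
  apply/funext => i; rewrite (bigD1 ord0)//= big1 ?addr0 ?sub0r.
    by rewrite mxE !eqxx mul1r.
  by move=> k k0; rewrite mxE (negbTE k0) mul0r.
have := cu _ h0; rewrite (cu _ h1) => /matrixP /(_ 0 ord0) /eqP.
by rewrite !mxE !eqxx oner_eq0.
Qed.

Lemma quotient_dim0 (R : realType) (I : choiceType) (X Y : set (I -> R[i])) :
  quotient_dim X Y 0 -> X `<=` Y.
Proof.
move=> [e [_ hq]] x Xx; have [c [hc _]] := hq _ Xx.
rewrite (_ : x = (fun i => x i - \sum_(k < 0) c 0 k * e k i))//.
by apply/funext => i; rewrite big_ord0 subr0.
Qed.

Lemma jact_sum (R : realType) (c : jacobi R) (n : nat) (a : nat -> R[i])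
    (Z : nat -> int -> R[i]) i :
  jact c (fun j => \sum_(k < n) a k * Z k j) i = \sum_(k < n) a k * jact c (Z k) i.
Proof.
elim: n => [|n ih]; first by rewrite /jact !big_ord0 !mulr0 !addr0.
by rewrite big_ord_recr /= -ih /jact !big_ord_recr /=; ring.
Qed.

Lemma decay_rate_gt1 (R : realType) (b K : R) : 0 < b -> 0 < K -> 1 < decay_rate b K.
Proof. by move=> b0 K0; rewrite /decay_rate ltrDl invr_gt0 -mulrA mulr_gt0// mulr_gt0. Qed.

(** A null vector starting at k + 1 is mapped to [up c k] times the k-th unit vector, and [up c k]
    is bounded away from 0. Superposing these solves c x = y; each entry of [x] is a finite sum, and
    the decay makes it a convolution estimate. *)
Lemma semi_surjective (R : realType) (U V W : set R[i]) (b K : R) (c : jacobi R)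
    (p : \bar R) : (1 <= p)%E ->
  uniformly_elliptic U V W b K -> has_half_kernel U V W -> jacobi_in U V W c ->
  lp p `<=` image_space p (jacobi_op Posz c).
Proof.
move=> p1 ell hk hc y ly; have [b0 K0 _ _] := ell.
have /choice[Z hZ] := fun k : nat => half_kernels_everywhere ell hk hc (k.+1)%:Z.
have upK k : 1 <= K * nc (up c k%:Z).
  have [_ _ _ _] := hZ k; rewrite (_ : k.+1%:Z - 1 = k%:Z)//; clear; lia.
have up0 k : up c k%:Z != 0.
  by rewrite -normc_gt0 -(pmulr_rgt0 _ K0); apply: lt_le_trans (upK k).
pose a k := y k / up c k%:Z.
pose x i := \sum_(k < i) a k * Z k i%:Z.
have xE n j : j <= n%:Z -> extend0 Posz x j = \sum_(k < n) a k * Z k j.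
  move=> jn; case: j jn => j jn; last first.
    rewrite extend0_neg// big1// => k _; have [_ h _ _ _] := hZ k.
    by rewrite h ?mulr0//; clear; lia.
  rewrite extend0_Posz /x (big_ord_widen n (fun k => a k * Z k j%:Z)) ?big_mkcond//=.
  apply: eq_bigr => k _; case: ifP => // hkj; have [_ h _ _ _] := hZ k.
  by rewrite h ?mulr0//; clear -hkj; lia.
set s := decay_rate b K; have s1 : 1 < s by exact: decay_rate_gt1.
have s0 : 0 < s by apply: lt_trans s1.
exists x; last first.
  apply/funext => i; rewrite mxact_jacobi; last exact: Posz_inj.
  transitivity (jact c (fun j => \sum_(k < i.+1) a k * Z k j) i%:Z).
    rewrite /jact !(xE i.+1)//; clear; lia.
  rewrite jact_sum big_ord_recr /= big1 ?add0r => [|k _]; last first.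
    have [_ _ h _ _] := hZ k; rewrite h ?mulr0//.
    by have := ltn_ord k; clear; lia.
  have [h1 h2 _ _ _] := hZ i; rewrite /jact.
  rewrite (h2 (i%:Z - 1)); last by clear; lia.
  rewrite (h2 i%:Z); last by clear; lia.
  rewrite (_ : i%:Z + 1 = i.+1%:Z); last by clear; lia.
  by rewrite h1 !mulr0 !add0r mulr1 /a divfK.
(* Since [Z k] starts at k + 1, entry [i] of [x] involves y at i - 1 and below; the shift by one
   matches this with [lp_convolution]. *)
pose y' i := oapp y 0 (if (0 < i)%N then Some i.-1 else None).
have ly' : lp p y'.
  have [M M0 hM] := (lpP p1 _).1 ly; apply/(lpP p1); exists M => //.
  apply: (lp_bounded_reindex p1) => // j j' i.
  by case: j => [//|j] [<-]; case: j' => [//|j'] [<-].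
apply: (@lp_convolution _ p x y' (2 * (K * b) * K) s^-1 p1 _ _ _ ly').
- by rewrite !mulr_ge0// ltW.
- by rewrite invr_ge0 ltW.
- by rewrite invf_lt1.
move=> i; apply: le_trans (normc_sum _ _ _) _.
rewrite big_ord_recr /= subnn [y' 0%N]/= Normc.normc0 mulr0 addr0.
rewrite (reindex_inj rev_ord_inj) /=; apply: ler_sum => m _.
have mi := ltn_ord m.
have -> : y' (i - m)%N = y (i - m.+1)%N by rewrite /y' ifT ?subn_gt0//= -subnS.
have [_ _ _ hd _] := hZ (i - m.+1)%N.
have := hd m; rewrite (_ : (i - m.+1).+1%:Z + m%:Z = i%:Z); last by clear -mi; lia.
rewrite -ler_pdivlMr ?exprn_gt0// -exprVn => h.
rewrite Normc.normcM /a Normc.normcM Normc.normcV.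
set Y := nc (y _); have Y0 : 0 <= Y := normc_ge0 _.
have hu : (nc (up c (i - m.+1)%N%:Z))^-1 <= K.
  rewrite -[leLHS]mul1r ler_pdivrMr ?normc_gt0//; exact: upK.
have hu0 : 0 <= (nc (up c (i - m.+1)%N%:Z))^-1 by rewrite invr_ge0 normc_ge0.
have := ler_wpM2l Y0 (ler_pM hu0 (normc_ge0 _) hu h).
by rewrite mulrA => /le_trans; apply; rewrite le_eqVlt; apply/orP; left; apply/eqP; ring.
Qed.

(** If c x is the first unit vector and [z] is a decaying null vector of the transpose, their
    discrete Wronskian is constantly 1; but it tends to 0 because [x] is bounded. *)
Lemma semi_not_surjective (R : realType) (U V W : set R[i]) (b K : R) (c : jacobi R)
    (p : \bar R) : (1 <= p)%E ->
  uniformly_elliptic U V W b K -> has_half_kernel W V U -> jacobi_in U V W c ->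
  ~ lp p `<=` image_space p (jacobi_op Posz c).
Proof.
move=> p1 ell hk hc surj; have [b0 K0 hb _] := ell.
have [z [z1 z0 zk dec _]] := half_kernels_everywhere (uniformly_elliptic_reflect ell)
  hk (jacobi_in_transpose hc) 0.
set s := decay_rate b K in dec; have s1 : 1 < s by exact: decay_rate_gt1.
have s0 : 0 < s by apply: lt_trans s1.
have [x lx xE] := surj _ (lp_delta 0%N p1).
have [M M0 xM] := lp_normc_le p1 lx.
pose X := extend0 Posz x.
have XM i : nc (X i) <= M.
  by rewrite /X; case: i => i; rewrite ?extend0_Posz// extend0_neg// Normc.normc0.
(* The boundary term in Green's identity for [c] and its transpose. *)
pose D (i : int) := z i * up c i * X (i + 1) - z (i + 1) * lo c (i + 1) * X i.
have stepD i : 0 <= i -> z i * jact c X i = D i - D (i - 1).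
  move=> i0; have : jact (transpose_jac c) z i * X i = 0 by rewrite zk// mul0r.
  rewrite /jact /transpose_jac /D /= subrK => e.
  by rewrite -[LHS]subr0 -e; ring.
have D1 (n : nat) : D n%:Z = 1.
  elim: n => [|n ih].
    have Dm1 : D (0 - 1) = 0.
      by rewrite /D (z0 (0 - 1))// /X (@extend0_neg _ x (0 - 1))// mulr0 !mul0r subr0.
    have := stepD 0 (lexx _); rewrite Dm1 subr0 z1 mul1r => <-.
    by rewrite -(mxact_jacobi c x 0%N Posz_inj) xE eqxx.
  have := stepD n.+1%:Z isT; rewrite -(mxact_jacobi c x n.+1 Posz_inj) xE mulr0.
  rewrite (_ : n.+1%:Z - 1 = n%:Z); last by clear; lia.
  by rewrite ih => /esym/eqP; rewrite subr_eq0 => /eqP.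
have zb (n : nat) : nc (z n%:Z) * s ^+ n <= 2 * (K * b).
  by have := dec n; rewrite add0r.
have [n hn] := @exp_unbounded R s (4 * (K * b) * b * M + 1) 1 s1 ltr01.
have cb i : nc (lo c i) <= b /\ nc (up c i) <= b.
  by have [? ? ?] := hc i; split; apply: hb; tauto.
have : 1 <= nc (z n%:Z) * (b * M) + nc (z (n%:Z + 1)) * (b * M).
  rewrite -[leLHS](Normc.normc1 R) -(D1 n); apply: le_trans (normcB _ _) _.
  rewrite !Normc.normcM -!mulrA; apply: lerD; rewrite ler_wpM2l ?normc_ge0//.
    by rewrite ler_pM ?normc_ge0 ?(cb _).2.
  by rewrite ler_pM ?normc_ge0 ?(cb _).1.
have sn0 : 0 < s ^+ n by rewrite exprn_gt0.
rewrite -(ler_pM2r sn0) mul1r => h.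
have h1 := zb n.
have h2 : nc (z (n%:Z + 1)) * s ^+ n <= 2 * (K * b).
  apply: le_trans (zb n.+1); rewrite (_ : n.+1%:Z = n%:Z + 1); last by clear; lia.
  by rewrite ler_wpM2l ?normc_ge0// ler_weXn2l// ltW.
have bM : 0 <= b * M by rewrite mulr_ge0// ltW.
have h3 := ler_wpM2r bM h1; have h4 := ler_wpM2r bM h2.
by rewrite mul1r in hn; clear -h h3 h4 hn; lra.
Qed.

(** A null vector over (U,V,W) makes the operator surjective with a nontrivial kernel. One over
    (W,V,U) makes it non-surjective, and then [coburn] makes its kernel trivial. In neither case do
    the dimensions agree. *)
Lemma index0_no_half_kernel (R : realType) (U V W : set R[i]) (b : R) (c : jacobi R)
    (p : \bar R) : (1 <= p)%E -> 0 < b ->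
  (forall x, U x \/ V x \/ W x -> nc x <= b) ->
  pseudoergodic Posz U V W c -> fredholm_index p (jacobi_op Posz c) 0 ->
  has_half_kernel U V W \/ has_half_kernel W V U -> False.
Proof.
move=> p1 b0 hb erg [n [m [qn qm nm]]].
have {nm} nm : n = m by clear -nm; lia.
have [K ell] := uniformly_elliptic_of_codim p1 Posz_inj erg b0 hb qm.
have [hc _] := erg; have [_ K0 _ _] := ell.
have lin := mxact_jacobi_linear c _ _ _ Posz_inj.
have null0 : null_space p (jacobi_op Posz c) (fun=> 0).
  split; first exact: lp0.
  apply/funext => i; rewrite mxact_jacobi; last exact: Posz_inj.
  have E k : extend0 Posz (fun=> 0) k = 0 :> R[i] by rewrite /extend0; case: preim.
  by rewrite /jact !E !mulr0 !addr0.
have nullN x : null_space p (jacobi_op Posz c) x ->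
    null_space p (jacobi_op Posz c) (fun i => - x i).
  move=> [lx Ax]; split; first exact: lp_opp.
  have -> : (fun i => - x i) = (fun i => (-1) * x i + (fun=> 0) i).
    by apply/funext => i; rewrite mulN1r addr0.
  by rewrite lin Ax null0.2; apply/funext => i; rewrite mulr0 addr0.
case=> hk.
- have m0 : m = 0%N.
    apply: quotient_dim_eq0 qm; first exact: lp0.
      by move=> x; exact: lp_opp.
    exact: (semi_surjective p1 ell hk hc).
  rewrite nm m0 in qn; have qn' := quotient_dim0 qn.
  have [z [z1 z0 zk dec _]] := half_kernels_everywhere ell hk hc 0.
  have lz : lp p (fun n : nat => z n%:Z).
    apply: (@lp_geometric _ p _ (2 * (K * b)) (decay_rate b K)) => //.
    - exact: decay_rate_gt1.
    - by rewrite !mulr_ge0// ltW.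
  have : null_space p (jacobi_op Posz c) (fun n : nat => z n%:Z).
    split=> //; apply/funext => i; rewrite mxact_jacobi; last exact: Posz_inj.
    have E k : extend0 Posz (fun n : nat => z n%:Z) k = z k.
      by case: k => k; rewrite ?extend0_Posz// extend0_neg// z0.
    by rewrite /jact !E; exact: zk.
  move=> /qn' /= /(congr1 (fun f => f 0%N)) /=; rewrite z1 => /eqP.
  by rewrite oner_eq0.
- have n0 : n <> 0%N.
    move=> n0; rewrite -nm n0 in qm.
    exact: (semi_not_surjective p1 ell hk hc (quotient_dim0 qm)).
  apply: n0; apply: quotient_dim_eq0 qn => // x [lx Ax] /=.
  apply: contrapT => xn0.
  have [i xi] : exists i, x i != 0.
    apply: contrapT => h; apply: xn0; apply/funext => i.
    by apply/eqP; apply: contrapT => /negP hi; apply: h; exists i.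
  have [M M0 xM] := lp_normc_le p1 lx.
  apply: (coburn ell _ hk); exists c, (extend0 Posz x), M; split=> //.
  + split=> k k0; first exact: extend0_neg.
    have := congr1 (fun f => f `|k|%N) Ax.
    by rewrite /= mxact_jacobi ?gez0_abs//; exact: Posz_inj.
  + by move=> k; case: k => k; rewrite ?extend0_Posz// extend0_neg// Normc.normc0.
  + by exists i%:Z; rewrite extend0_Posz.
Qed.

(** * The finite section method *)

Lemma invertible_fredholm_index0 (R : realType) (I : choiceType) (p : \bar R)
    (A : I -> I -> R[i]) : (1 <= p)%E -> invertible p A -> fredholm_index p A 0.
Proof.
move=> p1 [M [B [[_ Bb] Binv]]]; exists 0%N, 0%N; split => //.
- exists (fun=> fun=> 0); split=> [[]//|x [lx Ax]]; exists 0; split; last first.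
    by move=> c _; apply/rowP => -[].
  have A0 : mxact A (fun=> 0) = (fun=> 0).
    by apply/funext => i; apply: fsbig1 => j _; rewrite mulr0.
  have x0 : x = (fun=> 0).
    by rewrite -(Binv x lx).2 Ax -{1}A0 (Binv _ (lp0 I p1)).2.
  by rewrite x0; apply/funext => i; rewrite big_ord0 subr0.
- exists (fun=> fun=> 0); split=> [[]//|x lx]; exists 0; split; last first.
    by move=> c _; apply/rowP => -[].
  exists (B x); first exact: (Bb x lx).1.
  by rewrite (Binv x lx).1; apply/funext => i; rewrite big_ord0 subr0.
Qed.

(** Both forms of convergence bound the entries of the truncated solutions uniformly, which is what
    [fsm_blowup] contradicts. *)
Lemma approximates_bounded (R : realType) (I : choiceType) (p : \bar R)
    (y : nat -> I -> R[i]) (x : I -> R[i]) : (1 <= p)%E -> lp p x ->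
  approximates p y x -> exists (M : R) (N : nat),
  forall n, (N <= n)%N -> forall i, nc (y n i) <= M.
Proof.
move=> p1 lx; rewrite /approximates; case: ifP => _.
  move=> [[M [N _ hN]] _]; exists (Num.max 0 M), N => n Nn i.
  have M0 : 0 <= Num.max 0 M by rewrite le_max lexx.
  apply: (lp_bounded_coord p1 i M0); apply/(lpnorm_leP p1) => //.
  by apply: le_trans (hN n Nn) _; rewrite lee_fin le_max lexx orbT.
move=> h; have [Mx Mx0 hx] := lp_normc_le p1 lx.
have : nbhs (0 : \bar R)%E [set u | (u < 1%:E)%E].
  by apply: open_nbhs_nbhs; split; [exact: open_ereal_lt_ereal|rewrite /= lte_fin].
move=> /h [N _ hN]; exists (1 + Mx), N => n Nn i.
have hn : (lpnorm p (fun j => y n j - x j)%R <= 1%:E)%E by apply/ltW/hN.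
have := lp_bounded_coord p1 i ler01 ((lpnorm_leP p1 _ ler01).1 hn).
have := hx i; rewrite {2}(_ : y n i = (y n i - x i) + x i); last by ring.
have := normcD (y n i - x i) (x i); clear; lra.
Qed.

(* The right-hand side is built entry by entry: switching on the entry of index
   [n], of size s^-n, moves the n-th truncated solution by at least s^n / C, so one
   of the two choices makes it large, and later entries do not affect it. *)
Lemma fsm_blowup (R : realType) (I : choiceType) (p : \bar R) (A : I -> I -> R[i])
    (D : nat -> set I) (al be : nat -> I) (X : nat -> I -> R[i]) (rho : nat -> R[i])
    (C s : R) : (1 <= p)%E -> 1 < s -> 0 < C ->
  (forall n, finite_set (D n)) -> (forall n, D n (al n)) ->
  (forall m n, D m (be n) -> (n <= m)%N) -> (forall n, D n (be n)) ->
  (forall n, truncated_solution (D n) A (fun i => if i == be n then rho n else 0) (X n)) ->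
  (forall n, 1 <= nc (X n (al n))) ->
  (forall n, nc (rho n) * (s ^+ n * s ^+ n) <= C) ->
  ~ fsm_applies p D A.
Proof.
move=> p1 s1 C0 finD Dal Dbe Dbe' hX X1 hrho [[MB [B [[_ Bb] Binv]]] [N [huniq happ]]].
have s0 : 0 < s by apply: lt_trans s1.
have sn0 n : 0 < s ^+ n by rewrite exprn_gt0.
have binj : injective be.
  by move=> m n e; apply/eqP; rewrite eqn_leq; apply/andP; split; apply: Dbe;
    [rewrite e|rewrite -e]; exact: Dbe'.
pose delta m : I -> R[i] := fun i => if i == be m then 1 else 0.
pose sm m : R[i] := ((s ^+ m)^-1)%:C%C.
have nsm m : nc (sm m) = (s ^+ m)^-1 by rewrite normcR ger0_norm// invr_ge0 ltW.
have comb n g h y z (a : R[i]) : truncated_solution (D n) A g y ->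
    truncated_solution (D n) A h z ->
    truncated_solution (D n) A (fun i => g i + a * h i) (fun i => y i + a * z i).
  move=> [y0 hy] [z0 hz]; split=> [j nj|i Di]; first by rewrite y0// z0// mulr0 addr0.
  rewrite -hy// -hz// fsbig_distrr// -fsbig_split//; apply: eq_fsbigr => j _ /=.
  by ring.
(* Otherwise [X n] would be a second solution of the homogeneous truncated system. *)
have rho0 n : (N <= n)%N -> rho n != 0.
  move=> Nn; apply/eqP => r0; have [y [_ yu]] := huniq n Nn _ (lp0 I p1).
  have h0 : truncated_solution (D n) A (fun=> 0) (fun=> 0).
    by split=> // i _; apply: fsbig1 => j _; rewrite mulr0.
  have h1 : truncated_solution (D n) A (fun=> 0) (X n).
    have [Xz Xr] := hX n; split=> // i Di; rewrite Xr// r0; by case: ifP.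
  have := X1 n; rewrite -(yu _ h1) (yu _ h0) Normc.normc0 ler10.
  by [].
have step mb : exists c : R[i], (c = 0 \/ c = sm mb.1) /\
    (lp p mb.2 -> (N <= mb.1)%N -> forall y,
      truncated_solution (D mb.1) A (fun i => mb.2 i + c * delta mb.1 i) y ->
      s ^+ mb.1 / (2 * C) <= nc (y (al mb.1))).
  case: mb => m g /=.
  have [lg|nlg] := pselect (lp p g); last by exists 0; split; [left|move=> /nlg].
  have [Nm|Nm] := leqP N m; last by exists 0; split; [left|].
  have [y [hy _]] := huniq m Nm g lg.
  have uni c y' : truncated_solution (D m) A (fun i => g i + c * delta m i) y' ->
      y' = (fun i => y i + c / rho m * X m i).
    move=> hy'.
    have lgc : lp p (fun i => g i + c * delta m i).
      have [M M0 hM] := (lpP p1 _).1 lg; apply/(lpP p1).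
      exists (M + nc c * 1); first by rewrite addr_ge0// mulr1 normc_ge0.
      apply: (lp_bounded_add p1) => //; first by rewrite mulr1 normc_ge0.
      by apply: (lp_bounded_scale p1) => //; exact: lp_bounded_delta.
    have [y'' [_ yu]] := huniq m Nm _ lgc.
    rewrite -(yu _ hy'); apply: yu.
    have := comb _ _ _ _ _ (c / rho m) hy (hX m).
    rewrite (_ : (fun i => g i + c / rho m * _) = (fun i => g i + c * delta m i))//.
    apply/funext => i; rewrite /delta; case: ifP; rewrite ?mulr0// mulr1 => _.
    by rewrite divfK// rho0.
  have [h|h] := leP (s ^+ m / (2 * C)) (nc (y (al m))).
    by exists 0; split; [left|move=> _ _ y' /uni ->; rewrite !mul0r addr0].
  exists (sm m); split; [by right|move=> _ _ y' /uni ->].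
  have nr : 0 < nc (rho m) by rewrite normc_gt0 rho0.
  (* The entry s^-m is divided by [rho m], of size at most C s^(-2m). If the displacement is at
     least s^m / C, one of the two candidate solutions reaches half of it. *)
  have big : s ^+ m / C <= nc (sm m / rho m * X m (al m)).
    rewrite !Normc.normcM Normc.normcV nsm -[leLHS]mulr1 ler_pM//.
      by rewrite divr_ge0// ltW.
    rewrite -invfM -[leLHS]invrK lef_pV2 ?posrE ?invr_gt0 ?divr_gt0 ?mulr_gt0//.
    by rewrite invf_div ler_pdivlMr//; have := hrho m; clear; lra.
  have e2 : s ^+ m / C = 2 * (s ^+ m / (2 * C)) by field; rewrite gt_eqF.
  have := normcB (y (al m) + sm m / rho m * X m (al m)) (y (al m)).
  rewrite addrAC subrr add0r => h'; rewrite e2 in big.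
  by move: big h h'; clear; lra.
have /choice[f fP] := step.
pose bb := fix bb m : I -> R[i] :=
  if m is k.+1 then (fun i => bb k i + f (k, bb k) * delta k i) else (fun=> 0).
pose c m := f (m, bb m).
have cc m : c m = 0 \/ c m = sm m by have [] := fP (m, bb m).
pose h (i : I) : option nat :=
  if pselect (exists j, be j == i) is left hj then Some (xchoose hj) else None.
have hbe j : h (be j) = Some j.
  rewrite /h; case: pselect => [hj|[]]; last by exists j.
  by congr Some; apply: binj; apply/eqP; exact: (xchooseP hj).
have hS i j : h i = Some j -> be j = i.
  by rewrite /h; case: pselect => // hj [<-]; apply/eqP; exact: (xchooseP hj).
have bbE m i : bb m i = oapp (fun j => if (j < m)%N then c j else 0) 0 (h i).
  elim: m => [|m ih]; first by case: (h i).
  rewrite [LHS]/= ih /delta; case: eqP => [->|ne].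
    by rewrite hbe [oapp _ _ _]/= ltnn add0r mulr1 [RHS]/= ltnSn.
  rewrite mulr0 addr0; case e : (h i) => [j|//]; rewrite [LHS]/= [RHS]/=.
  have jm : j != m by apply/eqP => jm; apply: ne; rewrite -jm (hS _ _ e).
  by rewrite ltnS (leq_eqVlt j m) (negbTE jm).
have lbb m : lp p (bb m).
  elim: m => [|m ih]; first exact: lp0.
  have [M M0 hM] := (lpP p1 _).1 ih; apply/(lpP p1).
  exists (M + nc (c m) * 1); first by rewrite addr_ge0// mulr1 normc_ge0.
  apply: (lp_bounded_add p1) => //; first by rewrite mulr1 normc_ge0.
  by apply: (lp_bounded_scale p1) => //; exact: lp_bounded_delta.
pose b i := oapp c 0 (h i).
have lb : lp p b.
  have lc : lp p c.
    apply: (@lp_geometric _ p c 1 s) => // n.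
    have [->|->] := cc n; first by rewrite Normc.normc0 mul0r.
    by rewrite nsm mulVf// gt_eqF.
  have [M M0 hM] := (lpP p1 _).1 lc; apply/(lpP p1); exists M => //.
  by apply: (lp_bounded_reindex p1) => // i i' j /hS <- /hS <-.
have /choice[y hy] : forall n, exists y, (N <= n)%N -> truncated_solution (D n) A b y.
  move=> n; have [Nn|_] := leqP N n; last by exists (fun=> 0).
  by have [y [hy _]] := huniq n Nn b lb; exists y.
have [lx Ax] : lp p (B b) /\ mxact A (B b) = b.
  by split; [exact: (Bb b lb).1|exact: (Binv b lb).1].
have [M [N' hM]] := approximates_bounded p1 lx (happ b (B b) y lb lx Ax hy).
have [n0 hn0] := @exp_unbounded R s ((M + 1) * (2 * C)) 1 s1 ltr01.
pose n := maxn n0 (maxn N N').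
have Nn : (N <= n)%N by rewrite /n !leq_max leqnn orbT.
have N'n : (N' <= n)%N by rewrite /n !leq_max leqnn !orbT.
(* Rows in [D n] see only the entries at [be j] with j <= n, so [b] may be replaced by its partial
   sum. *)
have yn : truncated_solution (D n) A (fun i => bb n i + c n * delta n i) (y n).
  have [y0 yr] := hy n Nn; split=> // i Di; rewrite yr// /b.
  rewrite -[RHS]/(bb n.+1 i) bbE; case e : (h i) => [j|//]; rewrite [LHS]/= [RHS]/=.
  by rewrite ltnS (Dbe n j)// (hS _ _ e).
have [_ /(_ (lbb n) Nn _ yn)] := fP (n, bb n).
have := hM n N'n (al n) => h1 h2.
have : M + 1 <= M.
  apply: le_trans h1; apply: le_trans h2; rewrite ler_pdivlMr ?mulr_gt0//.
  apply: le_trans hn0 _; rewrite mul1r ler_weXn2l ?ltW// leq_maxl//.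
by rewrite gerDl ler10.
Qed.

(** A null vector starting with 1 at one end of the window, cut off at the other end, solves the
    truncated system with a right-hand side supported in the last row. Over a window of length 2 n +
    1 the decay makes that entry of order s^(-2n), as [fsm_blowup] requires. *)
Lemma full_fsm_no_half_kernel (R : realType) (U V W : set R[i]) (b : R) (c : jacobi R)
    (p : \bar R) : (1 <= p)%E -> 0 < b ->
  (forall x, U x \/ V x \/ W x -> nc x <= b) ->
  pseudoergodic id U V W c -> full_fsm_bi p (jacobi_op id c) ->
  has_half_kernel U V W \/ has_half_kernel W V U -> False.
Proof.
move=> p1 b0 hb erg fsm hk.
have [m [d [_ qd _]]] := invertible_fredholm_index0 p1 fsm.1.
have [K ell] := uniformly_elliptic_of_codim p1 (@inj_id int) erg b0 hb qd.
have [hc _] := erg; have [_ K0 _ _] := ell.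
set s := decay_rate b K; have s1 : 1 < s by exact: decay_rate_gt1.
have s0 : 0 < s by apply: lt_trans s1.
pose D n := [set j : int | - n%:Z <= j <= n%:Z].
have finD n : finite_set (D n).
  apply: (@sub_finite_set _ _ [set` [seq k%:Z - n%:Z | k <- iota 0 (2 * n).+1]]); last first.
    exact: finite_seq.
  move=> j hj; have {}hj : - n%:Z <= j <= n%:Z := hj.
  suff : j \in [seq k%:Z - n%:Z | k <- iota 0 (2 * n).+1] by [].
  apply/mapP; exists `|(j + n%:Z)%R|%N; last by clear -hj; lia.
  by rewrite mem_iota; clear -hj; lia.
have C0 : 0 < b * (2 * (K * b)) by rewrite !mulr_gt0.
have rowE n (X : int -> R[i]) i : (forall j, ~ D n j -> X j = 0) ->
    \sum_(j \in D n) (jacobi_op id c i j * X j) = jact c X i.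
  move=> X0; rewrite -(@fsbig_jacobi_mx _ _ id (D n) c X i)// => k nk.
  by apply: X0 => Dk; apply: nk; exists k.
have small (n : nat) u v : nc u <= b -> nc v * s ^+ (2 * n).+1 <= 2 * (K * b) ->
    nc (- (u * v)) * (s ^+ n * s ^+ n) <= b * (2 * (K * b)).
  move=> hu hv; rewrite normcN Normc.normcM -mulrA ler_pM ?normc_ge0//.
    by rewrite mulr_ge0 ?normc_ge0// mulr_ge0// exprn_ge0// ltW.
  apply: le_trans hv; rewrite -exprD addnn -mul2n ler_wpM2l ?normc_ge0//.
  by rewrite ler_weXn2l// ltW.
have cb i : nc (lo c i) <= b /\ nc (up c i) <= b.
  by have [? ? ?] := hc i; split; apply: hb; tauto.
case: hk => hk.
- have /choice[z hz] := fun n : nat => half_kernels_everywhere ell hk hc (- n%:Z).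
  pose X (n : nat) i := if i <= n%:Z then z n i else 0.
  apply: (@fsm_blowup _ _ p (jacobi_op id c) D (fun n => - n%:Z) (fun n => n%:Z) X
     (fun n => - (up c n%:Z * z n (n%:Z + 1))) (b * (2 * (K * b))) s) => //.
  + by move=> n; rewrite /D /=; clear; lia.
  + by move=> k n; rewrite /D /=; clear; lia.
  + by move=> n; rewrite /D /=; clear; lia.
  + move=> n; have [_ z0 zk _ _] := hz n.
    have X0 j : ~ D n j -> X n j = 0.
      rewrite /D /X /= => nD; case: ifP => // hj; apply: z0.
      by rewrite ltNge; apply/negP => hj'; apply: nD; rewrite hj' hj.
    split=> // i Di; rewrite rowE//; have hi : - n%:Z <= i <= n%:Z := Di.
    have hi1 : i - 1 <= n%:Z by clear -hi; lia.
    have hi2 : i <= n%:Z by clear -hi; lia.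
    have := zk i ltac:(clear -hi; lia); rewrite /jact /X hi1 hi2 => e.
    case: eqP => [ei|ne]; last by rewrite ifT//; clear -hi ne; lia.
    rewrite ei in e *; rewrite ifF; last by clear; lia.
    by rewrite mulr0 addr0 -[RHS]add0r -e; ring.
  + by move=> n; have [z1 _ _ _ _] := hz n; rewrite /X ifT ?z1 ?Normc.normc1//; clear; lia.
  + move=> n; apply: small; first exact: (cb _).2.
    have [_ _ _ + _] := hz n; move=> /(_ (2 * n).+1).
    by rewrite (_ : - n%:Z + (2 * n).+1%:Z = n%:Z + 1)//; clear; lia.
(* The mirror image: the reflected matrix has null vectors starting at -n, which after reflection
   run from [n] down to -n. *)
- have /choice[z hz] := fun n : nat => half_kernels_everywhere
    (uniformly_elliptic_reflect ell) hk (jacobi_in_reflect hc) (- n%:Z).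
  pose X (n : nat) i := if - n%:Z <= i then z n (- i) else 0.
  apply: (@fsm_blowup _ _ p (jacobi_op id c) D (fun n => n%:Z) (fun n => - n%:Z) X
     (fun n => - (lo c (- n%:Z) * z n (n%:Z + 1))) (b * (2 * (K * b))) s) => //.
  + by move=> n; rewrite /D /=; clear; lia.
  + by move=> k n; rewrite /D /=; clear; lia.
  + by move=> n; rewrite /D /=; clear; lia.
  + move=> n; have [_ z0 zk _ _] := hz n.
    have X0 j : ~ D n j -> X n j = 0.
      rewrite /D /X /= => nD; case: ifP => // hj; apply: z0.
      by rewrite ltNge; apply/negP => hj'; apply: nD; rewrite hj /=; clear -hj'; lia.
    split=> // i Di; rewrite rowE//; have hi : - n%:Z <= i <= n%:Z := Di.
    have hi1 : - n%:Z <= i + 1 by clear -hi; lia.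
    have hi2 : - n%:Z <= i by clear -hi; lia.
    have := zk (- i) ltac:(clear -hi; lia); rewrite /jact /X /= hi1 hi2 opprK.
    rewrite (_ : - i - 1 = - (i + 1)); last by clear; lia.
    rewrite (_ : - i + 1 = - (i - 1)); last by clear; lia.
    move=> e; case: eqP => [ei|ne]; last first.
      rewrite ifT; last by clear -hi ne; lia.
      by rewrite -[RHS]e; ring.
    rewrite ifF; last by rewrite ei; clear; lia.
    rewrite mulr0 add0r -[RHS]add0r -e ei (_ : n%:Z + 1 = - (- n%:Z - 1)); first by ring.
    by clear; lia.
  + by move=> n; have [z1 _ _ _ _] := hz n; rewrite /X ifT ?z1 ?Normc.normc1//; clear; lia.
  + move=> n; apply: small; first exact: (cb _).1.
    have [_ _ _ + _] := hz n; move=> /(_ (2 * n).+1).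
    by rewrite (_ : - n%:Z + (2 * n).+1%:Z = n%:Z + 1)//; clear; lia.
Qed.

Theorem theorem3p3 (R : realType) (U V W : set R[i]) (p : \bar R)
  (U0 : U !=set0) (V0 : V !=set0) (W0 : W !=set0)
  (cU : compact (U : set R[i]^o)) (cV : compact (V : set R[i]^o))
  (cW : compact (W : set R[i]^o))
  (p1 : (1 <= p)%E)
  (H :
    (* a *) (exists A, PsiE_bi U V W A /\ full_fsm_bi p A) \/
    (* b *) (exists A, PsiE_semi U V W A /\ full_fsm_semi p A) \/
    (* c *) (forall A, M_semi U V W A -> invertible p A) \/
    (* d *) (exists M : R,
               forall A, M_semi U V W A -> invertible_with_bound p M A) \/
    (* e *) (exists A, PsiE_semi U V W A /\ invertible p A) \/
    (* f *) ~ Sigma_plus p U V W 0 \/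
    (* g *) (exists A, PsiE_semi U V W A /\ fredholm_index p A 0) \/
    (* h *) (forall A, M_semi U V W A -> fredholm_index p A 0) \/
    (* i *) (compatible p U V W /\ kappa_is p U V W 0) \/
    (* j *) (forall A, M_bi U V W A -> full_fsm_bi p A) \/
    (* k *) (forall A, M_semi U V W A -> full_fsm_semi p A)) :
  forall n : nat, (0 < n)%N ->
  forall F : 'M[R[i]]_n, M_n U V W F -> F \in unitmx.
Proof.
move=> n _ F hF; apply: contraT => sF; exfalso.
have hk := has_half_kernel_singular U0 V0 W0 hF sF.
have [b b0 hb] := jacobi_bound cU cV cW.
have caseG A : PsiE_semi U V W A -> fredholm_index p A 0 -> False.
  move=> /(PsiE_semi_pseudoergodic U0 V0 W0)[c -> erg] ind.
  exact: (index0_no_half_kernel p1 b0 hb erg ind hk).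
have caseA A : PsiE_bi U V W A -> full_fsm_bi p A -> False.
  move=> /PsiE_bi_pseudoergodic[c -> erg] fsm.
  exact: (full_fsm_no_half_kernel p1 b0 hb erg fsm hk).
have caseE A : PsiE_semi U V W A -> invertible p A -> False.
  by move=> hA /(invertible_fredholm_index0 p1); exact: caseG.
(* Conditions on all operators are applied to a pseudoergodic one, which reduces every case to
   [caseA], [caseE] or [caseG]. *)
have [A hA] := PsiE_semi_nonempty U0 V0 W0.
have [A' hA'] := PsiE_bi_nonempty U0 V0 W0.
case: H => [[B [hB h]]|]; first exact: caseA h.
case=> [[B [hB [h _]]]|]; first exact: caseE h.
case=> [h|]; first exact: (caseE _ hA (h A hA.1)).
case=> [[M h]|]; first by apply: (caseE _ hA); exists M; exact: (h _ hA.1).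
case=> [[B [hB h]]|]; first exact: caseE h.
case=> [h|].
  (* A non-invertible pseudoergodic operator would put 0 into the union of the spectra. *)
  apply: (caseE _ hA); apply: contrapT => nA; apply: h; exists A; first exact: hA.1.
  rewrite /spec /=; apply: contra_not nA.
  rewrite (_ : (fun i j => _) = A)//; apply/funext => i; apply/funext => j.
  by case: ifP; rewrite subr0.
case=> [[B [hB h]]|]; first exact: caseG h.
case=> [h|]; first exact: (caseG _ hA (h A hA.1)).
case=> [[_ h]|]; first exact: (caseG _ hA (h A hA.1)).
case=> [h|h]; first exact: (caseA _ hA' (h A' hA'.1)).
exact: (caseE _ hA (h A hA.1).1).
Qed.
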